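(* Let $q\in[0,1)$ and $\beta>0$. The $q$-deformed Segal-Bargmann transform $S_{\mu_p^{(q)}}$ is a unitary map of $L^2(\mu_p^{(q)})$ onto the $q$-deformed Hardy space ${\cal H}^2(\nu_q)$.
   Context: Fix $q\in[0,1)$ and $\beta>0$; all function spaces are complex, inner products are antilinear in the first argument, and $0^0=1$. Notation: $[n]_q=1+q+\cdots+q^{n-1}$ with $[0]_q=0$; $[n]_q!=[1]_q\cdots[n]_q$ with $[0]_q!=1$; $(a;q)_n=\prod_{j=0}^{n-1}(1-aq^j)$ with $(a;q)_0=1$; $(a;q)_\infty=\prod_{j=0}^\infty(1-aq^j)$. The $q$-Charlier polynomials $\{C_n^{(q)}\}_{n\ge0}$ (with parameter $\beta$) are the monic polynomials defined by $C_0^{(q)}=1$, $C_1^{(q)}(x)=x-\beta$ and, for $n\ge1$, $$(x-[n]_q-\beta)C_n^{(q)}(x)=C_{n+1}^{(q)}(x)+\beta[n]_qC_{n-1}^{(q)}(x).$$ The $q$-deformed Poisson measure $\mu_p^{(q)}$ with parameter $\beta$ is the (unique, compactly supported) probability measure on $\mathbb R$ with respect to which the $C_n^{(q)}$ are orthogonal. They form an orthogonal basis of $L^2(\mu_p^{(q)})$ with $\|C_n^{(q)}\|^2_{L^2(\mu_p^{(q)})}=\beta^n[n]_q!$. Let $\Omega_q^\beta=\{z\in\mathbb C: |z|^2<\beta/(1-q)\}$. For $z\in\Omega_q^\beta$ the $q$-deformed coherent state vector is $$E^{(q)}_{\lambda,p}(x,z)=\sum_{n=0}^\infty\frac{C_n^{(q)}(x)}{\beta^n[n]_q!}z^n,$$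 which converges in $L^2(\mu_p^{(q)})$. The $q$-deformed Segal-Bargmann transform of $f\in L^2(\mu_p^{(q)})$ is the function on $\Omega_q^\beta$ given by $$(S_{\mu_p^{(q)}}f)(z)=\langle E^{(q)}_{\lambda,p}(\cdot,\overline z),f\rangle_{L^2(\mu_p^{(q)})}.$$ Let $\nu_q$ be the measure on $\mathbb C$ $$\nu_q(dz)=(q;q)_\infty\sum_{j=0}^\infty\frac{q^j}{(q;q)_j}\lambda^\beta_{r_j}(dz),\qquad r_j=q^{j/2}\sqrt{\frac{\beta}{1-q}},$$ where $\lambda^\beta_{r}$ is the normalized (total mass $1$) Lebesgue measure on the circle of radius $r$ centered at $0$. The $q$-deformed Hardy space ${\cal H}^2(\nu_q)$ is the completion, with respect to the inner product $(F,G)_{{\cal H}^2_q}=\int\overline{F(z)}G(z)\,\nu_q(dz)$, of the space of functions holomorphic on a neighbourhood of the closed disc $\overline{\Omega_q^\beta}$. Its elements are identified with the holomorphic functions $F(z)=\sum_{n\ge0}a_nz^n$ on $\Omega_q^\beta$ such that $\|F\|^2_{{\cal H}^2_q}=\sum_{n\ge0}\beta^n[n]_q!|a_n|^2<\infty$, with $(F,G)_{{\cal H}^2_q}=\sum_{n\ge0}\beta^n[n]_q!\,\overline{a_n}b_n$ for $G(z)=\sum_{n\ge0}b_nz^n$. *)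

(* Defs.v *)
From HB Require Import structures.
From mathcomp Require Import all_boot all_order all_algebra.
From mathcomp Require Import complex.
From mathcomp Require Import all_classical all_reals all_analysis.
From mathcomp Require Import measurable_realfun.

Set Implicit Arguments.
Unset Strict Implicit.
Unset Printing Implicit Defensive.

Import Order.TTheory GRing.Theory Num.Theory.
Import numFieldNormedType.Exports.

Local Open Scope classical_set_scope.
Local Open Scope complex_scope.
Local Open Scope ring_scope.

Section qnumbers.
Context {R : realType}.
Implicit Types (q a : R) (n : nat).

Definition qnat q n : R := \sum_(i < n) q ^+ i.
Definition qfact q n : R := \prod_(1 <= i < n.+1) qnat q i.
Definition qpoch a q n : R := \prod_(j < n) (1 - a * q ^+ j).
Definition qpoch_inf a q : R := lim (qpoch a q n @[n --> \oo]).

End qnumbers.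

(* Topological notions on the complex numbers use the type (R[i])^o, which is
   R[i] seen as a normed module over itself. *)
Section complex_functions.
Context {R : realType}.

Definition sqmod (z : R[i]) : R := complex.Re z ^+ 2 + complex.Im z ^+ 2.

Definition cvgC (u : nat -> (R[i])^o) (l : (R[i])^o) : Prop := u @ \oo --> l.

Definition limC (u : nat -> (R[i])^o) : R[i] := lim (u @ \oo).

Definition holomorphic_near (K : set R[i]) (F : R[i] -> R[i]) : Prop :=
  exists U : set (R[i])^o,
    [/\ open U, K `<=` U
      & forall z, U z -> derivable (F : (R[i])^o -> (R[i])^o) z 1].

Definition Cintegral d (T : measurableType d) (mu : {measure set T -> \bar R})
    (D : set T) (f : T -> R[i]) : R[i] :=
  (\int[mu]_(x in D) complex.Re (f x)) +i* (\int[mu]_(x in D) complex.Im (f x)).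

Definition L2 d (T : measurableType d) (mu : {measure set T -> \bar R})
    (f : T -> R[i]) : Prop :=
  [/\ measurable_fun setT (fun x => complex.Re (f x)),
      measurable_fun setT (fun x => complex.Im (f x))
    & mu.-integrable setT (fun x => (sqmod (f x))%:E)].

Definition l2dot d (T : measurableType d) (mu : {measure set T -> \bar R})
    (f g : T -> R[i]) : R[i] :=
  Cintegral mu setT (fun x => conjc (f x) * g x).

Definition l2sqnorm d (T : measurableType d) (mu : {measure set T -> \bar R})
    (f : T -> R[i]) : R :=
  \int[mu]_x sqmod (f x).

End complex_functions.

Section segal_bargmann.
Context {R : realType}.
Variables q beta : R.

Fixpoint qcharlier (n : nat) : {poly R} :=
  match n with
  | 0%N => 1
  | n'.+1 =>
    match n' with
    | 0%N => 'X - beta%:P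
    | n''.+1 => ('X - (qnat q n' + beta)%:P) * qcharlier n'
                - (beta * qnat q n') *: qcharlier n''
    end
  end.

Definition is_qpoisson (mu : probability R R) : Prop :=
  (exists M : R, mu (~` `[- M, M]) = 0%E) /\
  forall m n, m != n ->
    \int[mu]_x ((qcharlier m).[x] * (qcharlier n).[x]) = 0.

Definition Omega : set R[i] := [set z | sqmod z < beta / (1 - q)].
Definition cOmega : set R[i] := [set z | sqmod z <= beta / (1 - q)].

Definition coherent_psum (z : R[i]) (N : nat) (x : R) : R[i] :=
  \sum_(n < N)
    ((qcharlier n).[x] / (beta ^+ n * qfact q n))%:C * z ^+ n.

(* The sum of the series in L^2(mu); this is a function chosen in its
   almost-everywhere class. *)
Definition coherent (mu : probability R R) (z : R[i]) : R -> R[i] :=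
  xget (fun=> 0) [set E | L2 mu E /\
    (fun N => l2sqnorm mu (fun x => coherent_psum z N x - E x)) @ \oo --> (0 : R)].

Definition segal_bargmann (mu : probability R R) (f : R -> R[i])
    (z : R[i]) : R[i] :=
  l2dot mu (coherent mu (conjc z)) f.

End segal_bargmann.

Section circle.
Context {R : realType}.

Definition circle_param (r : R) (t : measurableTypeR R) : R * R :=
  (r * cos t, r * sin t).

Lemma measurable_circle_param (r : R) :
  measurable_fun setT (circle_param r).
Proof.
apply: measurable_fun_pair; apply: measurable_funM;
  try exact: measurable_cst.
- exact: continuous_measurable_fun (@continuous_cos R).
- exact: continuous_measurable_fun (@continuous_sin R).
Qed.

HB.instance Definition _ (r : R) := isMeasurableFun.Build _ _ _ _
  (circle_param r) (measurable_circle_param r).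

Lemma twopi_gt0 : (0 : R) < 2 * pi.
Proof. by rewrite mulr_gt0 ?pi_gt0. Qed.

Definition circle_prob (r : R) : probability (R * R)%type R :=
  distribution (uniform_prob twopi_gt0) (circle_param r).

Definition toC (p : R * R) : R[i] := p.1 +i* p.2.

End circle.

Section hardy.
Context {R : realType}.
Variables q beta : R.

Definition nu_radius (j : nat) : R :=
  q `^ (j%:R / 2) * Num.sqrt (beta / (1 - q)).

(* The measure lives on R * R, read as the complex plane through toC. For
   0 <= q < 1 all the weights are nonnegative; the absolute values only supply
   the positivity that mscale requires. *)
Definition nu_q : {measure set (R * R)%type -> \bar R} :=
  mscale (`|qpoch_inf q q|%:nng)
    (mseries (fun j => mscale (`|q ^+ j / qpoch q q j|%:nng)
                              (circle_prob (nu_radius j))) 0).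

(* nu_q is carried by the closed disc; restricting the integral to it makes
   it independent of the values of F and G away from the disc. *)
Definition nu_dot (F G : R[i] -> R[i]) : R[i] :=
  Cintegral nu_q (toC @^-1` cOmega q beta)
    (fun p => conjc (F (toC p)) * G (toC p)).

Definition nu_sqnorm (F : R[i] -> R[i]) : R := complex.Re (nu_dot F F).

(* The completion is realized by functions on Omega: a Cauchy sequence of
   functions holomorphic near the closed disc represents its pointwise limit
   on Omega. *)
Definition hardy_approx (F : R[i] -> R[i]) (u : nat -> R[i] -> R[i]) : Prop :=
  [/\ forall k, holomorphic_near (cOmega q beta) (u k),
      forall e : R, 0 < e -> exists N, forall k l, (N <= k)%N -> (N <= l)%N ->
        nu_sqnorm (fun z => u k z - u l z) < e
    & forall z, Omega q beta z -> cvgC (fun k => u k z) (F z)].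

Definition hardy (F : R[i] -> R[i]) : Prop := exists u, hardy_approx F u.

(* As usual for a completion, the value does not depend on the chosen
   approximating sequences. *)
Definition hardy_dot (F G : R[i] -> R[i]) : R[i] :=
  let u := xget (fun _ _ => 0) (hardy_approx F) in
  let v := xget (fun _ _ => 0) (hardy_approx G) in
  limC (fun k => nu_dot (u k) (v k)).

End hardy.

(* Main.v *)
Require Import Defs.
From HB Require Import structures.
From mathcomp Require Import all_boot all_order all_algebra.
From mathcomp Require Import complex.
From mathcomp Require Import all_classical all_reals all_analysis.
From mathcomp Require Import measurable_realfun.
From mathcomp Require Import ring lra zify.

Set Implicit Arguments.
Unset Strict Implicit.
Unset Printing Implicit Defensive.

Import Order.TTheory GRing.Theory Num.Theory.
Import numFieldNormedType.Exports.

Local Open Scope classical_set_scope.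
Local Open Scope complex_scope.
Local Open Scope ring_scope.

(** The q-Charlier polynomials C_n and the powers z^n are orthogonal families,
    in L^2(mu) and in L^2(nu_q) respectively, and their squared norms agree: both
    are cnorm n = beta^n [n]_q!. The transform of f is the power series whose
    coefficients are the Fourier coefficients of f with respect to the C_n
    (segal_bargmann_series), so it sends C_n to z^n. It is therefore unitary as
    soon as both families are complete, and completeness is where the work lies.

    On the side of L^2(mu), the norms come from the three-term recurrence
    (moment_sqr). Completeness (charlier_complete) says that a function
    orthogonal to all polynomials vanishes: iterates of (3 y - y^3) / 2 are
    polynomials that converge boundedly to the sign function, so the integrals of
    such a function over half-lines vanish (poly_orthogonal_ae0). Orthogonal
    series converge in L^2(mu) by riesz_fischer.

    On the side of nu_q, the monomials are orthogonal by integration over circles,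
    and their norms are given by Euler's identity
    (q; q)_oo sum_j q^(j (n+1)) / (q; q)_j = (q; q)_n (euler_identity, l2dot_mono).
    Their completeness in the Hardy space rests on the fact that a complex
    differentiable function on a neighbourhood of the closed disc is the sum of a
    power series that converges uniformly on the disc (taylor). Goursat's theorem
    is proved by subdividing a rectangle (goursat). Applied in the coordinate
    log z, it shows that the mean of a function over circles does not depend on
    the radius, also across a circle where the function is merely continuous at
    one point (cmean_zero). For z (F z - F a) / (z - a) this is Cauchy's formula,
    and expanding the kernel gives the Taylor expansion.

    The relation represents u f says that u is a power series and f an orthogonal
    series with the same coefficients. It holds for some f whenever u is
    holomorphic near the closed disc, it preserves inner products, and it implies
    that f is transformed into u. So an approximating sequence u_k of an element
    of the Hardy space comes from a Cauchy sequence in L^2(mu), and the transform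
    of its limit is the given element (hardy_approx_preimage): the transform is
    onto. Since a power series determines its coefficients
    (power_series_unique), the transform is injective; hence, for the transform
    of f, the limit is f itself, and inner products are preserved in the limit. *)

(** * Complex numbers *)

Section complex_facts.
Context {R : realType}.
Implicit Types (z w : R[i]) (a : R).

Lemma ReD z w : complex.Re (z + w) = complex.Re z + complex.Re w.
Proof. by case: z; case: w. Qed.
Lemma ImD z w : complex.Im (z + w) = complex.Im z + complex.Im w.
Proof. by case: z; case: w. Qed.
Lemma ReN z : complex.Re (- z) = - complex.Re z. Proof. by case: z. Qed.
Lemma ImN z : complex.Im (- z) = - complex.Im z. Proof. by case: z. Qed.
Lemma ReM z w :
  complex.Re (z * w) = complex.Re z * complex.Re w - complex.Im z * complex.Im w.
Proof. by case: z; case: w. Qed.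
Lemma ImM z w :
  complex.Im (z * w) = complex.Re z * complex.Im w + complex.Im z * complex.Re w.
Proof. by case: z => a b; case: w => c d /=; rewrite mulrC (mulrC b). Qed.
Lemma ReJ z : complex.Re (conjc z) = complex.Re z. Proof. by case: z. Qed.
Lemma ImJ z : complex.Im (conjc z) = - complex.Im z. Proof. by case: z. Qed.
Lemma complex_eqP z w : complex.Re z = complex.Re w ->
  complex.Im z = complex.Im w -> z = w.
Proof. by case: z => a b; case: w => c d /= -> ->. Qed.

Definition ReImE := (ReD, ImD, ReN, ImN, ReM, ImM, ReJ, ImJ).

Lemma conjcD z w : conjc (z + w) = conjc z + conjc w.
Proof. by apply: complex_eqP; rewrite !ReImE ?opprD. Qed.
Lemma conjcN z : conjc (- z) = - conjc z.
Proof. by apply: complex_eqP; rewrite !ReImE ?opprD. Qed.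
Lemma conjcB z w : conjc (z - w) = conjc z - conjc w.
Proof. by rewrite conjcD conjcN. Qed.
Lemma conjcM z w : conjc (z * w) = conjc z * conjc w.
Proof. by apply: complex_eqP; rewrite !ReImE; ring. Qed.
Lemma conjcX z n : conjc (z ^+ n) = conjc z ^+ n.
Proof. by elim: n => [|n IH]; rewrite ?expr0 ?conjc1 // !exprS conjcM IH. Qed.
Lemma conjc_sum (I : Type) (s : seq I) (P : pred I) (F : I -> R[i]) :
  conjc (\sum_(i <- s | P i) F i) = \sum_(i <- s | P i) conjc (F i).
Proof. by apply: (big_morph _ conjcD); rewrite conjc0. Qed.

Lemma sqmod_ge0 z : 0 <= sqmod z.
Proof. by rewrite addr_ge0 ?sqr_ge0. Qed.
Lemma sqmodM z w : sqmod (z * w) = sqmod z * sqmod w.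
Proof. by rewrite /sqmod !ReImE; ring. Qed.
Lemma sqmodJ z : sqmod (conjc z) = sqmod z.
Proof. by rewrite /sqmod !ReImE; ring. Qed.
Lemma sqmodN z : sqmod (- z) = sqmod z.
Proof. by rewrite /sqmod !ReImE; ring. Qed.
Lemma sqmodC a : sqmod a%:C = a ^+ 2.
Proof. by rewrite /sqmod /= expr0n addr0. Qed.
Lemma sqmod0 : sqmod (0 : R[i]) = 0.
Proof. by rewrite /sqmod /= expr0n addr0. Qed.
Lemma sqmodD_le z w : sqmod (z + w) <= 2 * sqmod z + 2 * sqmod w.
Proof.
have := sqmod_ge0 (z - w); rewrite /sqmod !ReImE => H.
by rewrite -subr_ge0; apply: le_trans H _; rewrite le_eqVlt; apply/orP; left;
  apply/eqP; ring.
Qed.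
Lemma conj_mul z : conjc z * z = (sqmod z)%:C.
Proof. by apply: complex_eqP; rewrite !ReImE /= /sqmod; ring. Qed.

Lemma sqmodE z : sqmod z = Normc.normc z ^+ 2.
Proof. by case: z => a b /=; rewrite sqr_sqrtr // addr_ge0 ?sqr_ge0. Qed.
Lemma normc_sqrt z : Normc.normc z = Num.sqrt (sqmod z).
Proof. by case: z. Qed.
Lemma normc_ge0 z : 0 <= Normc.normc z.
Proof. by rewrite normc_sqrt sqrtr_ge0. Qed.
Lemma normcC a : Normc.normc a%:C = `|a|.
Proof. by rewrite normc_sqrt sqmodC sqrtr_sqr. Qed.
Lemma le_Re_normc z : `|complex.Re z| <= Normc.normc z.
Proof. by rewrite normc_sqrt -sqrtr_sqr ler_wsqrtr // lerDl sqr_ge0. Qed.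
Lemma le_Im_normc z : `|complex.Im z| <= Normc.normc z.
Proof. by rewrite normc_sqrt -sqrtr_sqr ler_wsqrtr // lerDr sqr_ge0. Qed.
Lemma normc_le z : Normc.normc z <= `|complex.Re z| + `|complex.Im z|.
Proof.
rewrite -(@ler_pXn2r _ 2) ?nnegrE ?normc_ge0 ?addr_ge0 // -sqmodE.
rewrite sqrrD !real_normK ?num_real // /sqmod.
by rewrite addrAC lerDl mulrn_wge0 // mulr_ge0.
Qed.
Lemma normc_conj z : Normc.normc (conjc z) = Normc.normc z.
Proof. by rewrite !normc_sqrt sqmodJ. Qed.
Lemma complex_normE z : `|z| = (Normc.normc z)%:C.
Proof. by rewrite normc_def normc_sqrt. Qed.
Lemma ler_normcD z w : Normc.normc (z + w) <= Normc.normc z + Normc.normc w.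
Proof. by rewrite -lecR rmorphD /= -!complex_normE; exact: ler_normD. Qed.
Lemma normc_opp z : Normc.normc (- z) = Normc.normc z.
Proof. by rewrite !normc_sqrt sqmodN. Qed.
Lemma normc_distC z w : Normc.normc (z - w) = Normc.normc (w - z).
Proof. by rewrite -normc_opp opprB. Qed.
Lemma ler_normcB z w : Normc.normc (z - w) <= Normc.normc z + Normc.normc w.
Proof. by rewrite -(normc_opp w) ler_normcD. Qed.
Lemma normcX z n : Normc.normc (z ^+ n) = Normc.normc z ^+ n.
Proof.
by elim: n => [|n IH]; rewrite ?expr0 ?Normc.normc1 // !exprS Normc.normcM IH.
Qed.
Lemma ler_normc_sum n (F : nat -> R[i]) :
  Normc.normc (\sum_(i < n) F i) <= \sum_(i < n) Normc.normc (F i).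
Proof.
elim: n => [|n IH]; first by rewrite !big_ord0 Normc.normc0.
by rewrite !big_ord_recr /= (le_trans (ler_normcD _ _)) // lerD.
Qed.
Lemma normc_gt0 z : (0 < Normc.normc z) = (z != 0).
Proof.
rewrite lt_def normc_ge0 andbT; congr (~~ _).
by apply/eqP/eqP => [/Normc.eq0_normc //|->]; rewrite Normc.normc0.
Qed.

(** The balls of R[i] have complex radii; this brings convergence back to that
    of a real sequence. *)
Lemma cvgCP (u : nat -> R[i]) z :
  cvgC u z <-> Normc.normc (u n - z) @[n --> \oo] --> (0 : R).
Proof.
split=> [|] H.
  apply/cvgrPdist_lt => e e0.
  have ec0 : 0 < e%:C :> R[i] by rewrite ltcR.
  move/cvgrPdist_lt : H => /(_ _ ec0); apply: filterS => n.
  rewrite complex_normE ltcR => H.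
  by rewrite sub0r normrN ger0_norm ?normc_ge0 // normc_distC.
apply/cvgrPdist_lt => -[e e'].
rewrite ltcE /= => /andP[/eqP -> e0].
move/cvgrPdist_lt : H => /(_ _ e0); apply: filterS => n.
rewrite sub0r normrN ger0_norm ?normc_ge0 // normc_distC.
by rewrite complex_normE ltcR.
Qed.

Lemma cvgC_unique (u : nat -> R[i]) z w : cvgC u z -> cvgC u w -> z = w.
Proof. by move=> uz uw; exact: (cvg_unique _ uz uw). Qed.

Lemma limC_eq (u : nat -> R[i]) z : cvgC u z -> limC u = z.
Proof. by move=> uz; apply: (cvg_lim _ uz); exact: norm_hausdorff. Qed.

Lemma cvgC_le (u : nat -> R[i]) z (b : nat -> R) :
  (forall n, Normc.normc (u n - z) <= b n) -> b n @[n --> \oo] --> (0 : R) ->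
  cvgC u z.
Proof.
move=> ub b0; apply/cvgCP.
apply: (@squeeze_cvgr _ _ _ _ (fun=> 0) b); last exact: b0.
- by apply: nearW => n; rewrite normc_ge0 ub.
- exact: cvg_cst.
Qed.

Lemma sqrt_cvg0 (b : nat -> R) : b n @[n --> \oo] --> (0 : R) ->
  Num.sqrt (b n) @[n --> \oo] --> (0 : R).
Proof.
move=> b0; rewrite -(@sqrtr0 R); apply: (cvg_comp b (@Num.sqrt R)) b0 _.
exact: sqrt_continuous.
Qed.

Lemma cvgC_sqmod_le (u : nat -> R[i]) z (b : nat -> R) :
  (forall n, sqmod (u n - z) <= b n) -> b n @[n --> \oo] --> (0 : R) ->
  cvgC u z.
Proof.
move=> ub /sqrt_cvg0 b0; apply: cvgC_le b0 => n.
by rewrite normc_sqrt ler_wsqrtr.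
Qed.

Lemma cvgCD (u v : nat -> R[i]) z w : cvgC u z -> cvgC v w ->
  cvgC (fun n => u n + v n) (z + w).
Proof. exact: cvgD. Qed.
Lemma cvgC_cst z : cvgC (fun=> z) z. Proof. exact: cvg_cst. Qed.
End complex_facts.

(** * Square integrable complex functions *)

Section real_integrable.
Context d (T : measurableType d) (R : realType).
Variable mu : {measure set T -> \bar R}.
Implicit Types f g : T -> R.

Definition Rintegrable f := mu.-integrable setT (EFin \o f).

Lemma RintegrableD f g : Rintegrable f -> Rintegrable g ->
  Rintegrable (fun x => f x + g x).
Proof. by move=> fi gi; have := integrableD measurableT fi gi. Qed.

Lemma RintegrableZ a f : Rintegrable f -> Rintegrable (fun x => a * f x).
Proof. by move=> fi; have := integrableZl measurableT a fi. Qed.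

Lemma Rintegrable_measurable f : Rintegrable f -> measurable_fun setT f.
Proof. by move/measurable_int/measurable_EFinP. Qed.

Lemma le_Rintegrable f g : measurable_fun setT f -> Rintegrable g ->
  (forall x, `|f x| <= g x) -> Rintegrable f.
Proof.
move=> mf gi fg; apply: le_integrable gi => //; first exact/measurable_EFinP.
by move=> x _ /=; rewrite lee_fin (le_trans (fg x)) // ler_norm.
Qed.

Lemma bounded_Rintegrable f M : (mu setT < +oo)%E -> measurable_fun setT f ->
  (forall x, `|f x| <= M) -> Rintegrable f.
Proof.
move=> fin mf fM; apply: measurable_bounded_integrable => //.
exists M; split; first exact: num_real.
by move=> r Mr x _; apply: le_trans (fM x) _; exact: ltW.
Qed.

Lemma eq_Rintegrable f g : f =1 g -> Rintegrable f -> Rintegrable g.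
Proof. by move=> /funext ->. Qed.

End real_integrable.

Section L2_space.
Context d (T : measurableType d) (R : realType).
Variable mu : {measure set T -> \bar R}.
Implicit Types (f g h : T -> R[i]) (a : R[i]).

Definition Cintegrable f :=
  Rintegrable mu (fun x => complex.Re (f x)) /\
  Rintegrable mu (fun x => complex.Im (f x)).

Local Notation CI f := (Cintegral mu setT f).

Lemma CintegralD f g : Cintegrable f -> Cintegrable g ->
  CI (fun x => f x + g x) = CI f + CI g.
Proof.
move=> [f1 f2] [g1 g2]; apply: complex_eqP; rewrite ?ReImE /=.
- by under eq_Rintegral do rewrite ReD; rewrite RintegralD.
- by under eq_Rintegral do rewrite ImD; rewrite RintegralD.
Qed.

Lemma CintegralZ a f : Cintegrable f -> CI (fun x => a * f x) = a * CI f.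
Proof.
move=> [f1 f2]; apply: complex_eqP; rewrite ?ReImE /=.
- under eq_Rintegral do rewrite ReM.
  by rewrite RintegralB // ?RintegralZl //; exact: RintegrableZ.
- under eq_Rintegral do rewrite ImM.
  by rewrite RintegralD // ?RintegralZl //; exact: RintegrableZ.
Qed.

Lemma CintegralJ f : Cintegrable f ->
  CI (fun x => conjc (f x)) = conjc (CI f).
Proof.
move=> [f1 f2]; apply: complex_eqP; rewrite ?ReImE /=.
- by under eq_Rintegral do rewrite ReJ.
- under eq_Rintegral do rewrite ImJ -mulN1r.
  by rewrite RintegralZl // mulN1r.
Qed.

Definition Cmeasurable f := measurable_fun setT (fun x => complex.Re (f x)) /\
  measurable_fun setT (fun x => complex.Im (f x)).

Lemma CmeasurableD f g : Cmeasurable f -> Cmeasurable g ->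
  Cmeasurable (fun x => f x + g x).
Proof.
move=> [f1 f2] [g1 g2]; split.
- by under eq_fun do rewrite ReD; exact: measurable_funD.
- by under eq_fun do rewrite ImD; exact: measurable_funD.
Qed.

Lemma CmeasurableM f g : Cmeasurable f -> Cmeasurable g ->
  Cmeasurable (fun x => f x * g x).
Proof.
move=> [f1 f2] [g1 g2]; split.
- under eq_fun do rewrite ReM.
  by apply: measurable_funB; apply: measurable_funM.
- under eq_fun do rewrite ImM.
  by apply: measurable_funD; apply: measurable_funM.
Qed.

Lemma CmeasurableJ f : Cmeasurable f -> Cmeasurable (fun x => conjc (f x)).
Proof.
move=> [f1 f2]; split.
- by under eq_fun do rewrite ReJ.
- by under eq_fun do rewrite ImJ; exact: measurableT_comp.
Qed.

Lemma Cmeasurable_cst a : Cmeasurable (fun=> a).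
Proof. by split; exact: measurable_cst. Qed.

Lemma measurable_sqmod f : Cmeasurable f ->
  measurable_fun setT (fun x => sqmod (f x)).
Proof.
by move=> [f1 f2]; apply: measurable_funD; apply: measurable_funX.
Qed.

Lemma L2P f : L2 mu f <-> Cmeasurable f /\ Rintegrable mu (fun x => sqmod (f x)).
Proof. by split=> [[]|[[]]]. Qed.

Lemma L2_Cmeasurable f : L2 mu f -> Cmeasurable f.
Proof. by move/L2P => []. Qed.

Lemma L2_sqmod f : L2 mu f -> Rintegrable mu (fun x => sqmod (f x)).
Proof. by move/L2P => []. Qed.

Lemma L2_le f (b : T -> R) : Cmeasurable f -> Rintegrable mu b ->
  (forall x, sqmod (f x) <= b x) -> L2 mu f.
Proof.
move=> mf bi fb; apply/L2P; split => //; apply: le_Rintegrable bi _.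
  exact: measurable_sqmod.
by move=> x; rewrite ger0_norm ?sqmod_ge0.
Qed.

Lemma L2D f g : L2 mu f -> L2 mu g -> L2 mu (fun x => f x + g x).
Proof.
move=> /L2P[mf fi] /L2P[mg gi].
apply: (@L2_le _ (fun x => 2 * sqmod (f x) + 2 * sqmod (g x))).
- exact: CmeasurableD.
- by apply: RintegrableD; apply: RintegrableZ.
- by move=> x; exact: sqmodD_le.
Qed.

Lemma L2Z a f : L2 mu f -> L2 mu (fun x => a * f x).
Proof.
move=> /L2P[mf fi]; apply: (@L2_le _ (fun x => sqmod a * sqmod (f x))).
- by apply: CmeasurableM => //; exact: Cmeasurable_cst.
- exact: RintegrableZ.
- by move=> x; rewrite sqmodM.
Qed.

Lemma L2B f g : L2 mu f -> L2 mu g -> L2 mu (fun x => f x - g x).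
Proof.
move=> fi /(L2Z (-1)) gi; have := L2D fi gi.
by under eq_fun do rewrite mulN1r.
Qed.

Lemma L20 : L2 mu (fun=> 0).
Proof.
apply: (@L2_le _ (fun=> 0)); first exact: Cmeasurable_cst.
  exact: integrable0.
by move=> x; rewrite sqmod0.
Qed.

Lemma L2_sum n (F : nat -> T -> R[i]) : (forall k, L2 mu (F k)) ->
  L2 mu (fun x => \sum_(k < n) F k x).
Proof.
move=> FL; elim: n => [|n IH].
  by under eq_fun do rewrite big_ord0; exact: L20.
by under eq_fun do rewrite big_ord_recr /=; exact: L2D.
Qed.

(** |Re (conj f g)| and |Im (conj f g)| are at most |f|^2 + |g|^2. *)
Lemma L2_dot_integrable f g : L2 mu f -> L2 mu g ->
  Cintegrable (fun x => conjc (f x) * g x).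
Proof.
move=> /L2P[mf fi] /L2P[mg gi].
have [m1 m2] := CmeasurableM (CmeasurableJ mf) mg.
have bi := RintegrableD fi gi.
split; apply: le_Rintegrable bi _ => // x.
- rewrite !ReImE ler_norml; apply/andP; split; rewrite -subr_ge0 /sqmod.
  + have := sqr_ge0 (complex.Re (f x) + complex.Re (g x)).
    have := sqr_ge0 (complex.Im (f x) + complex.Im (g x)).
    have := sqr_ge0 (complex.Re (f x)); have := sqr_ge0 (complex.Re (g x)).
    have := sqr_ge0 (complex.Im (f x)); have := sqr_ge0 (complex.Im (g x)).
    nra.
  + have := sqr_ge0 (complex.Re (f x) - complex.Re (g x)).
    have := sqr_ge0 (complex.Im (f x) - complex.Im (g x)).
    have := sqr_ge0 (complex.Re (f x)); have := sqr_ge0 (complex.Re (g x)).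
    have := sqr_ge0 (complex.Im (f x)); have := sqr_ge0 (complex.Im (g x)).
    nra.
- rewrite !ReImE ler_norml; apply/andP; split; rewrite -subr_ge0 /sqmod.
  + have := sqr_ge0 (complex.Re (f x) + complex.Im (g x)).
    have := sqr_ge0 (complex.Im (f x) - complex.Re (g x)).
    have := sqr_ge0 (complex.Re (f x)); have := sqr_ge0 (complex.Re (g x)).
    have := sqr_ge0 (complex.Im (f x)); have := sqr_ge0 (complex.Im (g x)).
    nra.
  + have := sqr_ge0 (complex.Re (f x) - complex.Im (g x)).
    have := sqr_ge0 (complex.Im (f x) + complex.Re (g x)).
    have := sqr_ge0 (complex.Re (f x)); have := sqr_ge0 (complex.Re (g x)).
    have := sqr_ge0 (complex.Im (f x)); have := sqr_ge0 (complex.Im (g x)).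
    nra.
Qed.

Local Notation dot f g := (l2dot mu f g).
Local Notation N f := (l2sqnorm mu f).

Lemma l2dotDr f g h : L2 mu f -> L2 mu g -> L2 mu h ->
  dot f (fun x => g x + h x) = dot f g + dot f h.
Proof.
move=> fi gi hi; rewrite /l2dot -CintegralD; try exact: L2_dot_integrable.
by congr Cintegral; apply/funext => x; rewrite mulrDr.
Qed.

Lemma l2dotZr a f g : L2 mu f -> L2 mu g ->
  dot f (fun x => a * g x) = a * dot f g.
Proof.
move=> fi gi; rewrite /l2dot -CintegralZ; last exact: L2_dot_integrable.
by congr Cintegral; apply/funext => x; rewrite mulrCA.
Qed.

Lemma l2dotJ f g : L2 mu f -> L2 mu g -> dot g f = conjc (dot f g).
Proof.
move=> fi gi; rewrite /l2dot -CintegralJ; last exact: L2_dot_integrable.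
by congr Cintegral; apply/funext => x; rewrite conjcM conjcK mulrC.
Qed.

Lemma l2dotDl f g h : L2 mu f -> L2 mu g -> L2 mu h ->
  dot (fun x => g x + h x) f = dot g f + dot h f.
Proof.
move=> fi gi hi; rewrite (l2dotJ fi) ?l2dotDr //; last exact: L2D.
by rewrite conjcD -!l2dotJ.
Qed.

Lemma l2dotZl a f g : L2 mu f -> L2 mu g ->
  dot (fun x => a * g x) f = conjc a * dot g f.
Proof.
move=> fi gi; rewrite (l2dotJ fi) ?l2dotZr //; last exact: L2Z.
by rewrite conjcM -l2dotJ.
Qed.

Lemma l2dotBr f g h : L2 mu f -> L2 mu g -> L2 mu h ->
  dot f (fun x => g x - h x) = dot f g - dot f h.
Proof.
move=> fi gi hi; rewrite -mulN1r -l2dotZr // -l2dotDr //; last exact: L2Z.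
by congr (dot f _); apply/funext => x; rewrite mulN1r.
Qed.

Lemma l2dotBl f g h : L2 mu f -> L2 mu g -> L2 mu h ->
  dot (fun x => g x - h x) f = dot g f - dot h f.
Proof.
move=> fi gi hi; rewrite (l2dotJ fi) ?l2dotBr //; last exact: L2B.
by rewrite conjcB -!l2dotJ.
Qed.

Lemma l2dot0r f : dot f (fun=> 0) = 0.
Proof.
rewrite /l2dot /Cintegral.
by under eq_Rintegral do rewrite mulr0; under [X in _ +i* X]eq_Rintegral do
  rewrite mulr0; rewrite !Rintegral_cst // !mul0r.
Qed.

Lemma l2dot_sumr f n (F : nat -> T -> R[i]) : L2 mu f ->
  (forall k, L2 mu (F k)) ->
  dot f (fun x => \sum_(k < n) F k x) = \sum_(k < n) dot f (F k).
Proof.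
move=> fi FL; elim: n => [|n IH].
  by under eq_fun do rewrite big_ord0; rewrite big_ord0 l2dot0r.
under eq_fun do rewrite big_ord_recr /=.
by rewrite l2dotDr ?IH ?big_ord_recr //; exact: L2_sum.
Qed.

Lemma l2dot_suml f n (F : nat -> T -> R[i]) : L2 mu f ->
  (forall k, L2 mu (F k)) ->
  dot (fun x => \sum_(k < n) F k x) f = \sum_(k < n) dot (F k) f.
Proof.
move=> fi FL; rewrite (l2dotJ fi) ?l2dot_sumr //; last exact: L2_sum.
by rewrite conjc_sum; apply: eq_bigr => k _; rewrite -l2dotJ.
Qed.

Lemma l2dotff f : dot f f = (N f)%:C.
Proof.
apply: complex_eqP => /=.
  by apply: eq_Rintegral => x _; rewrite conj_mul.
under eq_Rintegral do rewrite conj_mul /=.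
by rewrite Rintegral_cst // mul0r.
Qed.

Lemma l2sqnorm_ge0 f : 0 <= N f.
Proof. by apply: Rintegral_ge0 => x _; exact: sqmod_ge0. Qed.

Lemma l2sqnormD_le f g : L2 mu f -> L2 mu g ->
  N (fun x => f x + g x) <= 2 * N f + 2 * N g.
Proof.
move=> fi gi; have f2 := L2_sqmod fi; have g2 := L2_sqmod gi.
rewrite /l2sqnorm -!RintegralZl // -RintegralD //; try exact: RintegrableZ.
apply: le_Rintegral => //.
- exact: (L2_sqmod (L2D fi gi)).
- by apply: RintegrableD; apply: RintegrableZ.
- by move=> x _; exact: sqmodD_le.
Qed.

Lemma l2sqnormN f g : N (fun x => f x - g x) = N (fun x => g x - f x).
Proof. by apply: eq_Rintegral => x _; rewrite -sqmodN opprB. Qed.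

Lemma l2sqnorm_axpy a f g : L2 mu f -> L2 mu g ->
  N (fun x => f x + a * g x) =
  N f + 2 * complex.Re (a * dot f g) + sqmod a * N g.
Proof.
move=> fi gi; have agi := L2Z a gi.
apply: (@complexI R); rewrite -l2dotff l2dotDl // ?l2dotDr //; last exact: L2D.
rewrite !(l2dotZl a) // !l2dotZr // !l2dotff (l2dotJ fi gi).
by apply: complex_eqP; rewrite !ReImE /= /sqmod; ring.
Qed.

Lemma l2dot_CauchySchwarz f g : L2 mu f -> L2 mu g ->
  sqmod (dot f g) <= N f * N g.
Proof.
move=> fi gi; set c := dot f g.
(* The squared norm of f - t (conj c) g, a quadratic polynomial in t. *)
have key (t : R) : 0 <= N f - 2 * t * sqmod c + t ^+ 2 * sqmod c * N g.
  have := l2sqnorm_ge0 (fun x => f x + (- t)%:C * conjc c * g x).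
  rewrite l2sqnorm_axpy // -/c -mulrA conj_mul sqmodM sqmodJ sqmodC !ReImE /=.
  by rewrite sqrrN mul0r subr0; congr (0 <= _); ring.
have c0 := sqmod_ge0 c; have g0 := l2sqnorm_ge0 g.
have [gz|gnz] := eqVneq (N g) 0.
  rewrite gz mulr0; have [-> //|cnz] := eqVneq (sqmod c) 0.
  have cp : 0 < sqmod c by rewrite lt_def cnz.
  have := key ((N f + 1) / (2 * sqmod c)); rewrite gz mulr0 addr0.
  have -> : 2 * ((N f + 1) / (2 * sqmod c)) * sqmod c = N f + 1 by field.
  by rewrite opprD addrA subrr add0r oppr_ge0 ler10.
have gp : 0 < N g by rewrite lt_def gnz.
have := key (N g)^-1.
have -> : N f - 2 * (N g)^-1 * sqmod c + (N g)^-1 ^+ 2 * sqmod c * N g =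
  (N f * N g - sqmod c) / N g by field.
by rewrite pmulr_lge0 ?invr_gt0 // subr_ge0.
Qed.

Definition cvgL2 (u : nat -> T -> R[i]) f :=
  N (fun x => u n x - f x) @[n --> \oo] --> (0 : R).

Lemma l2dot_cvgr f (v : nat -> T -> R[i]) g : L2 mu f ->
  (forall n, L2 mu (v n)) -> L2 mu g -> cvgL2 v g ->
  cvgC (fun n => dot f (v n)) (dot f g).
Proof.
move=> fi vi gi vg.
apply: (@cvgC_sqmod_le _ _ _ (fun n => N f * N (fun x => v n x - g x))).
  move=> n; rewrite -l2dotBr // l2dot_CauchySchwarz //; exact: L2B.
by rewrite -(mulr0 (N f)); apply: cvgMr.
Qed.

Lemma l2dot_cvg (u v : nat -> T -> R[i]) f g :
  (forall n, L2 mu (u n)) -> L2 mu f -> (forall n, L2 mu (v n)) -> L2 mu g ->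
  cvgL2 u f -> cvgL2 v g ->
  cvgC (fun n => dot (u n) (v n)) (dot f g).
Proof.
move=> ui fi vi gi uf vg.
have -> : (fun n => dot (u n) (v n)) = (fun n =>
    dot (fun x => u n x - f x) (fun x => v n x - g x) +
    dot (fun x => u n x - f x) g + dot f (v n)).
  apply/funext => n; rewrite -l2dotDr //; [|exact: L2B..].
  have -> : (fun x => v n x - g x + g x) = v n.
    by apply/funext => x; rewrite subrK.
  by rewrite l2dotBl // subrK.
rewrite -[dot f g]add0r; apply: cvgCD; last exact: l2dot_cvgr.
rewrite -[0 : R[i]]addr0; apply: cvgCD.
- apply: (@cvgC_sqmod_le _ _ _ (fun n => N (fun x => u n x - f x) *
      N (fun x => v n x - g x))).
    by move=> n; rewrite subr0 l2dot_CauchySchwarz //; exact: L2B.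
  by rewrite -(mulr0 (0 : R)); apply: cvgM.
- apply: (@cvgC_sqmod_le _ _ _ (fun n => N (fun x => u n x - f x) * N g)).
    by move=> n; rewrite subr0 l2dot_CauchySchwarz //; exact: L2B.
  by rewrite -(mul0r (N g)); apply: cvgMl.
Qed.

Lemma cvgL2_dist (u v : nat -> T -> R[i]) f g :
  (forall n, L2 mu (u n)) -> L2 mu f -> (forall n, L2 mu (v n)) -> L2 mu g ->
  cvgL2 u f -> cvgL2 v g -> cvgL2 (fun n x => u n x - v n x) (fun x => f x - g x).
Proof.
move=> ui fi vi gi uf vg.
apply: (@squeeze_cvgr _ _ _ _ (fun=> 0)
  (fun n => 2 * N (fun x => u n x - f x) + 2 * N (fun x => v n x - g x))).
- apply: nearW => n; rewrite l2sqnorm_ge0 /= [X in _ + 2 * X]l2sqnormN.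
  have := l2sqnormD_le (L2B (ui n) fi) (L2B gi (vi n)).
  congr (_ <= _); apply: eq_Rintegral => x _; congr sqmod.
  by ring.
- exact: cvg_cst.
- have -> : (0 : R) = 2 * 0 + 2 * 0 by rewrite mulr0 addr0.
  by apply: cvgD; apply: cvgMr.
Qed.

End L2_space.

(** * Completeness of L^2 *)

Section riesz_fischer.
Context {R : realType}.

Lemma summable_telescope_cvg (a : nat -> R) (b : nat -> R) :
  (forall j, `|a j.+1 - a j| <= b j) ->
  (\sum_(j <oo) (b j)%:E < +oo)%E -> cvgn a.
Proof.
move=> ab bfin.
have b0 j : 0 <= b j by exact: le_trans (normr_ge0 _) (ab j).
have b0' j : (0 <= (b j)%:E)%E by rewrite lee_fin.
suff ct : cvgn (series (telescope a)).
  have -> : a = (fun n => a 0%N + series (telescope a) n).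
    by apply/funext => n; rewrite -eq_sum_telescope.
  by apply: is_cvgD => //; exact: is_cvg_cst.
apply: normed_cvg; apply: nondecreasing_is_cvgn.
  by apply: nondecreasing_series => n _ _ /=; exact: normr_ge0.
have sfin : (\sum_(j <oo) (b j)%:E)%E \is a fin_num.
  by rewrite ge0_fin_numE //; apply: nneseries_ge0 => n _ _.
exists (fine (\sum_(j <oo) (b j)%:E)%E) => _ [n _ <-].
rewrite -lee_fin fineK // /series /=.
apply: (@le_trans _ _ (\sum_(0 <= j < n) (b j)%:E)%E).
  rewrite sumEFin lee_fin; apply: ler_sum => j _; exact: ab.
exact: nneseries_lim_ge.
Qed.

Lemma amgm_sum (t a b : R) : 0 < t ->
  `|a| + `|b| <= t^-1 + t * (a ^+ 2 + b ^+ 2).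
Proof.
move=> t0; have amgm (y : R) : `|y| <= t^-1 / 2 + t * y ^+ 2 / 2.
  rewrite -subr_ge0 -(real_normK (num_real y)).
  have -> : t^-1 / 2 + t * `|y| ^+ 2 / 2 - `|y| =
      (1 - t * `|y|) ^+ 2 / (2 * t) by field; rewrite gt_eqF.
  by rewrite divr_ge0 ?sqr_ge0 // mulr_ge0 // ltW.
apply: le_trans (lerD (amgm a) (amgm b)) _.
have -> : t^-1 / 2 + t * a ^+ 2 / 2 + (t^-1 / 2 + t * b ^+ 2 / 2) =
    t^-1 + t * (a ^+ 2 + b ^+ 2) / 2 by field; rewrite gt_eqF.
have ab0 : 0 <= t * (a ^+ 2 + b ^+ 2).
  by rewrite mulr_ge0 ?(ltW t0) // addr_ge0 ?sqr_ge0.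
by rewrite lerD2l ler_pdivrMr // ler_peMr // ler1n.
Qed.

Lemma cvg_sqmodB (a : nat -> R[i]) (c b : R[i]) :
  (complex.Re (a n) @[n --> \oo] --> complex.Re b) ->
  (complex.Im (a n) @[n --> \oo] --> complex.Im b) ->
  sqmod (c - a n) @[n --> \oo] --> sqmod (c - b).
Proof.
move=> are aim; have -> : (fun n => sqmod (c - a n)) = fun n =>
    (complex.Re c - complex.Re (a n)) ^+ 2 +
    (complex.Im c - complex.Im (a n)) ^+ 2.
  by apply/funext => n; rewrite /sqmod !ReImE.
rewrite /sqmod !ReImE.
by apply: cvgD; apply: cvgM; apply: cvgB => //; exact: cvg_cst.
Qed.

Lemma limn_einf_le (v : nat -> \bar R) e :
  (forall n, (v n <= e)%E) -> (limn_einf v <= e)%E.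
Proof.
move=> ve; rewrite limn_einf_lim; apply: lime_le; first exact: is_cvg_einfs.
apply: nearW => n; apply: le_trans (ve n).
by apply: ereal_inf_lbound; exists n => //=.
Qed.

Lemma fast_subsequence (P : nat -> nat -> Prop) :
  (forall j, exists N, forall n, (N <= n)%N -> P j n) ->
  exists s : nat -> nat, [/\ {homo s : i j / (i <= j)%N},
    forall j, (j <= s j)%N & forall j n, (s j <= n)%N -> P j n].
Proof.
move=> /choice[N NP]; exists (fun j => \sum_(i < j.+1) N i + j)%N; split.
- apply: homo_leq => //; first exact: leq_trans.
  move=> n; rewrite [X in (_ <= X + _)%N]big_ord_recr /= leq_add //.
  exact: leq_addr.
- by move=> j; exact: leq_addl.
- move=> j n sn; apply: NP; apply: leq_trans sn.
  by rewrite big_ord_recr /= addnAC leq_addl.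
Qed.

Context d (T : measurableType d).
Variable mu : {measure set T -> \bar R}.
Hypothesis fin : (mu setT < +oo)%E.

Lemma l2sqnorm_EFin (f : T -> R[i]) : L2 mu f ->
  (l2sqnorm mu f)%:E = (\int[mu]_x (sqmod (f x))%:E)%E.
Proof.
move=> /L2_sqmod fi; rewrite /l2sqnorm /Rintegral fineK //.
exact: integrable_fin_num.
Qed.

(** Along a subsequence with |u (s j.+1) - u (s j)|^2 of integral at most 4^-j,
    the increments have integral at most a constant times 2^-j, because
    |Re w| + |Im w| <= 2^-j + 2^j |w|^2. So they are summable almost everywhere,
    and the pointwise limit is the limit in L^2 by Fatou's lemma. *)
Lemma riesz_fischer (u : nat -> T -> R[i]) :
  (forall n, L2 mu (u n)) ->
  (forall e, 0 < e -> exists N, forall k l, (N <= k)%N -> (N <= l)%N ->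
    l2sqnorm mu (fun x => u k x - u l x) < e) ->
  exists2 f, L2 mu f & cvgL2 mu u f.
Proof.
move=> ui uC.
have [s [s_nd s_ge sP]] : exists s : nat -> nat, [/\ {homo s : i j / (i <= j)%N},
      forall j, (j <= s j)%N
    & forall j n, (s j <= n)%N -> forall l, (n <= l)%N ->
      l2sqnorm mu (fun x => u n x - u l x) <= (4 ^+ j)^-1].
  apply: fast_subsequence => j.
  have [|N NP] := uC (4 ^+ j)^-1; first by rewrite invr_gt0 exprn_gt0.
  by exists N => n Nn l nl; apply/ltW/NP => //; exact: leq_trans nl.
pose w j x := u (s j.+1) x - u (s j) x.
pose g j x := `|complex.Re (w j x)| + `|complex.Im (w j x)|.
have wi j : L2 mu (w j) by exact: L2B.
have wn j : l2sqnorm mu (w j) <= (4 ^+ j)^-1.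
  by rewrite l2sqnormN; apply: sP => //; exact: s_nd.
have mg j : measurable_fun setT (g j).
  have [m1 m2] := L2_Cmeasurable (wi j).
  by apply: measurable_funD; apply: measurableT_comp.
have g0 j x : 0 <= g j x by rewrite addr_ge0.
have g0' j x : (0 <= (g j x)%:E)%E by rewrite lee_fin.
pose h j x := (2 ^+ j)^-1 + 2 ^+ j * sqmod (w j x).
have gh j x : g j x <= h j x.
  by apply: amgm_sum; rewrite exprn_gt0.
have hi j : Rintegrable mu (h j).
  apply: RintegrableD; last by apply: RintegrableZ; exact: L2_sqmod.
  by apply: (@bounded_Rintegrable _ _ _ _ _ `|(2 ^+ j)^-1|).
pose M := fine (mu setT).
have inth j : (\int[mu]_x (g j x)%:E <= ((2 ^+ j)^-1 * (M + 1))%:E)%E.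
  apply: (@le_trans _ _ (\int[mu]_x (h j x)%:E)%E).
    apply: ge0_le_integral => //.
    - exact/measurable_EFinP.
    - exact/measurable_EFinP/Rintegrable_measurable.
    - by move=> x _; rewrite lee_fin.
  rewrite -(fineK (integrable_fin_num _ (hi j))) // lee_fin.
  have := @RintegralD _ _ _ mu setT (fun=> (2 ^+ j)^-1)
    (fun x => 2 ^+ j * sqmod (w j x)) measurableT.
  rewrite /Rintegral => -> //; last 2 first.
  - by apply: (@bounded_Rintegrable _ _ _ _ _ `|(2 ^+ j)^-1|).
  - by apply: RintegrableZ; exact: L2_sqmod.
  rewrite -![fine _]/(Rintegral _ _ _) Rintegral_cst // RintegralZl //; last first.
    exact: L2_sqmod.
  rewrite mulrDr lerD2l mulr1.
  apply: le_trans (ler_wpM2l _ (wn j)) _; first by rewrite exprn_ge0.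
  have -> : (4 : R) = 2 * 2 by rewrite -natrM.
  by rewrite exprMn invfM mulrA divff ?mul1r // expf_neq0.
pose S x := (\sum_(j <oo) (g j x)%:E)%E.
have mS : measurable_fun setT S.
  by apply: ge0_emeasurable_sum => // j _; exact/measurable_EFinP.
have S0 x : (0 <= S x)%E by apply: nneseries_ge0.
have intS : (\int[mu]_x S x < +oo)%E.
  rewrite integral_nneseries //; last by move=> j; exact/measurable_EFinP.
  apply: (@le_lt_trans _ _ (\sum_(j <oo) ((2 ^+ j)^-1 * (M + 1))%:E)%E).
    by apply: lee_nneseries => // j _ _; exact: integral_ge0.
  have M0 : 0 <= M + 1 by rewrite addr_ge0 // fine_ge0.
  have -> : (\sum_(j <oo) ((2 ^+ j)^-1 * (M + 1))%:E = ((M + 1) / (1 - 2^-1))%:E)%E.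
    apply/cvg_lim => //.
    have -> : (fun n => \sum_(0 <= j < n) ((2 ^+ j)^-1 * (M + 1))%:E)%E =
        EFin \o series (geometric (M + 1) 2^-1).
      apply/funext => n; rewrite sumEFin /= /series /=; congr EFin.
      by apply: eq_bigr => j _; rewrite exprVn mulrC.
    apply: cvg_comp (@cvg_geometric_series R (M + 1) 2^-1 _) _.
      by rewrite ger0_norm ?invr_ge0 // invf_lt1 // ltr1n.
    by apply: cvg_EFin; [exact: nearW|exact: cvg_id].
  exact: ltry.
have Si : mu.-integrable setT S.
  apply/integrableP; split => //.
  by under eq_integral do rewrite gee0_abs //.
pose E := [set x | S x < +oo]%E.
have mE : measurable E.
  by rewrite -[E]setTI; apply: measurable_lte => //; exact: measurable_cst.
have aeE : {ae mu, forall x, E x}.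
  apply: filterS (integrable_ae measurableT Si) => x /(_ I).
  by rewrite ge0_fin_numE.
(* Cutting off where the increments are not summable makes the sequence
   converge everywhere, which gives a measurable limit. *)
pose v j x : R[i] := (\1_E x)%:C * u (s j) x.
have mv j : Cmeasurable (v j).
  apply: CmeasurableM; last exact: L2_Cmeasurable.
  by split => //=; exact: measurable_indic.
have vE j x : E x -> v j x = u (s j) x.
  by move=> Ex; rewrite /v indicE mem_set // mul1r.
have cv_re x : cvgn (fun j => complex.Re (v j x)).
  have [Ex|nEx] := pselect (E x); last first.
    rewrite (_ : (fun _ => _) = fun=> 0); first exact: is_cvg_cst.
    by apply/funext => j; rewrite /v indicE memNset // mul0r.
  apply: (@summable_telescope_cvg _ (fun j => g j x)); last exact: Ex.
  by move=> j; rewrite !vE // -ReN -ReD /g -/(w j x) lerDl.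
have cv_im x : cvgn (fun j => complex.Im (v j x)).
  have [Ex|nEx] := pselect (E x); last first.
    rewrite (_ : (fun _ => _) = fun=> 0); first exact: is_cvg_cst.
    by apply/funext => j; rewrite /v indicE memNset // mul0r.
  apply: (@summable_telescope_cvg _ (fun j => g j x)); last exact: Ex.
  by move=> j; rewrite !vE // -ImN -ImD /g -/(w j x) lerDr.
pose f x := limn (fun j => complex.Re (v j x)) +i*
            limn (fun j => complex.Im (v j x)).
have mf : Cmeasurable f.
  split; first by apply: (@measurable_fun_cvg _ _ _ _
    (fun j x => complex.Re (v j x))) => [j|x _]; [case: (mv j)|exact: cv_re].
  by apply: (@measurable_fun_cvg _ _ _ _
    (fun j x => complex.Im (v j x))) => [j|x _]; [case: (mv j)|exact: cv_im].
have key e : 0 < e -> exists N, forall n, (N <= n)%N ->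
    (\int[mu]_x (sqmod (u n x - f x))%:E <= e%:E)%E.
  move=> e0; have [N NP] := uC e e0; exists N => n Nn.
  pose q j x := (sqmod (u n x - v (N + j)%N x))%:E.
  have qm j : measurable_fun setT (q j).
    apply/measurable_EFinP/measurable_sqmod.
    under eq_fun do rewrite -mulN1r.
    apply: CmeasurableD; first exact: L2_Cmeasurable.
    by apply: CmeasurableM => //; exact: Cmeasurable_cst.
  have sN k : (k <= s k + k)%N by rewrite leq_addl.
  have qlim x : (sqmod (u n x - f x))%:E = limn_einf (q ^~ x).
    have H : q ^~ x @ \oo --> (sqmod (u n x - f x))%:E.
      apply: cvg_EFin; first exact: nearW.
      apply: (@cvg_sqmodB (fun j => v (N + j)%N x)).
      - exact: (cvg_comp _ _ (cvg_addnl N) (cv_re x)).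
      - exact: (cvg_comp _ _ (cvg_addnl N) (cv_im x)).
    by have [-> _] := cvg_limn_einf_sup H.
  under eq_integral do rewrite qlim.
  apply: le_trans (fatou _ _ _ _) _ => //.
    by move=> j x _; rewrite lee_fin sqmod_ge0.
  apply: limn_einf_le => j.
  have -> : (\int[mu]_x q j x =
      (l2sqnorm mu (fun x => u n x - u (s (N + j)%N) x))%:E)%E.
    rewrite l2sqnorm_EFin; last exact: L2B.
    apply: ge0_ae_eq_integral => //.
    - by apply/measurable_EFinP/measurable_sqmod/L2_Cmeasurable; exact: L2B.
    - by move=> x _; rewrite lee_fin sqmod_ge0.
    - by move=> x _; rewrite lee_fin sqmod_ge0.
    - by apply: filterS aeE => x Ex _; rewrite /q vE.
  by rewrite lee_fin ltW // NP // (leq_trans (leq_addr j N)).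
have [N1 N1P] := key 1 ltr01.
have ufi n : (N1 <= n)%N -> L2 mu (fun x => u n x - f x).
  move=> Nn; have mq : Cmeasurable (fun x => u n x - f x).
    under eq_fun do rewrite -mulN1r.
    apply: CmeasurableD; first exact: L2_Cmeasurable.
    by apply: CmeasurableM => //; exact: Cmeasurable_cst.
  apply/L2P; split => //; apply/integrableP; split.
    exact/measurable_EFinP/measurable_sqmod.
  under eq_integral do rewrite /= ger0_norm ?sqmod_ge0 //.
  exact: le_lt_trans (N1P _ Nn) (ltry _).
exists f.
  have := L2B (ui N1) (ufi N1 (leqnn N1)).
  by under eq_fun do rewrite opprB addrC subrK.
apply/cvgrPdist_le => e e0; have [N NP] := key e e0.
near=> n.
have Nn : (N <= n)%N by near: n; exact: nbhs_infty_ge.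
have N1n : (N1 <= n)%N by near: n; exact: nbhs_infty_ge.
rewrite sub0r normrN ger0_norm ?l2sqnorm_ge0 // -lee_fin.
by rewrite l2sqnorm_EFin ?NP //; exact: ufi.
Unshelve. all: by end_near. Qed.

End riesz_fischer.

(** * Orthogonal families *)

Section orthogonal_families.
Context {R : realType} d (T : measurableType d).
Variable mu : {measure set T -> \bar R}.
Variables (e : nat -> T -> R[i]) (c : nat -> R).
Hypothesis eL : forall n, L2 mu (e n).
Hypothesis orth : forall m n, l2dot mu (e m) (e n) = (if m == n then c n else 0)%:C.
Hypothesis c_gt0 : forall n, 0 < c n.
Implicit Types (a b : nat -> R[i]) (f : T -> R[i]).

Definition orth_psum a n x := \sum_(k < n) a k * e k x.
Definition weighted_psum a n := \sum_(k < n) c k * sqmod (a k).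

Lemma L2_orth_psum a n : L2 mu (orth_psum a n).
Proof.
by apply: (@L2_sum _ _ _ _ _ (fun k x => a k * e k x)) => k; exact: L2Z.
Qed.

Lemma l2dot_orth_psum_l a k n :
  l2dot mu (e k) (orth_psum a n) = if (k < n)%N then (c k)%:C * a k else 0.
Proof.
rewrite /orth_psum (@l2dot_sumr _ _ _ _ _ _ (fun k x => a k * e k x)) //; last first.
  by move=> j; exact: L2Z.
under eq_bigr do rewrite l2dotZr // orth.
case: ltnP => kn.
  rewrite (bigD1 (Ordinal kn)) //= eqxx mulrC big1 ?addr0 // => j /eqP jk.
  case: eqP => [kj|]; last by rewrite mulr0.
  by case: jk; apply: val_inj.
rewrite big1 // => j _; case: eqP => [kj|]; last by rewrite mulr0.
by have := ltn_ord j; rewrite -kj ltnNge kn.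
Qed.

Lemma l2dot_orth_psum a b n :
  l2dot mu (orth_psum a n) (orth_psum b n) =
  \sum_(k < n) (c k)%:C * (conjc (a k) * b k).
Proof.
rewrite {1}/orth_psum (@l2dot_suml _ _ _ _ _ _ (fun k x => a k * e k x)).
- apply: eq_bigr => k _.
  rewrite l2dotZl ?l2dot_orth_psum_l ?ltn_ord //; last exact: L2_orth_psum.
  by rewrite mulrCA.
- exact: L2_orth_psum.
- by move=> j; exact: L2Z.
Qed.

Lemma l2sqnorm_orth_psum a n : l2sqnorm mu (orth_psum a n) = weighted_psum a n.
Proof.
apply: (@complexI R); rewrite -l2dotff l2dot_orth_psum rmorph_sum.
by apply: eq_bigr => k _; rewrite conj_mul -rmorphM.
Qed.

Lemma l2sqnorm_orth_psumB a m n : (m <= n)%N ->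
  l2sqnorm mu (fun x => orth_psum a n x - orth_psum a m x) =
  weighted_psum a n - weighted_psum a m.
Proof.
move=> mn; pose a' k := if (m <= k)%N then a k else 0.
have split (V : zmodType) (F : nat -> V) :
    \sum_(k < n) F k - \sum_(k < m) F k = \sum_(k < n) if (m <= k)%N then F k else 0.
  rewrite -!(big_mkord xpredT) (big_cat_nat (leq0n m) mn) /= addrAC subrr add0r.
  rewrite -(big_mkord xpredT (fun k => if (m <= k)%N then F k else 0)).
  rewrite [RHS](big_cat_nat (leq0n m) mn) /= [X in _ = X + _]big1_seq ?add0r.
    by apply: eq_big_nat => k /andP[->].
  by move=> k; rewrite mem_index_iota => /andP[_ /andP[_ km]]; rewrite leqNgt km.
have -> : (fun x => orth_psum a n x - orth_psum a m x) = orth_psum a' n.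
  apply/funext => x; rewrite /orth_psum (split _ (fun k => a k * e k x)).
  by apply: eq_bigr => k _; rewrite /a'; case: ifP => // _; rewrite mul0r.
rewrite l2sqnorm_orth_psum /weighted_psum (split _ (fun k => c k * sqmod (a k))).
by apply: eq_bigr => k _; rewrite /a'; case: ifP => // _; rewrite sqmod0 mulr0.
Qed.

Lemma weighted_psum_nd a m n : (m <= n)%N ->
  weighted_psum a m <= weighted_psum a n.
Proof. by move=> mn; rewrite -subr_ge0 -l2sqnorm_orth_psumB // l2sqnorm_ge0. Qed.

(** By Pythagoras the squared distances are increments of a bounded monotone
    sequence. *)
Lemma orth_psum_cauchy a B : (forall n, weighted_psum a n <= B) ->
  forall eps, 0 < eps -> exists N, forall k l, (N <= k)%N -> (N <= l)%N ->
    l2sqnorm mu (fun x => orth_psum a k x - orth_psum a l x) < eps.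
Proof.
move=> aB eps eps0.
have : cvgn (weighted_psum a).
  apply: nondecreasing_is_cvgn; last by exists B => _ [n _ <-].
  by move=> m n; exact: weighted_psum_nd.
move=> /cvg_ex[l /cvgrPdist_lt/(_ _ (divr_gt0 eps0 (ltr0Sn _ 1)))[N _ HN]].
have key k j : (N <= k)%N -> (N <= j)%N -> (j <= k)%N ->
    l2sqnorm mu (fun x => orth_psum a k x - orth_psum a j x) < eps.
  move=> Nk Nj jk; rewrite l2sqnorm_orth_psumB //.
  have := HN _ Nk; have := HN _ Nj; rewrite /= !ltr_norml.
  move=> /andP[h1 h2] /andP[h3 h4]; lra.
exists N => k j Nk Nj; have [jk|kj] := leqP j k; first exact: key.
by rewrite l2sqnormN; apply: key => //; exact: ltnW.
Qed.

Definition orth_coef f k := (c k)^-1%:C * l2dot mu (e k) f.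

(** Expand the squared norm of f minus its projection. *)
Lemma bessel f n : L2 mu f -> weighted_psum (orth_coef f) n <= l2sqnorm mu f.
Proof.
move=> fi; set a := orth_coef f.
have gi := L2_orth_psum a n.
have := l2sqnorm_ge0 mu (fun x => f x + (-1) * orth_psum a n x).
rewrite l2sqnorm_axpy // l2sqnorm_orth_psum sqmodN.
have -> : l2dot mu f (orth_psum a n) = (weighted_psum a n)%:C.
  rewrite /orth_psum (@l2dot_sumr _ _ _ _ _ _ (fun k x => a k * e k x)) //; last first.
    by move=> j; exact: L2Z.
  rewrite rmorph_sum; apply: eq_bigr => k _.
  rewrite l2dotZr // (l2dotJ (eL k) fi).
  have -> : l2dot mu (e k) f = (c k)%:C * a k.
    by rewrite /a /orth_coef mulrA -rmorphM divff ?mul1r // gt_eqF.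
  rewrite conjcM conjc_real mulrCA (mulrC (a k)) conj_mul -rmorphM //.
rewrite mulN1r ReN /= sqmodC expr1n mul1r; lra.
Qed.

Lemma orth_psum_cvg a f : L2 mu f -> cvgL2 mu (orth_psum a) f ->
  forall k, orth_coef f k = a k.
Proof.
move=> fi af k; have H := l2dot_cvgr (eL k) (L2_orth_psum a) fi af.
have H2 : cvgC (fun n => l2dot mu (e k) (orth_psum a n)) ((c k)%:C * a k).
  apply: cvg_near_cst; exists k.+1 => // n /= kn.
  by rewrite l2dot_orth_psum_l kn.
rewrite /orth_coef (cvgC_unique H H2) mulrA -rmorphM mulVf ?mul1r //.
by rewrite gt_eqF.
Qed.

End orthogonal_families.

(** * Polynomials and compactly supported measures *)

Section sign_polynomials.
Context {R : realType}.
Implicit Types (y M : R) (p : {poly R}).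

(** Iterating (3 y - y^3) / 2 fixes -1, 0 and 1 and drives every other point
    of [-1, 1] to its sign, monotonically: these are polynomials that converge
    boundedly to a step function. *)
Definition sign_step y : R := (3 * y - y ^+ 3) / 2.

Fixpoint sign_poly (p : {poly R}) n : {poly R} :=
  if n is n'.+1 then
    (2^-1)%:P * (3%:P * sign_poly p n' - sign_poly p n' ^+ 3)
  else p.

Lemma horner_sign_poly p n x :
  (sign_poly p n).[x] = iter n sign_step p.[x].
Proof.
elim: n => [//|n IH] /=; rewrite -IH /sign_step !hornerE /=.
by rewrite mulrC.
Qed.

Lemma iter_sign_stepN n y : iter n sign_step (- y) = - iter n sign_step y.
Proof. by elim: n => [//|n IH] /=; rewrite IH /sign_step; field. Qed.

Lemma iter_sign_step0 n : iter n sign_step 0 = 0.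
Proof. by elim: n => [//|n IH] /=; rewrite IH /sign_step; field. Qed.

Lemma iter_sign_step_gt0 n y : 0 < y <= 1 ->
  y <= iter n sign_step y <= 1 /\
  1 - iter n sign_step y <= (1 - y / 2) ^+ n * (1 - y).
Proof.
move=> /andP[y0 y1]; elim: n => [|n [/andP[H1 H2] H3]] /=.
  by rewrite lexx y1 expr0 mul1r.
set z := iter n sign_step y in H1 H2 H3 *.
have z0 : 0 < z by exact: lt_le_trans H1.
have E : 1 - sign_step z = (1 - z) * ((1 - z) * (2 + z) / 2).
  by rewrite /sign_step; field.
have E2 : sign_step z - z = z * (1 - z) * (1 + z) / 2.
  by rewrite /sign_step; field.
have zl : 0 <= 1 - z by rewrite subr_ge0.
split; first (apply/andP; split).
- apply: le_trans H1 _; rewrite -subr_ge0 E2.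
  by apply: divr_ge0 => //; rewrite !mulr_ge0 ?(ltW z0) // addr_ge0 // ltW.
- rewrite -subr_ge0 E mulr_ge0 // divr_ge0 // mulr_ge0 //.
  by rewrite addr_ge0 // ltW.
- rewrite E mulrC exprS -[leRHS]mulrA; apply: ler_pM => //.
    by rewrite divr_ge0 // mulr_ge0 // addr_ge0 // ltW.
  have := sqr_ge0 z; nra.
Qed.

Lemma cvg_iter_sign_step y : `|y| <= 1 ->
  iter n sign_step y @[n --> \oo] --> Num.sg y.
Proof.
have pos (x : R) : 0 < x <= 1 -> iter n sign_step x @[n --> \oo] --> (1 : R).
  move=> x01; have /andP[x0 x1] := x01.
  apply: (@squeeze_cvgr _ _ _ _ (fun n => 1 - (1 - x / 2) ^+ n * (1 - x))
    (fun=> 1)).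
  - apply: nearW => n; have [/andP[_ ->] H] := iter_sign_step_gt0 n x01.
    by rewrite andbT lerBlDr addrC -lerBlDr.
  - rewrite -[X in _ --> X]subr0; apply: cvgB; first exact: cvg_cst.
    rewrite -(mul0r (1 - x)); apply: cvgMl; apply: cvg_expr.
    rewrite ger0_norm; lra.
  - exact: cvg_cst.
have [y0|y0|<-] := ltgtP 0 y.
- by rewrite gtr0_norm // => y1; rewrite gtr0_sg //; apply: pos; rewrite y0.
- rewrite ltr0_norm // => y1; rewrite ltr0_sg //.
  have H : 0 < - y <= 1 by rewrite oppr_gt0 y0.
  have -> : (fun n => iter n sign_step y) = fun n => - iter n sign_step (- y).
    by apply/funext => n; rewrite iter_sign_stepN opprK.
  exact: cvgN (pos _ H).
- move=> _; rewrite sgr0; under eq_fun do rewrite iter_sign_step0.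
  exact: cvg_cst.
Qed.

Lemma iter_sign_step_le1 n y : `|y| <= 1 -> `|iter n sign_step y| <= 1.
Proof.
have pos (x : R) : 0 < x <= 1 -> `|iter n sign_step x| <= 1.
  move=> x01; have [/andP[H1 H2] _] := iter_sign_step_gt0 n x01.
  by rewrite ger0_norm //; apply: le_trans H1; case/andP: x01 => /ltW.
have [y0|y0|<-] := ltgtP 0 y.
- by rewrite gtr0_norm // => y1; apply: pos; rewrite y0.
- rewrite ltr0_norm // => y1; rewrite -[y]opprK iter_sign_stepN normrN.
  by apply: pos; rewrite oppr_gt0 y0.
- by move=> _; rewrite iter_sign_step0 normr0.
Qed.

Lemma poly_bounded p M :
  exists B, 0 <= B /\ forall x, `|x| <= M -> `|p.[x]| <= B.
Proof.
elim/poly_ind: p => [|p c [B [B0 HB]]].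
  by exists 0; split => // x _; rewrite horner0 normr0.
exists (B * `|M| + `|c|); split; first by rewrite addr_ge0 // mulr_ge0.
move=> x xM; rewrite !hornerE (le_trans (ler_normD _ _)) // lerD2r.
rewrite normrM ler_pM // ?HB //.
by rewrite (le_trans xM) // ler_norm.
Qed.

Lemma measurable_poly p : measurable_fun setT (fun x : R => p.[x]).
Proof.
elim/poly_ind: p => [|p c IH].
  by under eq_fun do rewrite horner0; exact: measurable_cst.
under eq_fun do rewrite !hornerE.
by apply: measurable_funD => //; apply: measurable_funM.
Qed.

End sign_polynomials.

Section determinacy.
Context {R : realType}.

Lemma Rdominated_cvg d (T : measurableType d) (mu : {measure set T -> \bar R})
    (u : nat -> T -> R) (f g : T -> R) :
  (forall n, measurable_fun setT (u n)) -> measurable_fun setT f ->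
  (forall x, u n x @[n --> \oo] --> f x) ->
  Rintegrable mu g -> (forall n x, `|u n x| <= g x) ->
  \int[mu]_x u n x @[n --> \oo] --> \int[mu]_x f x.
Proof.
move=> mu_ mf uf gi ug.
have [] := @dominated_convergence _ _ _ mu setT measurableT
  (fun n x => (u n x)%:E) (fun x => (f x)%:E) (fun x => (g x)%:E).
- by move=> n; exact/measurable_EFinP.
- exact/measurable_EFinP.
- by apply: aeW => x _; apply: cvg_EFin; [exact: nearW|exact: uf].
- exact: gi.
- by apply: aeW => x n _ /=; rewrite lee_fin.
move=> fi _ H; apply: fine_cvg.
by rewrite /Rintegral fineK //; exact: integrable_fin_num.
Qed.

Variable mu : probability R R.
Variable M : R.
Hypothesis muM : mu (~` `[- M, M]) = 0%E.

(** The sign polynomials converge boundedly on the support of the measure to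
    indicators of half-lines, so f has integral 0 over every half-line, hence
    over every Borel set. *)
Lemma poly_orthogonal_ae0_supp (f : R -> R) : Rintegrable mu f ->
  (forall x, M < `|x| -> f x = 0) ->
  (forall p : {poly R}, \int[mu]_x (p.[x] * f x) = 0) ->
  {ae mu, forall x, f x = 0}.
Proof.
move=> fi f0 pf.
have mf := Rintegrable_measurable fi.
have half a : \int[mu]_(x in `]a, +oo[) f x = 0.
  (* This scaling maps the support into [-1, 1] and a to 0. *)
  pose L := `|M| + `|a| + 1.
  have L0 : 0 < L by rewrite ltr_wpDl // addr_ge0.
  pose l : {poly R} := L^-1 *: ('X - a%:P).
  have lE x : l.[x] = (x - a) / L by rewrite !hornerE mulrC.
  (* (s^2 + s) / 2 is 1 for s = 1, and 0 for s = 0 and s = -1. *)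
  pose s n := 2^-1 *: (sign_poly l n ^+ 2 + sign_poly l n).
  have sE n x : (s n).[x] =
      2^-1 * (iter n sign_step l.[x] ^+ 2 + iter n sign_step l.[x]).
    by rewrite hornerZ hornerD horner_exp !horner_sign_poly.
  have l1 x : `|x| <= M -> `|l.[x]| <= 1.
    move=> xM; rewrite lE normrM (gtr0_norm (_ : 0 < L^-1)) ?invr_gt0 //.
    rewrite ler_pdivrMr // mul1r (le_trans (ler_normB _ _)) //.
    by rewrite -[leLHS]addr0 lerD // lerD2r (le_trans xM) // ler_norm.
  have lim : \int[mu]_x ((s n).[x] * f x) @[n --> \oo] -->
      \int[mu]_x (\1_(`]a, +oo[) x * f x).
    apply: (@Rdominated_cvg _ _ _ _ _ (fun x => `|f x|)).
    - by move=> n; apply: measurable_funM => //; exact: measurable_poly.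
    - by apply: measurable_funM => //; exact: measurable_indic.
    - move=> x; have [xM|xM] := leP `|x| M; last first.
        by under eq_fun do rewrite f0 // mulr0; rewrite f0 // mulr0;
          exact: cvg_cst.
      apply: cvgMl; under eq_fun do rewrite sE.
      have -> : \1_(`]a, +oo[) x = 2^-1 * (Num.sg l.[x] ^+ 2 + Num.sg l.[x]).
        rewrite indicE mem_setE in_itv /= andbT lE sgrM [Num.sg L^-1]gtr0_sg
          ?invr_gt0 // mulr1.
        have [xa|xa|->] := ltgtP a x.
        + by rewrite gtr0_sg ?subr_gt0 // expr1n mulVf // pnatr_eq0.
        + by rewrite ltr0_sg ?subr_lt0 // sqrrN expr1n subrr mulr0.
        + by rewrite subrr sgr0 expr0n addr0 mulr0.
      have H := cvg_iter_sign_step (l1 x xM).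
      by apply: cvgMr; apply: cvgD => //; exact: cvgM.
    - by have := integrable_norm fi.
    - move=> n x; have [xM|xM] := leP `|x| M; last first.
        by rewrite f0 // mulr0 normr0.
      rewrite normrM ler_piMl // sE.
      have H := iter_sign_step_le1 n (l1 x xM).
      rewrite normrM ger0_norm ?invr_ge0 // mulrC ler_pdivrMr // mul1r.
      rewrite (le_trans (ler_normD _ _)) // normrX.
      have H2 := normr_ge0 (iter n sign_step l.[x]); nra.
  have Z : \int[mu]_x (\1_(`]a, +oo[) x * f x) = 0.
    have E0 : (fun n => \int[mu]_x ((s n).[x] * f x)) = fun=> 0.
      by apply/funext => n; rewrite pf.
    have := lim; rewrite E0 => H.
    have := cvg_lim (@Rhausdorff R) H.
    by rewrite (cvg_lim (@Rhausdorff R) (cvg_cst (0 : R))) => <-.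
  rewrite Rintegral_mkcond -[RHS]Z; apply: eq_Rintegral => x _.
  by rewrite patchE indicE; case: (x \in _); rewrite ?mul1r ?mul0r.
have ef A : measurable A ->
    (\int[mu]_(x in A) (f x)%:E = (\int[mu]_(x in A) f x)%:E)%E.
  move=> mA; rewrite /Rintegral fineK //; apply: integrable_fin_num => //.
  exact: integrableS fi.
have all0 A : measurable A -> \int[mu]_(x in A) f x = 0.
  move=> mA; suff : [set B | \int[mu]_(x in B) f x = 0] A by [].
  have DI := @dynkin_induction _ (measurableTypeR R) (@RGenOInfty.G R)
    [set B | \int[mu]_(x in B) f x = 0].
  apply: DI; last by move: mA; rewrite [X in X A -> _]RGenOInfty.measurableE.
  - exact: RGenOInfty.measurableE.
  - move=> A1 A2 [x ->] [y ->]; exists (Num.max x y).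
    by apply/seteqP; split => z /=; rewrite !in_itv /= !andbT gt_max => /andP.
  - by have := pf 1; under eq_Rintegral do rewrite hornerE mul1r.
  - by move=> _ [a ->]; exact: half.
  - move=> S mS S0.
    have := pf 1; under eq_Rintegral do rewrite hornerE mul1r.
    rewrite -(setvU S) Rintegral_setU ?S0 ?addr0 //; first exact: measurableC.
    + by rewrite setvU.
    + by apply/disj_setPS; rewrite setICl.
  - move=> F mF tF F0.
    have mU : measurable (\bigcup_k F k) by exact: bigcupT_measurable.
    apply: EFin_inj; rewrite -ef // integral_bigcup //; last exact: integrableS fi.
    by apply: eseries0 => i _ _; rewrite ef; [congr EFin; exact: F0|exact: mF].
have := @integral_ae_eq _ _ _ mu setT measurableT (EFin \o cst 0) (EFin \o f) fi.
case=> [|E _ mE|N [mN N0 HN]].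
- by apply/measurable_EFinP; exact: measurable_cst.
-
  by rewrite [LHS]ef // all0 //= integral0.
- exists N; split => // x /= fx; apply: HN => /= H; apply: fx.
by have [] := H I.
Qed.

(** f may be replaced by 0 off the support, where polynomials are unbounded. *)
Lemma poly_orthogonal_ae0 (f : R -> R) : Rintegrable mu f ->
  (forall p : {poly R}, \int[mu]_x (p.[x] * f x) = 0) ->
  {ae mu, forall x, f x = 0}.
Proof.
move=> fi pf; have mf := Rintegrable_measurable fi.
have mI : measurable (`[- M, M] : set R) by [].
pose f' x := \1_(`[- M, M]) x * f x.
have mf' : measurable_fun setT f'.
  by apply: measurable_funM => //; exact: measurable_indic.
have f'E x : (`[- M, M]%classic : set R) x -> f' x = f x.
  by move=> xM; rewrite /f' indicE mem_set // mul1r.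
have aeM : {ae mu, forall x, (`[- M, M]%classic : set R) x}.
  by exists (~` `[- M, M]%classic); split => //; exact: measurableC.
have f'i : Rintegrable mu f'.
  apply: le_Rintegrable mf' (integrable_norm fi) _ => x.
  rewrite normrM ler_piMl // indicE ger0_norm //.
  by case: (x \in _).
have f'0 : {ae mu, forall x, f' x = 0}.
  apply: poly_orthogonal_ae0_supp => //.
    move=> x xM; rewrite /f' indicE memNset ?mul0r //= in_itv /= -ler_norml.
    by apply/negP; rewrite -ltNge.
  move=> p; rewrite -(pf p); congr fine; apply: ae_eq_integral => //.
  - apply/measurable_EFinP/measurable_funM => //; exact: measurable_poly.
  - apply/measurable_EFinP/measurable_funM => //; exact: measurable_poly.
  - by apply: filterS aeM => x xM _; rewrite f'E.
by apply: filterS2 aeM f'0 => x /f'E <-.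
Qed.

Lemma Rintegrable_poly p : Rintegrable mu (fun x => p.[x]).
Proof.
have [B [B0 HB]] := poly_bounded p M.
have mI : measurable (`[- M, M] : set R) by [].
apply/integrableP; split; first by apply/measurable_EFinP; exact: measurable_poly.
apply: (@le_lt_trans _ _ (\int[mu]_x (cst B%:E x))%E); last first.
  rewrite integral_cst //.
  rewrite [X in (_ * X)%E](_ : _ = 1%E); last exact: probability_setT.
  by rewrite mule1 ltry.
apply: ae_ge0_le_integral => //.
- by apply: measurableT_comp => //; apply/measurable_EFinP; exact: measurable_poly.
- exists (~` `[- M, M]%classic); split => //; first exact: measurableC.
  move=> x /= Hx xM; apply: Hx => _; rewrite lee_fin HB //.
  by move: xM; rewrite in_itv /= -ler_norml.
Qed.

End determinacy.

(** * q-factorials and Euler's identity *)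

Section q_numbers.
Context {R : realType}.
Variables q beta : R.
Hypotheses (hq0 : 0 <= q) (hq1 : q < 1) (hbeta : 0 < beta).

(** The squared norm of the n-th q-Charlier polynomial. *)
Definition cnorm n : R := beta ^+ n * qfact q n.

Let q1 : 0 < 1 - q. Proof. by rewrite subr_gt0. Qed.

Lemma qnat0 : qnat q 0 = 0. Proof. exact: big_ord0. Qed.

Lemma qnatE n : qnat q n = (1 - q ^+ n) / (1 - q).
Proof.
apply: (mulIf (lt0r_neq0 q1)); rewrite divfK ?lt0r_neq0 //.
elim: n => [|n IH]; first by rewrite qnat0 mul0r expr0 subrr.
by rewrite /qnat big_ord_recr /= -/(qnat q n) mulrDl IH exprSr; ring.
Qed.

Lemma qfactS n : qfact q n.+1 = qfact q n * qnat q n.+1.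
Proof. by rewrite /qfact big_nat_recr. Qed.

Lemma cnorm0 : cnorm 0 = 1.
Proof. by rewrite /cnorm /qfact big_nil expr0 mulr1. Qed.

Lemma cnormS n : cnorm n.+1 = beta * qnat q n.+1 * cnorm n.
Proof. by rewrite /cnorm qfactS exprS; ring. Qed.

Lemma cnormE n : cnorm n = (beta / (1 - q)) ^+ n * qpoch q q n.
Proof.
elim: n => [|n IH]; first by rewrite cnorm0 /qpoch big_ord0 expr0 mulr1.
rewrite cnormS IH qnatE exprS /qpoch big_ord_recr /= exprS; ring.
Qed.

Lemma factor_gt0 j : 0 < 1 - q * q ^+ j.
Proof. by rewrite -exprS subr_gt0 exprn_ilt1. Qed.

Lemma qpoch_gt0 n : 0 < qpoch q q n.
Proof. by apply: prodr_gt0 => j _; exact: factor_gt0. Qed.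

Lemma qpochS n : qpoch q q n.+1 = qpoch q q n * (1 - q ^+ n.+1).
Proof. by rewrite /qpoch big_ord_recr /= exprS. Qed.

Lemma qpoch0 : qpoch q q 0 = 1. Proof. exact: big_ord0. Qed.

Lemma cnorm_gt0 n : 0 < cnorm n.
Proof. by rewrite cnormE mulr_gt0 ?qpoch_gt0 // exprn_gt0 // divr_gt0. Qed.

(** The partial products of (q; q)_oo stay away from 0: once the tail of
    sum q^i is below 1/2, the remaining factors have product at least 1/2. *)
Lemma qpoch_lbound : exists2 del, 0 < del & forall n, del <= qpoch q q n.
Proof.
have [N HN] : exists N, q ^+ N / (1 - q) <= 2^-1.
  have : q ^+ n / (1 - q) @[n --> \oo] --> 0 / (1 - q).
    by apply: cvgMl; apply: cvg_expr; rewrite ger0_norm.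
  rewrite mul0r => /cvgrPdist_le /(_ 2^-1); rewrite invr_gt0 ltr0n => /(_ isT).
  case=> N _ /(_ N (leqnn N)); rewrite sub0r normrN ger0_norm; first by exists N.
  by rewrite divr_ge0 ?exprn_ge0 // ltW.
have dec n : qpoch q q n.+1 <= qpoch q q n.
  rewrite qpochS ler_piMr ?(ltW (qpoch_gt0 _)) // lerBlDr lerDl exprn_ge0 //.
have decr m n : (m <= n)%N -> qpoch q q n <= qpoch q q m.
  move=> /subnKC <-; elim: (n - m)%N => [|k IH]; first by rewrite addn0.
  by rewrite addnS; exact: le_trans (dec _) IH.
exists (qpoch q q N / 2); first by rewrite divr_gt0 ?qpoch_gt0.
move=> n; have [nN|Nn] := leqP n N.
  apply: le_trans (decr _ _ nN).
  by rewrite ler_pdivrMr // ler_peMr ?(ltW (qpoch_gt0 _)) // ler1n.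
have key k : qpoch q q N * (1 - (q ^+ N - q ^+ (N + k)) / (1 - q)) <=
    qpoch q q (N + k).
  elim: k => [|k IH]; first by rewrite addn0 subrr mul0r subr0 mulr1.
  rewrite addnS qpochS.
  have H : qpoch q q (N + k) * q ^+ (N + k).+1 <= qpoch q q N * q ^+ (N + k).
    apply: ler_pM; rewrite ?exprn_ge0 ?(ltW (qpoch_gt0 _)) //.
      by apply: decr; exact: leq_addr.
    by rewrite ler_wiXn2l // ltW.
  have -> : (q ^+ N - q ^+ (N + k).+1) / (1 - q) =
     (q ^+ N - q ^+ (N + k)) / (1 - q) + q ^+ (N + k).
    by rewrite exprS; field; rewrite gt_eqF.
  set S := _ / _ in IH *; move: IH H; rewrite !mulrBr mulrDr !mulr1; lra.
have := key (n - N)%N; rewrite subnKC ?(ltnW Nn) //; apply: le_trans.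
rewrite ler_pM2l ?qpoch_gt0 //.
have : 0 <= q ^+ n / (1 - q) by rewrite divr_ge0 ?exprn_ge0 // ltW.
rewrite mulrBl; lra.
Qed.

(** The series sum_j q^(j (n+1)) / (q; q)_j, whose sum is 1 / (q^(n+1); q)_oo
    by Euler. *)
Definition euler_psum n J := \sum_(j < J) q ^+ (j * n.+1) / qpoch q q j.

(** In the difference of the two series, the factor 1 - q^j cancels the last
    factor of (q; q)_j. *)
Lemma euler_psumS n J :
  euler_psum n J.+1 - euler_psum n.+1 J.+1 = q ^+ n.+1 * euler_psum n J.
Proof.
rewrite /euler_psum -sumrB big_ord_recl /= !mul0n subrr add0r mulr_sumr.
apply: eq_bigr => j _; rewrite /bump /= add1n qpochS.
have := qpoch_gt0 j; have := factor_gt0 j; rewrite -exprS => f0 p0.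
rewrite [(j.+1 * n.+2)%N]mulnS exprD mulSn exprD.
by field; rewrite !gt_eqF.
Qed.

Lemma euler_term_ge0 n j : 0 <= q ^+ (j * n.+1) / qpoch q q j.
Proof. by rewrite divr_ge0 ?exprn_ge0 // ltW // qpoch_gt0. Qed.

Lemma euler_psum_bound : exists2 B, 0 <= B & forall n J,
  1 <= euler_psum n J.+1 <= 1 + q ^+ n.+1 * B.
Proof.
have [del del0 Hdel] := qpoch_lbound.
exists ((1 - q)^-1 / del) => [|n J]; first by rewrite divr_ge0 ?invr_ge0 // ltW.
rewrite /euler_psum big_ord_recl /= mul0n expr0 qpoch0 divr1 lerDl.
rewrite sumr_ge0 /= ?lerD2l => [|j _]; last exact: euler_term_ge0.
have -> : q ^+ n.+1 * ((1 - q)^-1 / del) = (q ^+ n.+1 / del) * (1 - q)^-1 by ring.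
apply: (@le_trans _ _ (q ^+ n.+1 / del * \sum_(j < J) q ^+ j)).
  rewrite mulr_sumr; apply: ler_sum => j _; rewrite /bump /= add1n.
  rewrite mulrAC ler_pM ?exprn_ge0 ?invr_ge0 ?(ltW (qpoch_gt0 _)) //.
    by rewrite -exprD ler_wiXn2l ?(ltW hq1) // mulnC mulSn mulnS; lia.
  by rewrite lef_pV2 ?posrE ?qpoch_gt0.
rewrite ler_wpM2l ?divr_ge0 ?exprn_ge0 ?(ltW del0) //.
rewrite -/(qnat q J) qnatE // ler_pdivrMr // mulVf ?gt_eqF //.
by rewrite lerBlDr lerDl exprn_ge0.
Qed.

Definition euler_sum n := limn (euler_psum n).

Lemma cvg_euler_psum n : euler_psum n @ \oo --> euler_sum n.
Proof.
have [B B0 HB] := euler_psum_bound; apply: nondecreasing_is_cvgn.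
  apply/nondecreasing_seqP => J.
  by rewrite /euler_psum big_ord_recr /= lerDl euler_term_ge0.
exists (1 + q ^+ n.+1 * B) => _ [J _ <-].
case: J => [|J]; last by case/andP: (HB n J).
by rewrite /euler_psum big_ord0 addr_ge0 // mulr_ge0 // exprn_ge0.
Qed.

Lemma euler_sumS n : euler_sum n.+1 = (1 - q ^+ n.+1) * euler_sum n.
Proof.
have sh m : euler_psum m J.+1 @[J --> \oo] --> euler_sum m.
  by have /(cvg_comp _ _ (cvg_addnl 1)) := @cvg_euler_psum m.
have H1 : euler_psum n J.+1 - euler_psum n.+1 J.+1 @[J --> \oo] -->
    euler_sum n - euler_sum n.+1 by apply: cvgB; exact: sh.
have H2 : euler_psum n J.+1 - euler_psum n.+1 J.+1 @[J --> \oo] -->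
    q ^+ n.+1 * euler_sum n.
  under eq_fun do rewrite euler_psumS.
  by apply: cvgMr; exact: cvg_euler_psum.
have := cvg_lim (@Rhausdorff R) H1; rewrite (cvg_lim (@Rhausdorff R) H2) => E.
by rewrite mulrBl mul1r E; ring.
Qed.

Lemma euler_sumE n : euler_sum n = euler_sum 0 * qpoch q q n.
Proof.
elim: n => [|n IH]; first by rewrite qpoch0 mulr1.
by rewrite euler_sumS IH qpochS mulrC mulrA.
Qed.

(** The sums S_n satisfy S_(n+1) = (1 - q^(n+1)) S_n and tend to 1, which
    determines them. *)
Lemma euler_identity n : qpoch_inf q q * euler_sum n = qpoch q q n.
Proof.
have [B B0 HB] := euler_psum_bound.
have lim1 : euler_sum n @[n --> \oo] --> (1 : R).
  apply: (@squeeze_cvgr _ _ _ _ (fun=> 1) (fun n => 1 + q ^+ n.+1 * B)).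
  - apply: nearW => m.
    have sh : euler_psum m J.+1 @[J --> \oo] --> euler_sum m.
      by have /(cvg_comp _ _ (cvg_addnl 1)) := @cvg_euler_psum m.
    rewrite -(cvg_lim (@Rhausdorff R) sh); apply/andP; split.
      by apply: limr_ge; [apply/cvg_ex; eexists; exact: sh|];
        apply: nearW => J; case/andP: (HB m J).
    by apply: limr_le; [apply/cvg_ex; eexists; exact: sh|];
      apply: nearW => J; case/andP: (HB m J).
  - exact: cvg_cst.
  - rewrite -[X in _ --> X]addr0; apply: cvgD; first exact: cvg_cst.
    rewrite -(mul0r B); apply: cvgMl.
    have := @cvg_expr R q; rewrite ger0_norm // => /(_ hq1).
    by move=> /(cvg_comp _ _ (cvg_addnl 1)).
have S0 : euler_sum 0 != 0.
  apply/eqP => S0; have : euler_sum n @[n --> \oo] --> (0 : R).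
    under eq_fun do rewrite euler_sumE S0 mul0r.
    exact: cvg_cst.
  move/(cvg_lim (@Rhausdorff R)); rewrite (cvg_lim (@Rhausdorff R) lim1) => /eqP.
  by rewrite oner_eq0.
have qi : qpoch_inf q q = (euler_sum 0)^-1.
  apply: (@cvg_lim _ (@Rhausdorff R)).
  have -> : qpoch q q = fun n => (euler_sum 0)^-1 * euler_sum n.
    by apply/funext => m; rewrite (euler_sumE m) mulKf.
  by rewrite -[X in _ --> X]mulr1; apply: cvgMr.
by rewrite qi (euler_sumE n) mulKf.
Qed.

Lemma qpoch_inf_ge0 : 0 <= qpoch_inf q q.
Proof.
have [B B0 HB] := euler_psum_bound.
have := euler_identity 0; rewrite qpoch0 => E.
have S1 : 0 <= euler_sum 0.
  apply: limr_ge; first by apply/cvg_ex; eexists; exact: cvg_euler_psum.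
  by apply: nearW => J; apply: sumr_ge0 => j _; exact: euler_term_ge0.
have S0 : 0 < euler_sum 0.
  by rewrite lt_def S1 andbT; apply/eqP => S0; move: E; rewrite S0 mulr0 => /eqP;
    rewrite eq_sym oner_eq0.
by rewrite -(pmulr_lge0 _ S0) E.
Qed.

(** cnorm n is (beta / (1 - q))^n times (q; q)_n, which is bounded below. *)
Lemma cvg_inv_cnorm (x : R) : 0 <= x -> x < beta / (1 - q) ->
  cvgn (series (fun n => x ^+ n / cnorm n)).
Proof.
move=> x0 xb; have [del del0 Hdel] := qpoch_lbound.
have b0 : 0 < beta / (1 - q) by rewrite divr_gt0.
pose t := x / (beta / (1 - q)).
have t0 : 0 <= t by rewrite divr_ge0 // ltW.
have t1 : t < 1 by rewrite ltr_pdivrMr // mul1r.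
apply: (@series_le_cvg _ _ (geometric del^-1 t)).
- by move=> n; rewrite divr_ge0 ?exprn_ge0 // ltW // cnorm_gt0.
- by move=> n; rewrite /= mulr_ge0 ?exprn_ge0 ?invr_ge0 // ltW.
- move=> n; rewrite /= cnormE invfM mulrA -expr_div_n mulrC.
  rewrite ler_pM ?invr_ge0 ?exprn_ge0 ?(ltW (qpoch_gt0 _)) //.
  by rewrite lef_pV2 ?posrE ?qpoch_gt0.
- by apply: is_cvg_geometric_series; rewrite ger0_norm.
Qed.

End q_numbers.

(** * The q-Charlier polynomials *)

Section q_charlier.
Context {R : realType}.
Variables q beta : R.
Hypotheses (hq0 : 0 <= q) (hq1 : q < 1) (hbeta : 0 < beta).
Variable mu : probability R R.
Hypothesis hmu : is_qpoisson q beta mu.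

Local Notation C := (qcharlier q beta).
Local Notation c := (cnorm q beta).

(** For n = 0 the last term vanishes since [0]_q = 0, so the junk index n.-1
    is harmless. *)
Lemma qcharlier_rec n : 'X * C n =
  C n.+1 + (qnat q n + beta) *: C n + (beta * qnat q n) *: C n.-1.
Proof.
case: n => [|n].
  by rewrite qnat0 mulr0 scale0r addr0 add0r /= alg_polyC subrK mulr1.
by rewrite /= -!mul_polyC; ring.
Qed.

Lemma qcharlier0 : C 0 = 1. Proof. by []. Qed.

Lemma Rintegrable_mu_poly p : Rintegrable mu (fun x => p.[x]).
Proof. by have [[M /Rintegrable_poly]] := hmu. Qed.

Definition moment (p : {poly R}) := \int[mu]_x p.[x].

Lemma momentD p1 p2 : moment (p1 + p2) = moment p1 + moment p2.
Proof.
rewrite /moment -RintegralD //; try exact: Rintegrable_mu_poly.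
by apply: eq_Rintegral => x _; rewrite hornerD.
Qed.

Lemma momentZ a p : moment (a *: p) = a * moment p.
Proof.
rewrite /moment -RintegralZl //; last exact: Rintegrable_mu_poly.
by apply: eq_Rintegral => x _; rewrite hornerZ.
Qed.

Lemma moment_orthogonal m n : m != n -> moment (C m * C n) = 0.
Proof.
move=> mn; case: hmu => _ /(_ m n mn) <-.
by apply: eq_Rintegral => x _; rewrite hornerM.
Qed.

(** Expanding x C_n C_(n+1) by the recurrence for x C_n, and by the one for
    x C_(n+1), relates the norms of C_(n+1) and C_n. *)
Lemma moment_sqr n : moment (C n * C n) = c n.
Proof.
elim: n => [|n IH].
  rewrite qcharlier0 cnorm0 /moment mulr1; under eq_Rintegral do rewrite hornerC.
  by rewrite Rintegral_cst // mul1r [X in fine X](_ : _ = 1%E) //;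
    exact: probability_setT.
have E1 : moment (C n.+1 * ('X * C n)) = moment (C n.+1 * C n.+1).
  rewrite qcharlier_rec !mulrDr -!scalerAr !momentD !momentZ.
  rewrite [moment (_ * C n)]moment_orthogonal; last by rewrite gtn_eqF.
  rewrite [moment (_ * C n.-1)]moment_orthogonal ?mulr0 ?addr0 //.
  by apply/eqP; case: n {IH} => //= n; lia.
have E2 : moment (C n.+1 * ('X * C n)) = beta * qnat q n.+1 * moment (C n * C n).
  have swap (u v : {poly R}) : u * ('X * v) = ('X * u) * v by rewrite mulrCA mulrA.
  have split3 (u v w t : {poly R}) a b : moment ((u + a *: v + b *: w) * t) =
      moment (u * t) + a * moment (v * t) + b * moment (w * t).
    by rewrite !mulrDl -!scalerAl !momentD !momentZ.
  rewrite swap qcharlier_rec split3 succnK.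
  rewrite [moment (C n.+2 * _)]moment_orthogonal; last by apply/eqP; lia.
  rewrite [moment (C n.+1 * _)]moment_orthogonal; last by apply/eqP; lia.
  by rewrite mulr0 !add0r.
by rewrite -E1 E2 IH cnormS.
Qed.

Definition charlier_fun n (x : R) : R[i] := ((C n).[x])%:C.
Local Notation e := charlier_fun.

Lemma L2_poly p : L2 mu (fun x => (p.[x])%:C).
Proof.
apply/L2P; split.
  by split => /=; [exact: measurable_poly|exact: measurable_cst].
apply: eq_Rintegrable (Rintegrable_mu_poly (p ^+ 2)) => x.
by rewrite sqmodC horner_exp.
Qed.

Lemma L2_charlier n : L2 mu (e n). Proof. exact: L2_poly. Qed.

Lemma l2dot_charlier m n : l2dot mu (e m) (e n) = (if m == n then c n else 0)%:C.
Proof.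
have -> : l2dot mu (e m) (e n) = (moment (C m * C n))%:C.
  rewrite /l2dot (_ : (fun x => _) = fun x => ((C m * C n).[x])%:C); last first.
    by apply/funext => x; rewrite /charlier_fun conjc_real -rmorphM hornerM.
  apply: complex_eqP => //=.
  by rewrite Rintegral_cst // mul0r.
by case: eqP => [->|/eqP/moment_orthogonal ->//]; rewrite moment_sqr.
Qed.

(** Completeness: orthogonality to the q-Charlier polynomials passes to all
    polynomials through the three-term recurrence. *)
Lemma charlier_complete f : L2 mu f -> (forall n, l2dot mu (e n) f = 0) ->
  {ae mu, forall x, f x = 0}.
Proof.
move=> fi fC.
have Xkn k n : l2dot mu (fun x => ((('X^k * C n).[x])%:C)) f = 0.
  elim: k n => [|k IH] n.
    by rewrite -[RHS](fC n); congr l2dot; apply/funext => x; rewrite expr0 mul1r.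
  have -> : (fun x : R => ((('X^(k.+1) * C n).[x])%:C)) = (fun x =>
      (('X^k * C n.+1).[x])%:C + (qnat q n + beta)%:C * (('X^k * C n).[x])%:C +
      (beta * qnat q n)%:C * (('X^k * C n.-1).[x])%:C).
    apply/funext => x; rewrite -!rmorphM -!rmorphD /= -!hornerZ -!hornerD.
    by rewrite exprSr -mulrA qcharlier_rec !mulrDr -!scalerAr.
  rewrite !l2dotDl ?l2dotZl ?IH ?mulr0 ?addr0 //;
    do ?[exact: L2_poly | exact: (L2Z _ (L2_poly _))].
  by apply: L2D; [exact: L2_poly|exact: (L2Z _ (L2_poly _))].
have all0 p : l2dot mu (fun x => (p.[x])%:C) f = 0.
  have -> : (fun x : R => (p.[x])%:C) = (fun x =>
      \sum_(k < size p) (p`_k)%:C * (('X^k * C 0).[x])%:C).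
    apply/funext => x; rewrite horner_coef rmorph_sum; apply: eq_bigr => k _.
    by rewrite qcharlier0 mulr1 hornerXn rmorphM.
  rewrite (@l2dot_suml _ _ _ _ _ _ (fun k x => (p`_k)%:C * (('X^k * C 0).[x])%:C)) //.
    by rewrite big1 // => k _; rewrite l2dotZl ?Xkn ?mulr0 //; exact: L2_poly.
  by move=> k; apply: L2Z; exact: L2_poly.
have [[M HM] _] := hmu.
have H1 := L2_dot_integrable (L2_poly 1) fi.
have [f1 f2] : Cintegrable mu f.
  by move: H1; under eq_fun do rewrite hornerC conjc1 mul1r.
have dotE p : l2dot mu (fun x => (p.[x])%:C) f =
    (\int[mu]_x (p.[x] * complex.Re (f x))) +i*
    (\int[mu]_x (p.[x] * complex.Im (f x))).
  congr (_ +i* _); apply: eq_Rintegral => x _.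
    by rewrite conjc_real ReM /= mul0r subr0.
  by rewrite conjc_real ImM /= mul0r addr0.
have r0 : {ae mu, forall x, complex.Re (f x) = 0}.
  by apply: (poly_orthogonal_ae0 HM f1) => p; have := all0 p; rewrite dotE => -[].
have i0 : {ae mu, forall x, complex.Im (f x) = 0}.
  by apply: (poly_orthogonal_ae0 HM f2) => p; have := all0 p; rewrite dotE => -[].
by apply: filterS2 r0 i0 => x rx ix; apply: complex_eqP.
Qed.

Lemma l2sqnorm_ae0 f : L2 mu f -> {ae mu, forall x, f x = 0} ->
  l2sqnorm mu f = 0.
Proof.
move=> fi f0; rewrite /l2sqnorm /Rintegral.
rewrite (ae_eq_integral (cst 0%E)) ?integral0 //.
- exact: (measurable_int _ (L2_sqmod fi)).
- by apply: filterS f0 => x -> _; rewrite sqmod0.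
Qed.

End q_charlier.

(** * Integrals of complex functions over an interval *)

Section interval_integrals.
Context {R : realType}.
Implicit Types (f g : R -> R[i]) (a b : R).

Definition Ccontinuous f :=
  continuous (fun t => complex.Re (f t)) /\ continuous (fun t => complex.Im (f t)).

Lemma Ccontinuous_cst (w : R[i]) : Ccontinuous (fun=> w).
Proof. by split=> t; exact: cvg_cst. Qed.

Lemma CcontinuousD f g : Ccontinuous f -> Ccontinuous g ->
  Ccontinuous (fun t => f t + g t).
Proof.
move=> [f1 f2] [g1 g2]; split.
- under eq_fun do rewrite ReD.
  by move=> t; apply: cvgD; [exact: f1|exact: g1].
- under eq_fun do rewrite ImD.
  by move=> t; apply: cvgD; [exact: f2|exact: g2].
Qed.

Lemma CcontinuousM f g : Ccontinuous f -> Ccontinuous g ->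
  Ccontinuous (fun t => f t * g t).
Proof.
move=> [f1 f2] [g1 g2]; split.
- under eq_fun do rewrite ReM.
  by move=> t; apply: cvgB; apply: cvgM; [exact: f1|exact: g1|exact: f2|exact: g2].
- under eq_fun do rewrite ImM.
  by move=> t; apply: cvgD; apply: cvgM; [exact: f1|exact: g2|exact: f2|exact: g1].
Qed.

Lemma CcontinuousB f g : Ccontinuous f -> Ccontinuous g ->
  Ccontinuous (fun t => f t - g t).
Proof.
move=> cf cg; have := CcontinuousD cf (CcontinuousM (Ccontinuous_cst (-1)) cg).
by under eq_fun do rewrite mulN1r.
Qed.

Lemma Ccontinuous_comp f (u : R -> R) : Ccontinuous f -> continuous u ->
  Ccontinuous (fun t => f (u t)).
Proof.
move=> [f1 f2] cu; split=> t; first exact: (continuous_comp (cu t) (f1 (u t))).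
exact: (continuous_comp (cu t) (f2 (u t))).
Qed.

Definition Cint a b f : R[i] := Cintegral (@lebesgue_measure R) `[a, b] f.

Local Notation integrable_on a b f :=
  ((@lebesgue_measure R).-integrable `[a, b] (EFin \o (f : R -> R))).

Lemma continuous_integrable_on a b (u : R -> R) : continuous u ->
  integrable_on a b u.
Proof.
move=> cu; apply: continuous_compact_integrable; first exact: segment_compact.
exact: continuous_subspaceT.
Qed.

Lemma CintD a b f g : Ccontinuous f -> Ccontinuous g ->
  Cint a b (fun t => f t + g t) = Cint a b f + Cint a b g.
Proof.
move=> [f1 f2] [g1 g2]; apply: complex_eqP; rewrite ?ReD ?ImD /=.
- under eq_Rintegral do rewrite ReD.
  by rewrite RintegralD //; exact: continuous_integrable_on.
- under eq_Rintegral do rewrite ImD.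
  by rewrite RintegralD //; exact: continuous_integrable_on.
Qed.

Lemma CintZ a b (w : R[i]) f : Ccontinuous f ->
  Cint a b (fun t => w * f t) = w * Cint a b f.
Proof.
move=> [f1 f2]; have i1 := continuous_integrable_on a b f1.
have i2 := continuous_integrable_on a b f2.
have iz (r : R) (u : R -> R) : integrable_on a b u ->
    integrable_on a b (fun t => r * u t).
  move=> ui; rewrite (_ : EFin \o _ = fun t => (r%:E * (EFin \o u) t)%E) //.
  exact: integrableZl.
apply: complex_eqP; rewrite ?ReM ?ImM /=.
- under eq_Rintegral do rewrite ReM.
  by rewrite RintegralB ?RintegralZl //; exact: iz.
- under eq_Rintegral do rewrite ImM.
  by rewrite RintegralD ?RintegralZl //; exact: iz.
Qed.

Lemma CintB a b f g : Ccontinuous f -> Ccontinuous g ->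
  Cint a b (fun t => f t - g t) = Cint a b f - Cint a b g.
Proof.
move=> cf cg; rewrite -mulN1r -CintZ // -CintD //.
  by congr Cintegral; apply/funext => t; rewrite mulN1r.
by apply: CcontinuousM => //; exact: Ccontinuous_cst.
Qed.

Lemma length_itv a b : a <= b -> fine (@lebesgue_measure R `[a, b]) = b - a.
Proof.
move=> ab; rewrite lebesgue_measure_itv /= lte_fin.
by case: ltgtP ab => // -> _; rewrite subrr.
Qed.

Lemma Cint_cst a b (w : R[i]) : a <= b -> Cint a b (fun=> w) = (b - a)%:C * w.
Proof.
move=> ab; apply: complex_eqP; rewrite ?ReM ?ImM /=.
- by rewrite Rintegral_cst // length_itv // mul0r subr0 mulrC.
- by rewrite Rintegral_cst // length_itv // mul0r addr0 mulrC.
Qed.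

Lemma Cint_sub_cst (w : R[i]) a b f : Ccontinuous f -> a <= b ->
  Cint a b f = (b - a)%:C * w + Cint a b (fun t => f t - w).
Proof.
move=> cf ab; rewrite CintB //; last exact: Ccontinuous_cst.
by rewrite Cint_cst // addrCA subrr addr0.
Qed.

Lemma eq_Cint a b f g : (forall t, a <= t <= b -> f t = g t) ->
  Cint a b f = Cint a b g.
Proof.
move=> fg; congr (_ +i* _); apply: eq_Rintegral => t.
  by rewrite mem_setE in_itv /= => /fg ->.
by rewrite mem_setE in_itv /= => /fg ->.
Qed.

(** The factor 2 comes from estimating the real and imaginary parts
    separately. *)
Lemma normc_Cint_le a b f B : Ccontinuous f -> a <= b ->
  (forall t, a <= t <= b -> Normc.normc (f t) <= B) ->
  Normc.normc (Cint a b f) <= 2 * ((b - a) * B).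
Proof.
move=> [f1 f2] ab fB.
have key (u : R -> R) : continuous u -> (forall t, a <= t <= b -> `|u t| <= B) ->
    `|\int[lebesgue_measure]_(t in `[a, b]) u t| <= (b - a) * B.
  move=> cu uB; have iu := continuous_integrable_on a b cu.
  apply: le_trans (le_normr_Rintegral _ iu) _ => //.
  have := @Rintegral_cst _ _ R (@lebesgue_measure R) `[a, b] (measurable_itv _) B.
  rewrite length_itv // mulrC => <-; apply: le_Rintegral => //.
  - exact: integrable_norm.
  - by apply: continuous_integrable_on => t; exact: cvg_cst.
apply: le_trans (normc_le _) _; rewrite mulr_natl mulr2n lerD //=.
- by apply: key => // t /fB; exact: le_trans (le_Re_normc _).
- by apply: key => // t /fB; exact: le_trans (le_Im_normc _).
Qed.

Lemma Cint_split a b c f : Ccontinuous f -> a <= b -> b <= c ->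
  Cint a c f = Cint a b f + Cint b c f.
Proof.
move=> [f1 f2] ab bc.
have key (u : R -> R) : continuous u ->
    \int[lebesgue_measure]_(t in `[a, c]) u t =
    \int[lebesgue_measure]_(t in `[a, b]) u t +
    \int[lebesgue_measure]_(t in `[b, c]) u t.
  move=> cu; have iu := continuous_integrable_on a c cu.
  have := @Rintegral_itvB _ u (BLeft a) (BRight c) b iu.
  rewrite !bnd_simp => /(_ ab bc); rewrite Rintegral_itv_obnd_cbnd; last first.
    apply: integrableS (continuous_integrable_on b c cu) => //.
    by apply: subset_itvr; rewrite bnd_simp.
  by move=> <-; rewrite addrC subrK.
by rewrite /Cint /Cintegral !key.
Qed.

End interval_integrals.

Section exponentials.
Context {R : realType}.
Implicit Types t s : R.

Definition expi t : R[i] := cos t +i* sin t.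

Lemma expiD s t : expi (s + t) = expi s * expi t.
Proof.
by apply: complex_eqP; rewrite ?ReM ?ImM /= ?cosD ?sinD // addrC [X in _ + X]mulrC
  mulrC addrC; ring.
Qed.

Lemma expi0 : expi 0 = 1.
Proof. by rewrite /expi cos0 sin0. Qed.

Lemma expiX t n : expi t ^+ n = expi (n%:R * t).
Proof.
elim: n => [|n IH]; first by rewrite mul0r expi0 expr0.
by rewrite exprS IH -expiD -natr1; congr expi; ring.
Qed.

Lemma expiJ t : conjc (expi t) = expi (- t).
Proof. by rewrite /expi cosN sinN. Qed.

Lemma expiN t : expi t * expi (- t) = 1.
Proof. by rewrite -expiD subrr expi0. Qed.

Lemma expiV t : (expi t)^-1 = expi (- t).
Proof.
have e0 : expi t != 0.
  by apply/eqP => e0; have := expiN t; rewrite e0 mul0r => /eqP; rewrite eq_sym oner_eq0.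
by apply: (mulfI e0); rewrite divff // expiN.
Qed.

Lemma sqmod_expi t : sqmod (expi t) = 1.
Proof. exact: cos2Dsin2. Qed.

Lemma normc_expi t : Normc.normc (expi t) = 1.
Proof. by rewrite normc_sqrt sqmod_expi sqrtr1. Qed.

Lemma expi_2pi n : expi (n%:R * (2 * pi)) = 1.
Proof.
rewrite -expiX; have -> : 2 * pi = pi *+ 2 :> R by rewrite mulr_natl.
by rewrite /expi cos2pi sin2pi expr1n.
Qed.

Lemma Ccontinuous_expi : Ccontinuous expi.
Proof. by split; [exact: continuous_cos|exact: continuous_sin]. Qed.

Lemma continuous_scale (k : R) : continuous (fun t => k * t).
Proof. by move=> t; apply: cvgMr; exact: cvg_id. Qed.

(** The orthogonality of the characters of the circle. *)
Lemma Cint_expi (k : R) : k != 0 -> expi (k * (2 * pi)) = 1 ->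
  Cint 0 (2 * pi) (fun t => expi (k * t)) = 0.
Proof.
move=> k0 k1; have p0 : 0 < 2 * pi :> R := @twopi_gt0 R.
have ftc (u U : R -> R) : continuous u -> (forall t, is_derive t 1 U (u t)) ->
    U 0 = U (2 * pi) -> \int[lebesgue_measure]_(t in `[0, 2 * pi]) u t = 0.
  move=> cu dU U0; rewrite /Rintegral (@continuous_FTC2 _ u U) //.
  - by rewrite U0 -EFinB subrr.
  - exact: continuous_subspaceT.
  - have cU t : {for t, continuous U}.
      by apply/differentiable_continuous/derivable1_diffP; case: (dU t).
    split.
    + by move=> t _; case: (dU t).
    + exact: cvg_at_right_filter (cU 0).
    + exact: cvg_at_left_filter (cU (2 * pi)).
  - by move=> t _; rewrite derive1E; case: (dU t).
have [ck sk] : cos (k * (2 * pi)) = 1 /\ sin (k * (2 * pi)) = 0.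
  by case: k1 => -> ->.
have [c1 c2] : Ccontinuous (fun t => expi (k * t)).
  exact: (Ccontinuous_comp Ccontinuous_expi (@continuous_scale k)).
apply: complex_eqP => /=.
- apply: (ftc _ (k^-1 \*: (sin \o (k \*: id)))) => //.
  + move=> t; apply: (is_derive_eq (is_deriveZ k^-1 (is_derive1_comp
      (is_derive_sin (k * t)) (is_deriveZ k (is_derive_id t 1))))).
    by rewrite /GRing.scale /= mulr1 mulrCA mulVf ?mulr1.
  + by rewrite /= /GRing.scale /= mulr0 sin0 sk.
- apply: (ftc _ ((- k^-1) \*: (cos \o (k \*: id)))) => //.
  + move=> t; apply: (is_derive_eq (is_deriveZ (- k^-1) (is_derive1_comp
      (is_derive_cos (k * t)) (is_deriveZ k (is_derive_id t 1))))).
    by rewrite /GRing.scale /= mulr1; field.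
  + by rewrite /= /GRing.scale /= mulr0 cos0 ck.
Qed.

End exponentials.

(** * The measure of the Hardy space *)

Section hardy_measure.
Context {R : realType}.
Variables q beta : R.
Hypotheses (hq0 : 0 <= q) (hq1 : q < 1) (hbeta : 0 < beta).

Local Notation nu := (nu_q q beta).
Local Notation rad := (nu_radius q beta).
Local Notation c := (cnorm q beta).
Local Notation leb := (@lebesgue_measure R).
Local Notation I02 := ([set` `[0%R, (2 * pi)%R]] : set R).

Let q1 : 0 < 1 - q. Proof. by rewrite subr_gt0. Qed.

Lemma nu_radius_sqr j : rad j ^+ 2 = q ^+ j * (beta / (1 - q)).
Proof.
rewrite /nu_radius exprMn sqr_sqrtr; last by rewrite divr_ge0 // ltW.
by rewrite -[X in X * _]powR_mulrn ?powR_ge0 // -powRrM divfK // powR_mulrn.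
Qed.

Lemma toC_circle (r t : R) : toC (circle_param r t) = r%:C * expi t.
Proof. by apply: complex_eqP; rewrite ?ReM ?ImM /=; ring. Qed.

Lemma nu_integral_ge0 (g : R * R -> R) : measurable_fun setT g ->
  (forall p, 0 <= g p) ->
  (\int[nu]_p (g p)%:E = (qpoch_inf q q)%:E *
    \sum_(j <oo) ((q ^+ j / qpoch q q j)%:E * ((2 * pi)^-1%:E *
      \int[leb]_(t in I02) (g (circle_param (rad j) t))%:E)))%E.
Proof.
move=> mg g0.
have mg' : measurable_fun setT (EFin \o g) by exact/measurable_EFinP.
have g0' p : (0 <= (g p)%:E)%E by rewrite lee_fin.
have gc j : measurable_fun setT (fun t => (g (circle_param (rad j) t))%:E).
  exact: measurableT_comp mg' (measurable_circle_param _).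
rewrite [LHS](ge0_integral_mscale _ measurableT _ mg') //= ger0_norm; last first.
  exact: qpoch_inf_ge0.
congr (_ * _)%E; rewrite ge0_integral_measure_series //.
apply: eq_eseriesr => j _.
rewrite (ge0_integral_mscale _ measurableT _ mg') //= ger0_norm; last first.
  by rewrite divr_ge0 ?exprn_ge0 // ltW // qpoch_gt0.
congr (_ * _)%E; rewrite /circle_prob ge0_integral_distribution //.
by rewrite integral_uniform ?subr0 // => [|t]; [exact: gc|exact: g0'].
Qed.

(** This computes the total mass, the norms of the monomials and the integrals
    of constants at once. *)
Lemma nu_integral_radial (g : R * R -> R) (K : R) n : measurable_fun setT g ->
  (forall p, 0 <= g p) ->
  (forall j, \int[leb]_(t in I02) (g (circle_param (rad j) t))%:E =
    (2 * pi * (K * (rad j ^+ 2) ^+ n))%:E)%E ->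
  (\int[nu]_p (g p)%:E = (K * c n)%:E)%E.
Proof.
move=> mg g0 gE; rewrite nu_integral_ge0 //.
have p0 : 2 * pi != 0 :> R by rewrite gt_eqF // twopi_gt0.
have -> : (\sum_(j <oo) ((q ^+ j / qpoch q q j)%:E * ((2 * pi)^-1%:E *
      \int[leb]_(t in I02) (g (circle_param (rad j) t))%:E)) =
    (K * (beta / (1 - q)) ^+ n * euler_sum q n)%:E)%E.
  apply/cvg_lim => //.
  have -> : (fun N => \sum_(0 <= j < N) ((q ^+ j / qpoch q q j)%:E * ((2 * pi)^-1%:E *
      \int[leb]_(t in I02) (g (circle_param (rad j) t))%:E)))%E =
      EFin \o (fun N => K * (beta / (1 - q)) ^+ n * euler_psum q n N).
    apply/funext => N; rewrite /= /euler_psum mulr_sumr -sumEFin big_mkord.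
    apply: eq_bigr => j _; rewrite gE -!EFinM nu_radius_sqr exprMn -exprM mulnS exprD.
    congr EFin; have := qpoch_gt0 hq0 hq1 j; move=> /lt0r_neq0.
    move: (qpoch q q j) (2 * pi) p0 (beta / (1 - q)) => Q P P0 X Q0.
    by field; rewrite P0 Q0.
  have H : K * (beta / (1 - q)) ^+ n * euler_psum q n N @[N --> \oo] -->
      K * (beta / (1 - q)) ^+ n * euler_sum q n.
    by apply: cvgMr; exact: cvg_euler_psum.
  by apply: cvg_EFin; [exact: nearW|exact: H].
rewrite -EFinM cnormE // -(euler_identity hq0 hq1 hbeta n); congr EFin; ring.
Qed.

Lemma nu_setT : nu setT = 1%E.
Proof.
have -> : nu setT = (\int[nu]_p (1 : R)%:E)%E by rewrite integral_cst // mul1e.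
rewrite (@nu_integral_radial (fun=> 1) 1 0) ?cnorm0 ?mulr1 // => j.
rewrite integral_cst //= lebesgue_measure_itv /= lte_fin twopi_gt0 mul1e.
by rewrite expr0 !mulr1 -EFinB subr0.
Qed.

Lemma nu_fin : (nu setT < +oo)%E. Proof. by rewrite nu_setT ltry. Qed.

(** Adding the bound B to phi reduces to nonnegative functions, which integrate
    term by term against the series of measures. *)
Lemma nu_integral_mean0 (phi : R * R -> R) B : measurable_fun setT phi ->
  (forall p, `|phi p| <= B) ->
  (forall j, exists2 u : R -> R, continuous u &
    (forall t, phi (circle_param (rad j) t) = u t) /\
    \int[leb]_(t in `[0, 2 * pi]) u t = 0) ->
  \int[nu]_p phi p = 0.
Proof.
move=> mphi phiB circ.
have i1 : Rintegrable nu phi by exact: bounded_Rintegrable nu_fin mphi phiB.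
have i2 : Rintegrable nu (fun=> B).
  exact: (@bounded_Rintegrable _ _ _ _ _ `|B| nu_fin).
have H : (\int[nu]_p (phi p + B)%:E = (B * c 0)%:E)%E.
  apply: nu_integral_radial.
  - by apply: measurable_funD.
  - by move=> p; have := phiB p; rewrite ler_norml => /andP[? _]; lra.
  - move=> j; have [u cu [uE u0]] := circ j.
    under eq_integral do rewrite uE.
    have iu := continuous_integrable_on 0 (2 * pi) cu.
    have iB : leb.-integrable `[0, 2 * pi] (EFin \o (fun=> B)).
      by apply: continuous_integrable_on => t; exact: cvg_cst.
    rewrite -[LHS]fineK; last first.
      by apply: integrable_fin_num => //; have := integrableD _ iu iB; exact.
    congr EFin; rewrite -[LHS]/(\int[leb]_(t in `[0, 2 * pi]) (u t + B)).
    rewrite RintegralD // u0 add0r Rintegral_cst // length_itv ?ltW ?twopi_gt0 //.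
    by rewrite expr0 mulr1 subr0 mulrC.
have := RintegralD measurableT i1 i2.
rewrite {1}/Rintegral H [fine _%:E]/= Rintegral_cst // [X in fine X](_ : _ = 1%E); last first.
  exact: nu_setT.
rewrite cnorm0 /= !mulr1 => E; apply: (@addIr _ B); by rewrite -E add0r.
Qed.

Let D : set (R * R) := toC @^-1` cOmega q beta.

Lemma measurable_disc : measurable (toC @^-1` cOmega q beta).
Proof.
have mf : measurable_fun setT (fun p : R * R => p.1 ^+ 2 + p.2 ^+ 2).
  by apply: measurable_funD; apply: measurable_funX.
have -> : toC @^-1` cOmega q beta =
    (fun p : R * R => p.1 ^+ 2 + p.2 ^+ 2) @^-1` `]-oo, beta / (1 - q)].
  by apply/seteqP; split => p /=; rewrite in_itv.
by rewrite -[X in measurable X]setTI; exact: mf.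
Qed.

(** Integrals over the closed disc become integrals over the plane, so that the
    theory of L^2 applies whatever u is off the disc. *)
Definition cut (u : R[i] -> R[i]) (p : R * R) : R[i] :=
  (\1_(toC @^-1` cOmega q beta) p)%:C * u (toC p).

Lemma nu_dotE u v : nu_dot q beta u v = l2dot nu (cut u) (cut v).
Proof.
have key (h : R[i] -> R) : h 0 = 0 ->
    \int[nu]_(p in D) h (conjc (u (toC p)) * v (toC p)) =
    \int[nu]_p h (conjc (cut u p) * cut v p).
  move=> h0; rewrite Rintegral_mkcond; apply: eq_Rintegral => p _.
  rewrite patchE /cut indicE -/D; case: (p \in D).
    by rewrite !mul1r.
  by rewrite !mul0r conjc0 mul0r h0.
by congr (_ +i* _); exact: key.
Qed.

Lemma cut_in u p : D p -> cut u p = u (toC p).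
Proof. by move=> Dp; rewrite /cut indicE mem_set // mul1r. Qed.

Lemma cut_out u p : ~ D p -> cut u p = 0.
Proof. by move=> Dp; rewrite /cut indicE memNset // mul0r. Qed.

Lemma cutB u v p : cut (fun z => u z - v z) p = cut u p - cut v p.
Proof. by rewrite /cut mulrBr. Qed.

Lemma circle_in_disc j t : D (circle_param (rad j) t).
Proof.
rewrite /D /= /cOmega /= toC_circle sqmodM sqmodC sqmod_expi mulr1 nu_radius_sqr.
by rewrite ler_piMl ?divr_ge0 // ?exprn_ile1 // ltW.
Qed.

Definition mono n : R * R -> R[i] := cut (fun z => z ^+ n).

Lemma Cmeasurable_mono n : Cmeasurable (mono n).
Proof.
apply: CmeasurableM.
  split => /=; last exact: measurable_cst.
  by apply: measurable_indic; exact: measurable_disc.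
elim: n => [|n IH]; first exact: Cmeasurable_cst.
under eq_fun do rewrite exprS.
by apply: CmeasurableM => //; split; [exact: measurable_fst|exact: measurable_snd].
Qed.

Lemma normc_mono_le n p : Normc.normc (mono n p) <= Num.sqrt (beta / (1 - q)) ^+ n.
Proof.
have [Dp|nDp] := pselect (D p); last first.
  by rewrite /mono cut_out // Normc.normc0 exprn_ge0 // sqrtr_ge0.
rewrite /mono cut_in // normcX lerXn2r ?nnegrE ?normc_ge0 ?sqrtr_ge0 //.
by rewrite normc_sqrt ler_wsqrtr.
Qed.

Lemma L2_mono n : L2 nu (mono n).
Proof.
pose B := Num.sqrt (beta / (1 - q)) ^+ n.
apply: (@L2_le _ _ _ _ _ (fun=> B ^+ 2)); first exact: Cmeasurable_mono.
  exact: (@bounded_Rintegrable _ _ _ _ _ `|B ^+ 2| nu_fin).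
move=> p; rewrite sqmodE lerXn2r ?nnegrE ?normc_ge0 ?exprn_ge0 ?sqrtr_ge0 //.
exact: normc_mono_le.
Qed.

Lemma mono_circle n j t : mono n (circle_param (rad j) t) =
  (rad j ^+ n)%:C * expi (n%:R * t).
Proof.
by rewrite /mono cut_in; [rewrite toC_circle exprMn expiX rmorphXn|
  exact: circle_in_disc].
Qed.

Lemma l2sqnorm_mono n : l2sqnorm nu (mono n) = c n.
Proof.
rewrite /l2sqnorm /Rintegral (@nu_integral_radial _ 1 n) ?mul1r //.
- exact: measurable_sqmod (Cmeasurable_mono n).
- by move=> p; exact: sqmod_ge0.
- move=> j; under eq_integral do rewrite mono_circle sqmodM sqmodC sqmod_expi mulr1.
  rewrite integral_cst //= lebesgue_measure_itv /= lte_fin twopi_gt0 mul1r.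
  by rewrite -EFinB -EFinM subr0 mulrC exprAC.
Qed.

(** The monomials are orthogonal in L^2(nu) since the characters of the circle
    are, and their norms come from Euler's identity. *)
Lemma l2dot_mono m n : l2dot nu (mono m) (mono n) = (if m == n then c n else 0)%:C.
Proof.
case: eqP => [->|/eqP mn]; first by rewrite l2dotff l2sqnorm_mono.
pose h p := conjc (mono m p) * mono n p.
have [mh1 mh2] : Cmeasurable h.
  by apply: CmeasurableM; [apply: CmeasurableJ|]; exact: Cmeasurable_mono.
pose B := Num.sqrt (beta / (1 - q)) ^+ m * Num.sqrt (beta / (1 - q)) ^+ n.
have hB p : Normc.normc (h p) <= B.
  by rewrite /h Normc.normcM normc_conj ler_pM ?normc_ge0 ?normc_mono_le.
pose k : R := n%:R - m%:R.
have k0 : k != 0 by rewrite subr_eq0 eqr_nat eq_sym.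
have k2pi : expi (k * (2 * pi)) = 1.
  by rewrite /k mulrBl expiD -expiJ !expi_2pi conjc1 mulr1.
have hE j t : h (circle_param (rad j) t) = (rad j ^+ m * rad j ^+ n)%:C * expi (k * t).
  rewrite /h !mono_circle conjcM conjc_real expiJ mulrACA -rmorphM -expiD.
  by congr (_ * expi _); rewrite /k; ring.
have ck : Ccontinuous (fun t => expi (k * t)).
  exact: (Ccontinuous_comp Ccontinuous_expi (@continuous_scale _ k)).
have cz (j : nat) : Ccontinuous (fun t => (rad j ^+ m * rad j ^+ n)%:C * expi (k * t)).
  by apply: CcontinuousM => //; exact: Ccontinuous_cst.
have iz j : Cint 0 (2 * pi) (fun t => (rad j ^+ m * rad j ^+ n)%:C * expi (k * t)) = 0.
  by rewrite CintZ // Cint_expi // mulr0.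
apply: complex_eqP.
- apply: (@nu_integral_mean0 (fun p => complex.Re (h p)) B) => // [p|j].
    exact: le_trans (le_Re_normc _) (hB p).
  exists (fun t => complex.Re ((rad j ^+ m * rad j ^+ n)%:C * expi (k * t))).
    by case: (cz j).
  by split => [t|]; [rewrite hE|have [] := iz j].
- apply: (@nu_integral_mean0 (fun p => complex.Im (h p)) B) => // [p|j].
    exact: le_trans (le_Im_normc _) (hB p).
  exists (fun t => complex.Im ((rad j ^+ m * rad j ^+ n)%:C * expi (k * t))).
    by case: (cz j).
  by split => [t|]; [rewrite hE|have [] := iz j].
Qed.

End hardy_measure.

(** * Goursat's theorem *)

Section goursat.
Context {R : realType}.

Lemma nested_halving (u : nat -> R) (L : R) : 0 <= L ->
  (forall n, u n <= u n.+1 <= u n + L / 2 ^+ n.+1) ->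
  exists s, forall n, u n <= s <= u n + L / 2 ^+ n.
Proof.
move=> L0 uL.
have halve n : L / 2 ^+ n = L / 2 ^+ n.+1 + L / 2 ^+ n.+1.
  by rewrite exprS; field; rewrite expf_neq0.
have nd : nondecreasing_seq u by apply/nondecreasing_seqP => n; case/andP: (uL n).
have ni n k : u (n + k)%N + L / 2 ^+ (n + k) <= u n + L / 2 ^+ n.
  elim: k => [|k IH]; first by rewrite addn0.
  rewrite addnS; apply: le_trans IH; have /andP[_ H] := uL (n + k)%N.
  by rewrite (halve (n + k)%N) addrA lerD2r.
have ub n m : u m <= u n + L / 2 ^+ n.
  have p k : 0 <= L / 2 ^+ k by rewrite divr_ge0 // exprn_ge0.
  have [nm|mn] := leqP n m.
    by have := ni n (m - n)%N; rewrite subnKC // => H; apply: le_trans H; rewrite lerDl.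
  by apply: le_trans (nd _ _ (ltnW mn)) _; rewrite lerDl.
have cu : cvgn u.
  by apply: nondecreasing_is_cvgn => //; exists (u 0%N + L / 2 ^+ 0) => _ [m _ <-].
exists (limn u) => n; apply/andP; split; first exact: nondecreasing_cvgn_le.
by apply: limr_le => //; apply: nearW => m.
Qed.

Variable h : R -> R -> R[i].
Hypothesis hs : forall t, Ccontinuous (fun s => h s t).
Hypothesis ht : forall s, Ccontinuous (h s).

(** The value of the contour integral of h(s + i t) over the boundary of the
    rectangle [a, b] x [c, d]. *)
Definition rect_integral a b c d : R[i] :=
  Cint a b (fun s => h s c - h s d) + 'i * Cint c d (fun t => h b t - h a t).

Local Notation Phi := rect_integral.

Lemma rect_integral_split1 a m b c d : a <= m -> m <= b ->
  Phi a b c d = Phi a m c d + Phi m b c d.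
Proof.
move=> am mb; rewrite /Phi (Cint_split (CcontinuousB (hs c) (hs d)) am mb).
have -> : (fun t => h b t - h a t) = fun t => (h m t - h a t) + (h b t - h m t).
  by apply/funext => t; ring.
rewrite (@CintD _ c d (fun t => h m t - h a t) (fun t => h b t - h m t));
  [ring|exact: CcontinuousB..].
Qed.

Lemma rect_integral_split2 a b c m d : c <= m -> m <= d ->
  Phi a b c d = Phi a b c m + Phi a b m d.
Proof.
move=> cm md; rewrite /Phi (Cint_split (CcontinuousB (ht b) (ht a)) cm md).
have -> : (fun s => h s c - h s d) = fun s => (h s c - h s m) + (h s m - h s d).
  by apply/funext => s; rewrite addrA subrK.
rewrite (@CintD _ a b (fun s => h s c - h s m) (fun s => h s m - h s d));
  [ring|exact: CcontinuousB..].
Qed.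

(** For an affine h the contributions K1 and K2 of the two pairs of opposite
    sides cancel; only the deviation from an affine function remains. *)
Lemma rect_integral_small x y A B s t (w : R[i]) e : 0 <= A -> 0 <= B ->
  x <= s <= x + A -> y <= t <= y + B -> 0 <= e ->
  (forall s' t', x <= s' <= x + A -> y <= t' <= y + B ->
    Normc.normc (h s' t' - h s t - w * ((s' - s) +i* (t' - t))) <= e * (A + B)) ->
  Normc.normc (Phi x (x + A) y (y + B)) <= 8 * e * (A + B) ^+ 2.
Proof.
move=> A0 B0 xs yt e0 H.
pose K1 : R[i] := - (w * (0 +i* B)); pose K2 := w * A%:C.
have yy : y <= y <= y + B by rewrite lexx lerDl.
have yB : y <= y + B <= y + B by rewrite lexx lerDl B0.
have xx : x <= x <= x + A by rewrite lexx lerDl.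
have xA : x <= x + A <= x + A by rewrite lexx lerDl A0.
have E1 : Cint x (x + A) (fun s' => h s' y - h s' (y + B)) =
    A%:C * K1 + Cint x (x + A) (fun s' => (h s' y - h s' (y + B)) - K1).
  rewrite {1}(Cint_sub_cst K1) ?lerDl //; last exact: CcontinuousB.
  by rewrite addrAC subrr add0r.
have E2 : Cint y (y + B) (fun t' => h (x + A) t' - h x t') =
    B%:C * K2 + Cint y (y + B) (fun t' => (h (x + A) t' - h x t') - K2).
  rewrite {1}(Cint_sub_cst K2) ?lerDl //; last exact: CcontinuousB.
  by rewrite addrAC subrr add0r.
have -> : Phi x (x + A) y (y + B) =
    Cint x (x + A) (fun s' => (h s' y - h s' (y + B)) - K1) +
    'i * Cint y (y + B) (fun t' => (h (x + A) t' - h x t') - K2).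
  rewrite /Phi E1 E2 mulrDr addrACA.
  rewrite (_ : A%:C * K1 + 'i * (B%:C * K2) = 0) ?add0r //.
  by apply: complex_eqP; rewrite /K1 /K2 !ReImE /=; ring.
have b1 : Normc.normc (Cint x (x + A) (fun s' => (h s' y - h s' (y + B)) - K1)) <=
    2 * (A * (2 * (e * (A + B)))).
  have := @normc_Cint_le _ x (x + A) (fun s' => (h s' y - h s' (y + B)) - K1)
    (2 * (e * (A + B))).
  rewrite addrAC subrr add0r; apply.
  - by apply: CcontinuousB; [exact: CcontinuousB|exact: Ccontinuous_cst].
  - by rewrite lerDl.
  - move=> s' xs'; have h1 := H s' y xs' yy; have h2 := H s' (y + B) xs' yB.
    have -> : h s' y - h s' (y + B) - K1 =
      (h s' y - h s t - w * ((s' - s) +i* (y - t))) -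
      (h s' (y + B) - h s t - w * ((s' - s) +i* (y + B - t))).
      by apply: complex_eqP; rewrite /K1 !ReImE /=; ring.
    by apply: le_trans (ler_normcB _ _) _; rewrite mulr_natl mulr2n lerD.
have b2 : Normc.normc (Cint y (y + B) (fun t' => (h (x + A) t' - h x t') - K2)) <=
    2 * (B * (2 * (e * (A + B)))).
  have := @normc_Cint_le _ y (y + B) (fun t' => (h (x + A) t' - h x t') - K2)
    (2 * (e * (A + B))).
  rewrite addrAC subrr add0r; apply.
  - by apply: CcontinuousB; [exact: CcontinuousB|exact: Ccontinuous_cst].
  - by rewrite lerDl.
  - move=> t' yt'; have h1 := H (x + A) t' xA yt'; have h2 := H x t' xx yt'.
    have -> : h (x + A) t' - h x t' - K2 =
      (h (x + A) t' - h s t - w * ((x + A - s) +i* (t' - t))) -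
      (h x t' - h s t - w * ((x - s) +i* (t' - t))).
      by apply: complex_eqP; rewrite /K2 !ReImE /=; ring.
    by apply: le_trans (ler_normcB _ _) _; rewrite mulr_natl mulr2n lerD.
apply: le_trans (ler_normcD _ _) _; rewrite Normc.normcM.
have -> : Normc.normc ('i : R[i]) = 1 by rewrite /= expr0n expr1n add0r sqrtr1.
rewrite mul1r; apply: le_trans (lerD b1 b2) _.
have : 0 <= e * (A + B) ^+ 2 by rewrite mulr_ge0 ?sqr_ge0.
have -> : 2 * (A * (2 * (e * (A + B)))) + 2 * (B * (2 * (e * (A + B)))) =
  4 * (e * (A + B) ^+ 2) by ring.
have -> : 8 * e * (A + B) ^+ 2 = 8 * (e * (A + B) ^+ 2) by ring.
lra.
Qed.

Variables a c A B : R.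
Hypotheses (A0 : 0 <= A) (B0 : 0 <= B).
Hypothesis hd : forall s t, a <= s <= a + A -> c <= t <= c + B ->
  exists w, forall e, 0 < e -> exists2 del, 0 < del & forall s' t',
    `|s' - s| < del -> `|t' - t| < del ->
    Normc.normc (h s' t' - h s t - w * ((s' - s) +i* (t' - t))) <=
      e * (`|s' - s| + `|t' - t|).

(** Goursat's theorem for a rectangle: quarter it repeatedly, following the
    quarter with the largest integral; the quarters shrink to a point, where
    differentiability makes the integral small compared with their area. *)
Lemma goursat : Phi a (a + A) c (c + B) = 0.
Proof.
suff H eta : 0 < eta -> Normc.normc (Phi a (a + A) c (c + B)) <= eta.
  apply/Normc.eq0_normc/eqP; rewrite eq_le normc_ge0 andbT.
  by apply/ler_addgt0Pl => e /H; rewrite addr0.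
move=> eta0; apply: contrapT => nP0.
(* The cell of the n-th subdivision with corner p has a small integral. *)
pose P n (p : R * R) := Normc.normc (Phi p.1 (p.1 + A / 2 ^+ n) p.2 (p.2 + B / 2 ^+ n))
  <= eta / 4 ^+ n.
pose close n (p p' : R * R) := (p.1 <= p'.1 <= p.1 + A / 2 ^+ n.+1) /\
  (p.2 <= p'.2 <= p.2 + B / 2 ^+ n.+1).
have half (L : R) n : L / 2 ^+ n = L / 2 ^+ n.+1 + L / 2 ^+ n.+1.
  by rewrite exprS; field; rewrite expf_neq0.
have pos (L : R) n : 0 <= L -> 0 <= L / 2 ^+ n.
  by move=> L0; rewrite divr_ge0 // exprn_ge0.
have step n p : ~ P n p -> exists p', ~ P n.+1 p' /\ close n p p'.
  move=> nP; apply: contrapT => /forallNP allP; apply: nP.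
  have cl p' : close n p p' -> P n.+1 p'.
    by move=> cp; apply: contrapT => np; apply: (allP p').
  rewrite /P; set A1 := A / 2 ^+ n.+1; set B1 := B / 2 ^+ n.+1.
  rewrite (half A) (half B) -/A1 -/B1.
  have A10 : 0 <= A1 by exact: pos.
  have B10 : 0 <= B1 by exact: pos.
  have -> : Phi p.1 (p.1 + (A1 + A1)) p.2 (p.2 + (B1 + B1)) =
      (Phi p.1 (p.1 + A1) p.2 (p.2 + B1) +
       Phi p.1 (p.1 + A1) (p.2 + B1) (p.2 + B1 + B1)) +
      (Phi (p.1 + A1) (p.1 + A1 + A1) p.2 (p.2 + B1) +
       Phi (p.1 + A1) (p.1 + A1 + A1) (p.2 + B1) (p.2 + B1 + B1)).
    rewrite [p.1 + (A1 + A1)]addrA [p.2 + (B1 + B1)]addrA.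
    rewrite (@rect_integral_split1 p.1 (p.1 + A1)) ?lerDl //.
    by congr (_ + _); rewrite (@rect_integral_split2 _ _ p.2 (p.2 + B1)) ?lerDl.
  have c1 : close n p p by split; rewrite lexx lerDl.
  have c2 : close n p (p.1, p.2 + B1) by split => /=; rewrite ?lexx ?lerDl ?B10.
  have c3 : close n p (p.1 + A1, p.2) by split => /=; rewrite ?lexx ?lerDl ?A10.
  have c4 : close n p (p.1 + A1, p.2 + B1).
    by split => /=; rewrite ?lexx ?lerDl ?A10 ?B10.
  have := cl _ c1; have := cl _ c2; have := cl _ c3; have := cl _ c4.
  rewrite /P -/A1 -/B1 ![fst (_, _)]/= ![snd (_, _)]/=.
  have -> : eta / 4 ^+ n = (eta / 4 ^+ n.+1 + eta / 4 ^+ n.+1) +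
      (eta / 4 ^+ n.+1 + eta / 4 ^+ n.+1).
    by rewrite exprS; field; rewrite expf_neq0.
  move=> h4 h3 h2 h1; apply: le_trans (ler_normcD _ _) _; apply: lerD.
    by apply: le_trans (ler_normcD _ _) _; apply: lerD; [exact: h1|exact: h2].
  by apply: le_trans (ler_normcD _ _) _; apply: lerD; [exact: h3|exact: h4].
pose nxt n p := xget p [set p' | ~ P n.+1 p' /\ close n p p'].
pose pt := fix pt n := if n is n'.+1 then nxt n' (pt n') else (a, c).
have ptP n : ~ P n (pt n) /\ close n (pt n) (pt n.+1).
  have nx m : ~ P m (pt m) -> ~ P m.+1 (pt m.+1) /\ close m (pt m) (pt m.+1).
    move=> nP; have [p' Hp'] := step m _ nP.
    have ex : exists x, [set p' | ~ P m.+1 p' /\ close m (pt m) p'] x by exists p'.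
    exact: (xgetPex (pt m) ex).
  have nP m : ~ P m (pt m).
    elim: m => [|m IH]; last by case: (nx m IH).
    by rewrite /P [pt 0%N]/= [fst _]/= [snd _]/= !expr0 !divr1.
  by split => //; case: (nx n (nP n)).
have [s sP] := nested_halving A0 (fun n => (ptP n).2.1).
have [t tP] := nested_halving B0 (fun n => (ptP n).2.2).
have := sP 0%N; have := tP 0%N; rewrite /= !expr0 !divr1 => t0 s0.
have [w wP] := hd s0 t0.
(* So small that the bound of rect_integral_small, summed over all the cells of
   a subdivision, stays below eta. *)
pose e := eta / (8 * (A + B) ^+ 2 + 1).
have AB0 : 0 <= A + B by rewrite addr_ge0.
have den : 0 < 8 * (A + B) ^+ 2 + 1 by have := sqr_ge0 (A + B); lra.
have e0 : 0 < e by rewrite divr_gt0.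
have [del del0 delP] := wP e e0.
have [n Hn] : exists n, (A + B) / 2 ^+ n < del.
  have : (A + B) * 2^-1 ^+ n @[n --> \oo] --> (A + B) * 0.
    by apply: cvgMr; apply: cvg_expr; rewrite ger0_norm ?invr_ge0 // invf_lt1 // ltr1n.
  rewrite mulr0 => /cvgrPdist_lt /(_ _ del0)[n _ /(_ n (leqnn n))].
  rewrite sub0r normrN ger0_norm ?mulr_ge0 ?exprn_ge0 ?invr_ge0 //.
  by rewrite exprVn; exists n.
have [nPn _] := ptP n; apply: nPn.
set A1 := A / 2 ^+ n; set B1 := B / 2 ^+ n.
have A10 : 0 <= A1 by exact: pos.
have B10 : 0 <= B1 by exact: pos.
have ABd : A1 + B1 < del by rewrite /A1 /B1 -mulrDl.
rewrite /P -/A1 -/B1.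
have small := @rect_integral_small (pt n).1 (pt n).2 A1 B1 s t w e A10 B10
  (sP n) (tP n) (ltW e0).
apply: le_trans (small _) _.
  move=> s' t' /andP[s1 s2] /andP[t1 t2].
  have /andP[s3 s4] := sP n; have /andP[t3 t4] := tP n.
  have ds : `|s' - s| <= A1.
    by rewrite ler_distl; apply/andP; split; rewrite -/A1 in s4 *; lra.
  have dt : `|t' - t| <= B1.
    by rewrite ler_distl; apply/andP; split; rewrite -/B1 in t4 *; lra.
  apply: le_trans (delP s' t' _ _) _.
  - by apply: le_lt_trans ds _; lra.
  - by apply: le_lt_trans dt _; lra.
  - by rewrite ler_wpM2l ?(ltW e0) // lerD.
have -> : 8 * e * (A1 + B1) ^+ 2 = (e * (8 * (A + B) ^+ 2)) / 4 ^+ n.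
  have -> : (4 : R) ^+ n = 2 ^+ n * 2 ^+ n.
    by rewrite -exprMn -natrM.
  by rewrite /A1 /B1; field; rewrite expf_neq0.
rewrite ler_wpM2r ?invr_ge0 ?exprn_ge0 //.
rewrite /e mulrAC ler_pdivrMr // ler_wpM2l ?(ltW eta0) //.
by rewrite lerDl.
Qed.

End goursat.

(** * Complex differentiability and discs *)

Section complex_topology.
Context {R : realType}.
Implicit Types (F G : R[i] -> R[i]) (z w : R[i]).
Local Notation nm := (@Normc.normc R).

Lemma dist_normc z w : `|nm z - nm w| <= nm (w - z).
Proof.
have h1 : nm z <= nm w + nm (w - z).
  have := ler_normcB w (w - z); by rewrite opprB addrC subrK.
have h2 : nm w <= nm z + nm (w - z).
  have := ler_normcD z (w - z); by rewrite addrC subrK.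
rewrite ler_norml; apply/andP; split; lra.
Qed.

Lemma nbhs_complexP z (P : R[i] -> Prop) :
  nbhs (z : (R[i])^o) P <->
  exists2 del : R, 0 < del & forall w, nm (w - z) < del -> P w.
Proof.
split=> [/(@nbhs_normP R[i] (R[i])^o z P)[[d d'] /= d0 H]|[del d0 H]].
  move: d0 H; rewrite ltcE /= => /andP[/eqP -> d0] H.
  exists d => // w wz; apply: H; rewrite /= complex_normE normc_distC.
  by rewrite ltcR.
apply/(@nbhs_normP R[i] (R[i])^o z P); exists del%:C; first by rewrite /= ltcR.
by move=> w /=; rewrite complex_normE ltcR normc_distC; exact: H.
Qed.

(** Complex differentiability and continuity in terms of real estimates. *)
Definition cdiff F z := exists w, forall e, 0 < e -> exists2 del, 0 < del &
  forall z', nm (z' - z) < del -> nm (F z' - F z - w * (z' - z)) <= e * nm (z' - z).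

Definition ccont F z := forall e, 0 < e -> exists2 del, 0 < del &
  forall z', nm (z' - z) < del -> nm (F z' - F z) < e.

Lemma derivable_cdiff F z :
  derivable (F : (R[i])^o -> (R[i])^o) z 1 -> cdiff F z.
Proof.
move=> /cvg_ex[w H]; exists w => e e0.
have ec : 0 < e%:C :> R[i] by rewrite ltcR.
move/cvgrPdist_lt : H => /(_ _ ec).
move=> /(nbhs_complexP 0)[del d0 H]; exists del => // z' z'd.
have [->|zz] := eqVneq z' z.
  by rewrite !subrr mulr0 subrr Normc.normc0 mulr0.
have h0 : z' - z != 0 by rewrite subr_eq0.
have := H (z' - z); rewrite subr0 => /(_ z'd h0).
rewrite /= complex_normE ltcR.
have -> : (z' - z) *: (1 : (R[i])^o) = z' - z by rewrite /GRing.scale /= mulr1.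
rewrite subrK => Hl.
have -> : F z' - F z - w * (z' - z) =
    - (w - (z' - z)^-1 *: (F z' - F z)) * (z' - z).
  by rewrite /GRing.scale /= mulNr mulrBl [_^-1 * _]mulrC mulfVK // opprB.
by rewrite Normc.normcM normc_opp ler_wpM2r ?normc_ge0 // ltW.
Qed.

Lemma cdiff_derivable F z : cdiff F z ->
  derivable (F : (R[i])^o -> (R[i])^o) z 1.
Proof.
move=> [w H]; apply/cvg_ex; exists w; apply/cvgrPdist_le => -[e e'].
rewrite ltcE /= => /andP[/eqP -> e0].
have [del d0 Hd] := H e e0.
apply/(nbhs_complexP 0); exists del => // h; rewrite subr0 => hd h0.
rewrite complex_normE.
have -> : h *: (1 : (R[i])^o) = h by rewrite /GRing.scale /= mulr1.
have := Hd (h + z); rewrite addrK => /(_ hd) Hl.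
change (e +i* 0) with e%:C; rewrite lecR.
have -> : w - h^-1 *: (F (h + z) - F z) = - ((F (h + z) - F z - w * h) / h).
  by rewrite /GRing.scale /= mulrBl mulfK // opprB mulrC.
rewrite normc_opp Normc.normcM Normc.normcV ler_pdivrMr //.
by rewrite normc_gt0.
Qed.

Lemma cdiff_ccont F z : cdiff F z -> ccont F z.
Proof.
move=> [w H] e e0; have [del d0 Hd] := H 1 ltr01.
have K0 : 0 < 1 + nm w by rewrite ltr_pwDl ?normc_ge0.
exists (Num.min del (e / (1 + nm w))); first by rewrite lt_min d0 divr_gt0.
move=> z'; rewrite lt_min => /andP[zd ze].
have -> : F z' - F z = (F z' - F z - w * (z' - z)) + w * (z' - z) by rewrite subrK.
apply: le_lt_trans (ler_normcD _ _) _; rewrite Normc.normcM.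
apply: le_lt_trans (_ : (1 + nm w) * nm (z' - z) < e).
  by rewrite mulrDl lerD2r; exact: Hd.
by rewrite mulrC -ltr_pdivlMr.
Qed.

Lemma cdiff_near F G z r : 0 < r ->
  (forall z', nm (z' - z) < r -> F z' = G z') -> cdiff G z -> cdiff F z.
Proof.
move=> r0 FG [w H]; exists w => e /H[del d0 Hd].
exists (Num.min del r); first by rewrite lt_min d0.
move=> z'; rewrite lt_min => /andP[zd zr]; rewrite !FG //; last first.
  by rewrite subrr Normc.normc0.
exact: Hd.
Qed.

Lemma ccont_id z : ccont id z.
Proof. by move=> e e0; exists e. Qed.

Lemma ccontM F G z : ccont F z -> ccont G z -> ccont (fun z => F z * G z) z.
Proof.
move=> cF cG e e0.
pose K := 1 + nm (F z) + nm (G z).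
have K1 : 1 <= K by rewrite /K -addrA lerDl addr_ge0 // normc_ge0.
have K0 : 0 < K by exact: lt_le_trans K1.
pose e1 := Num.min 1 (e / (2 * K)).
have e10 : 0 < e1 by rewrite lt_min ltr01 divr_gt0 // mulr_gt0.
have [d1 d10 H1] := cF e1 e10; have [d2 d20 H2] := cG e1 e10.
exists (Num.min d1 d2); first by rewrite lt_min d10.
move=> z'; rewrite lt_min => /andP[/H1 h1 /H2 h2].
have -> : F z' * G z' - F z * G z =
    (F z' - F z) * ((G z' - G z) + G z) + F z * (G z' - G z) by ring.
apply: le_lt_trans (ler_normcD _ _) _; rewrite !Normc.normcM.
have b : nm ((G z' - G z) + G z) <= 1 + nm (G z).
  apply: le_trans (ler_normcD _ _) _; rewrite lerD2r ltW //.
  by apply: lt_le_trans h2 _; rewrite ge_min lexx.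
have p1 : nm (F z' - F z) * nm ((G z' - G z) + G z) <= e1 * (1 + nm (G z)).
  by apply: ler_pM; rewrite ?normc_ge0 // ltW.
have p2 : nm (F z) * nm (G z' - G z) <= e1 * nm (F z).
  by rewrite mulrC ler_wpM2r ?normc_ge0 // ltW.
apply: le_lt_trans (lerD p1 p2) _.
have -> : e1 * (1 + nm (G z)) + e1 * nm (F z) = e1 * K by rewrite /K; ring.
apply: le_lt_trans (_ : e / 2 < e).
  have : e1 <= e / (2 * K) by rewrite ge_min lexx orbT.
  rewrite -(ler_pM2r K0) => /le_trans; apply.
  by rewrite le_eqVlt; apply/orP; left; apply/eqP; field; rewrite gt_eqF.
by rewrite ltr_pdivrMr // ltr_pMr // ltr1n.
Qed.

Lemma ccont_curve F (gam : R -> R[i]) : Ccontinuous gam ->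
  (forall t, ccont F (gam t)) -> Ccontinuous (fun t => F (gam t)).
Proof.
move=> [g1 g2] cF.
have key t e : 0 < e -> \forall t' \near t, nm (F (gam t) - F (gam t')) < e.
  move=> e0; have [del d0 Hd] := cF t e e0.
  have d20 : 0 < del / 2 by rewrite divr_gt0.
  have /cvgrPdist_lt/(_ _ d20) n1 := g1 t.
  have /cvgrPdist_lt/(_ _ d20) n2 := g2 t.
  near=> t'; rewrite normc_distC; apply: Hd.
  apply: le_lt_trans (normc_le _) _; rewrite !ReImE [ltRHS](splitr del).
  rewrite distrC (distrC (complex.Im _)); apply: ltrD.
    by near: t'.
  by near: t'.
split=> t; apply/cvgrPdist_lt => e /(key t); apply: filterS => t'.
  by apply: le_lt_trans; rewrite -ReN -ReD; exact: le_Re_normc.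
by apply: le_lt_trans; rewrite -ImN -ImD; exact: le_Im_normc.
Unshelve. all: by end_near. Qed.

Lemma continuous_sqmod_toC : continuous (fun p : R * R => sqmod (toC p)).
Proof.
move=> p; rewrite /sqmod /=; apply: cvgD; apply: cvgM;
  solve [exact: cvg_fst | exact: cvg_snd].
Qed.

Lemma compact_disc r : compact [set p : R * R | sqmod (toC p) <= r ^+ 2].
Proof.
apply: (@subclosed_compact _ _ (`[- `|r|, `|r|] `*` `[- `|r|, `|r|])).
- have -> : [set p : R * R | sqmod (toC p) <= r ^+ 2] =
      (fun p => sqmod (toC p)) @^-1` [set x | x <= r ^+ 2] by [].
  by apply: preimage_closed; [move=> p _; exact: continuous_sqmod_toC|exact: closed_le].
- by apply: compact_setX; exact: segment_compact.
- move=> [x y]; rewrite /sqmod /= !in_itv /= -!ler_norml => H; split.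
  + rewrite -(@ler_pXn2r _ 2) ?nnegrE // !real_normK ?num_real //.
    by apply: le_trans H; rewrite lerDl sqr_ge0.
  + rewrite -(@ler_pXn2r _ 2) ?nnegrE // !real_normK ?num_real //.
    by apply: le_trans H; rewrite lerDr sqr_ge0.
Qed.

Lemma toC_nbhs (p : R * R) (P : R[i] -> Prop) del : 0 < del ->
  (forall w, nm (w - toC p) < del -> P w) -> nbhs p [set p' | P (toC p')].
Proof.
move=> d0 H; have d20 : 0 < del / 2 by rewrite divr_gt0.
have n1 : \forall p' \near p, `|p.1 - p'.1| < del / 2.
  have c1 : (fun p' : R * R => p'.1) @ p --> p.1 by exact: cvg_fst.
  by move/cvgrPdist_lt : c1; apply.
have n2 : \forall p' \near p, `|p.2 - p'.2| < del / 2.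
  have c2 : (fun p' : R * R => p'.2) @ p --> p.2 by exact: cvg_snd.
  by move/cvgrPdist_lt : c2; apply.
near=> p'; apply: H.
apply: le_lt_trans (normc_le _) _; rewrite !ReImE /= [ltRHS](splitr del).
rewrite distrC (distrC p'.2); apply: ltrD.
  by near: p'.
by near: p'.
Unshelve. all: by end_near. Qed.

Lemma normc_le_sqmod z r : 0 <= r -> (nm z <= r) = (sqmod z <= r ^+ 2).
Proof. by move=> r0; rewrite sqmodE ler_pXn2r ?nnegrE ?normc_ge0. Qed.

Lemma toC_onto z : toC (complex.Re z, complex.Im z) = z.
Proof. by case: z. Qed.

Lemma ccont_bounded F r : 0 <= r -> (forall z, nm z <= r -> ccont F z) ->
  exists B, 0 <= B /\ forall z, nm z <= r -> nm (F z) <= B.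
Proof.
move=> r0 cF; pose K := [set p : R * R | sqmod (toC p) <= r ^+ 2].
have K0 : K !=set0.
  by exists (0, 0); rewrite /K /sqmod /= expr0n addr0 sqr_ge0.
have cK : {within K, continuous (fun p => nm (F (toC p)))}.
  apply: continuous_in_subspaceT => p /set_mem Kp.
  apply/cvgrPdist_lt => e e0.
  have pr : nm (toC p) <= r by rewrite normc_le_sqmod.
  have [del d0 Hd] := cF (toC p) pr e e0.
  apply: (toC_nbhs (P := fun w => Num.norm (Normc.normc (F (toC p)) - Normc.normc (F w)) < e)) d0 _ => w /Hd.
  by apply: le_lt_trans; exact: dist_normc.
have [p Kp Hp] := compact_EVT_max K0 (@compact_disc r) cK.
exists (nm (F (toC p))); split; first exact: normc_ge0.
move=> z zr; have := Hp (complex.Re z, complex.Im z); rewrite toC_onto; apply.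
by rewrite inE /K /= toC_onto -normc_le_sqmod.
Qed.

(** An open set containing a closed disc contains a larger disc: |z|^2 attains
    its minimum on the complement, cut down to a compact set. *)
Lemma open_disc_enlarge (U : set (R[i])^o) r : 0 < r -> open U ->
  (forall z, nm z <= r -> U z) ->
  exists2 r', r < r' & forall z, nm z < r' -> U z.
Proof.
move=> r0 oU rU.
pose K := [set p : R * R | sqmod (toC p) <= (r + 1) ^+ 2] `&` ~` [set p | U (toC p)].
have r10 : 0 <= r + 1 by rewrite addr_ge0 // ltW.
have cK : compact K.
  apply: subclosed_compact (@compact_disc (r + 1)) _; last by move=> p [].
  apply: closedI; first exact: compact_closed (@compact_disc _).
  apply: open_closedC; rewrite openE => p Up.
  have /nbhs_complexP[del d0 Hd] := open_nbhs_nbhs (conj oU Up).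
  exact: toC_nbhs d0 Hd.
have [K0|/set0P/negP/negPn/eqP K0] := pselect (K !=set0); last first.
  exists (r + 1); first by rewrite ltrDl.
  move=> z zr; apply: contrapT => nU.
  suff : K (complex.Re z, complex.Im z) by rewrite K0.
  by split; rewrite /= toC_onto // -normc_le_sqmod // ltW.
have [p /set_mem Kp Hp] := compact_EVT_min K0 cK
  (continuous_subspaceT continuous_sqmod_toC).
have rp : r < nm (toC p).
  by rewrite ltNge; apply/negP => /rU; case: Kp.
exists (nm (toC p)) => // z zp; apply: contrapT => nU.
have := Hp (complex.Re z, complex.Im z); rewrite toC_onto => H.
have : nm (toC p) <= nm z.
  rewrite normc_le_sqmod ?normc_ge0 // -sqmodE; apply: H; rewrite inE; split.
    rewrite /= toC_onto -normc_le_sqmod //; apply/ltW/(lt_le_trans zp).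
    by rewrite normc_le_sqmod //; case: Kp.
  by rewrite /= toC_onto.
by rewrite leNgt zp.
Qed.

End complex_topology.

(** * Circle means *)

Section circle_means.
Context {R : realType}.
Implicit Types (G : R[i] -> R[i]) (z w : R[i]) (s t u v r x y : R).
Local Notation nm := (@Normc.normc R).

Lemma is_derive_bound (f : R -> R) x l : is_derive x 1 f l ->
  forall e, 0 < e -> exists2 del, 0 < del & forall u, `|u| < del ->
    `|f (x + u) - f x - l * u| <= e * `|u|.
Proof.
move=> [df dl] e e0; have H : h^-1 *: ((f \o shift x) (h *: 1) - f x)
    @[h --> 0^'] --> l by rewrite -dl; exact: df.
move/cvgrPdist_lt : H => /(_ _ e0)/nbhs_ballP[del /= d0 H].
exists del => // u ud.
have [->|u0] := eqVneq u 0; first by rewrite addr0 subrr mulr0 subrr !normr0 mulr0.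
have := H u; rewrite -ball_normE /= sub0r normrN => /(_ ud u0).
have -> : u *: (1 : R^o) = u by rewrite /GRing.scale /= mulr1.
rewrite /= (addrC u x) => Hl.
have -> : f (x + u) - f x - l * u = - (l - u^-1 *: (f (x + u) - f x)) * u.
  by rewrite /GRing.scale /= mulNr mulrBl [_^-1 * _]mulrC mulfVK // opprB.
by rewrite normrM normrN ler_wpM2r // ltW.
Qed.

Lemma exp_expansion e : 0 < e -> exists2 del, 0 < del & forall u v,
  `|u| < del -> `|v| < del ->
  nm ((expR u)%:C * expi v - 1 - (u +i* v)) <= e * (`|u| + `|v|).
Proof.
move=> e0; have [e1 [e10 e11 e18]] : exists e1, [/\ 0 < e1, e1 <= 1 & e1 <= e / 8].
  exists (Num.min 1 (e / 8)); split.
  - by rewrite lt_min ltr01 divr_gt0.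
  - by rewrite ge_min lexx.
  - by rewrite ge_min lexx orbT.
have [d1 d10 H1] := is_derive_bound (is_derive_expR (0 : R)) e10.
have [d2 d20 H2] := is_derive_bound (is_derive_cos (0 : R)) e10.
have [d3 d30 H3] := is_derive_bound (is_derive_sin (0 : R)) e10.
exists (Num.min (Num.min d1 d2) (Num.min d3 e1)).
  by rewrite !lt_min d10 d20 d30 e10.
move=> u v; rewrite !lt_min => /andP[/andP[u1 _] /andP[_ ue]].
move=> /andP[/andP[_ v2] /andP[v3 ve]].
have := H1 u u1; rewrite add0r expR0 mul1r => h1.
have := H2 v v2; rewrite add0r cos0 sin0 oppr0 mul0r subr0 => h2.
have := H3 v v3; rewrite add0r cos0 sin0 mul1r subr0 => h3.
have -> : (expR u)%:C * expi v - 1 - (u +i* v) =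
   (expR u - 1 - u)%:C * expi v + u%:C * (expi v - 1) + (expi v - 1 - (0 +i* v)).
  by apply: complex_eqP; rewrite !ReImE /=; ring.
have n1 : nm (expi v - 1 - (0 +i* v)) <= e1 * `|v| + e1 * `|v|.
  apply: le_trans (normc_le _) _; rewrite !ReImE /= subr0 oppr0 addr0.
  exact: lerD h2 h3.
have n2 : nm (expi v - 1) <= 3 * `|v|.
  have -> : expi v - 1 = (expi v - 1 - (0 +i* v)) + (0 +i* v) by rewrite subrK.
  apply: le_trans (ler_normcD _ _) _.
  have -> : nm (0 +i* v) = `|v|.
    by rewrite /= expr0n add0r sqrtr_sqr.
  have : e1 * `|v| <= `|v| by rewrite ler_piMl.
  lra.
apply: le_trans (ler_normcD _ _) _; apply: le_trans (lerD (ler_normcD _ _) n1) _.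
rewrite !Normc.normcM !normcC normc_expi mulr1.
have p1 : `|u| * nm (expi v - 1) <= e1 * (3 * `|v|).
  by apply: ler_pM => //; [exact: normc_ge0|exact: ltW].
have a0 := normr_ge0 u; have b0 := normr_ge0 v.
have : e1 * `|u| <= e / 8 * `|u| by rewrite ler_wpM2r.
have : e1 * `|v| <= e / 8 * `|v| by rewrite ler_wpM2r.
have : 0 <= e * `|u| by rewrite mulr_ge0 // ltW.
have : 0 <= e * `|v| by rewrite mulr_ge0 // ltW.
lra.
Qed.

(** The chain rule for the logarithmic coordinate s + i t. *)
Lemma cdiff_exp G s t : cdiff G ((expR s)%:C * expi t) ->
  exists w, forall e, 0 < e -> exists2 del, 0 < del & forall s' t',
    `|s' - s| < del -> `|t' - t| < del ->
    nm (G ((expR s')%:C * expi t') - G ((expR s)%:C * expi t) -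
        w * ((s' - s) +i* (t' - t))) <= e * (`|s' - s| + `|t' - t|).
Proof.
set z0 := (expR s)%:C * expi t => -[w H]; exists (w * z0) => e e0.
pose Z := nm z0; have Z0 : 0 <= Z := normc_ge0 _.
pose e1 := e / (4 * (Z + 1)).
pose e2 := Num.min 1 (e / (2 * (nm w * Z + 1))).
have Z1 : 0 < Z + 1 by rewrite ltr_wpDl.
have W1 : 0 < nm w * Z + 1 by rewrite ltr_wpDl // mulr_ge0 // normc_ge0.
have e10 : 0 < e1 by rewrite divr_gt0 // mulr_gt0.
have e20 : 0 < e2 by rewrite lt_min ltr01 divr_gt0 // mulr_gt0.
have [dG dG0 HG] := H e1 e10; have [dE dE0 HE] := exp_expansion e20.
exists (Num.min dE (dG / (4 * (Z + 1)))).
  by rewrite lt_min dE0 divr_gt0 // mulr_gt0.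
move=> s' t'; rewrite !lt_min => /andP[sE sG] /andP[tE tG].
set u := s' - s in sE sG *; set v := t' - t in tE tG *.
have zE : (expR s')%:C * expi t' = z0 * ((expR u)%:C * expi v).
  have -> : s' = s + u by rewrite /u addrC subrK.
  have -> : t' = t + v by rewrite /v addrC subrK.
  by rewrite expRD expiD rmorphM /z0; ring.
rewrite zE; set X := (expR u)%:C * expi v.
have hE := HE u v sE tE; rewrite -/X in hE.
set D := `|u| + `|v| in hE *; have D0 : 0 <= D by rewrite addr_ge0.
have nuv : nm (u +i* v) <= D by exact: normc_le.
have hX : nm (X - 1) <= 2 * D.
  have -> : X - 1 = (X - 1 - (u +i* v)) + (u +i* v) by rewrite subrK.
  apply: le_trans (ler_normcD _ _) _.
  have : e2 * D <= 1 * D by rewrite ler_wpM2r // ge_min lexx.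
  lra.
have dz : z0 * X - z0 = z0 * (X - 1) by rewrite mulrBr mulr1.
have nz : nm (z0 * X - z0) <= Z * (2 * D).
  by rewrite dz Normc.normcM ler_wpM2l.
have small : nm (z0 * X - z0) < dG.
  apply: le_lt_trans nz _.
  have : D < dG / (4 * (Z + 1)) + dG / (4 * (Z + 1)) by rewrite ltrD.
  have -> : dG / (4 * (Z + 1)) + dG / (4 * (Z + 1)) = dG / (2 * (Z + 1)).
    by field; rewrite gt_eqF.
  rewrite ltr_pdivlMr; last by rewrite mulr_gt0.
  by apply: le_lt_trans; nra.
have hG := HG _ small.
have -> : G (z0 * X) - G z0 - w * z0 * (u +i* v) =
   (G (z0 * X) - G z0 - w * (z0 * X - z0)) + w * z0 * (X - 1 - (u +i* v)).
  by rewrite dz; ring.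
apply: le_trans (ler_normcD _ _) _.
have b1 : nm (G (z0 * X) - G z0 - w * (z0 * X - z0)) <= e / 2 * D.
  apply: le_trans hG _; apply: le_trans (ler_wpM2l (ltW e10) nz) _.
  have -> : e1 * (Z * (2 * D)) = (e / 2 * D) * (Z / (Z + 1)).
    by rewrite /e1; field; rewrite gt_eqF.
  rewrite ler_piMr ?mulr_ge0 ?divr_ge0 ?(ltW e0) //.
  by rewrite ler_pdivrMr // mul1r lerDl.
have b2 : nm (w * z0 * (X - 1 - (u +i* v))) <= e / 2 * D.
  rewrite (Normc.normcM (w * z0)) (Normc.normcM w z0) -/Z.
  have wz : 0 <= nm w * Z by rewrite mulr_ge0 ?normc_ge0.
  apply: le_trans (ler_wpM2l wz hE) _.
  have : e2 <= e / (2 * (nm w * Z + 1)) by rewrite ge_min lexx orbT.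
  rewrite ler_pdivlMr; last by rewrite mulr_gt0.
  move=> He2; rewrite mulrA ler_wpM2r //.
  have : 0 <= e2 by exact: ltW.
  lra.
lra.
Qed.

(** 2 pi times the mean of G over the circle of radius r. *)
Definition cmean G r : R[i] := Cint 0 (2 * pi) (fun t => G (r%:C * expi t)).

Lemma normc_circle r t : 0 <= r -> nm (r%:C * expi t) = r.
Proof. by move=> r0; rewrite Normc.normcM normcC normc_expi mulr1 ger0_norm. Qed.

Lemma Ccontinuous_circle r : Ccontinuous (fun t => r%:C * expi t).
Proof. by apply: CcontinuousM; [exact: Ccontinuous_cst|exact: Ccontinuous_expi]. Qed.

(** In the coordinate log z the annulus between two circles is a rectangle, and
    two of its sides cancel by periodicity, so that Goursat's theorem compares
    the integrals over the circles. *)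
Lemma cmean_const G x' x y y' : 0 < x' -> x' < x -> x <= y -> y < y' ->
  (forall z, x' <= nm z -> nm z <= y' -> ccont G z) ->
  (forall z, x <= nm z -> nm z <= y -> cdiff G z) ->
  cmean G x = cmean G y.
Proof.
move=> x'0 x'x xy yy' cG dG.
have x0 : 0 < x by exact: lt_trans x'x.
have y0 : 0 < y by exact: lt_le_trans xy.
have y'0 : 0 < y' by exact: lt_trans yy'.
(* Clamping extends G continuously to all radii without changing it near the
   annulus. *)
pose cl s := Num.max (ln x') (Num.min s (ln y')).
have lnx : ln x' < ln x by rewrite ltr_ln ?posrE.
have lny : ln y < ln y' by rewrite ltr_ln ?posrE.
have lnxy : ln x <= ln y by rewrite ler_ln ?posrE.
have ccl : continuous cl.
  move=> s; have c1 : {for s, continuous (fun u : R => Num.min u (ln y'))}.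
    have := @continuous_min R R (fun u : R => u) (fun=> ln y') s.
    by apply; [exact: cvg_id|exact: cvg_cst].
  have := @continuous_max R R (fun=> ln x') (fun u : R => Num.min u (ln y')) s.
  by apply => //; exact: cvg_cst.
have cl_id s : ln x' <= s <= ln y' -> cl s = s.
  by move=> /andP[s1 s2]; rewrite /cl (min_idPl s2) (max_idPr s1).
have rcl s : x' <= expR (cl s) <= y'.
  rewrite -[x']lnK ?posrE // -[y' in X in _ && X]lnK ?posrE // !ler_expR.
  by rewrite /cl le_max lexx /= ge_max ge_min lexx orbT andbT ltW // (lt_trans lnx)
    // (le_lt_trans lnxy).
pose h s t := G ((expR (cl s))%:C * expi t).
have ch s t : ccont G ((expR (cl s))%:C * expi t).
  have /andP[r1 r2] := rcl s.
  by apply: cG; rewrite normc_circle // ltW // (lt_le_trans x'0).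
have hs t : Ccontinuous (fun s => h s t).
  apply: (ccont_curve (F := G) (gam := fun s => (expR (cl s))%:C * expi t)) => //.
  apply: CcontinuousM; last exact: Ccontinuous_cst.
  split => /= s; last exact: cvg_cst.
  exact: (continuous_comp (ccl s) (@continuous_expR R (cl s))).
have ht s : Ccontinuous (h s).
  apply: (ccont_curve (F := G) (gam := fun t => (expR (cl s))%:C * expi t)) => //.
  exact: Ccontinuous_circle.
have A0 : 0 <= ln y - ln x by rewrite subr_ge0.
have B0 : 0 <= 2 * pi :> R by rewrite ltW // twopi_gt0.
have xA : ln x + (ln y - ln x) = ln y by rewrite addrC subrK.
have hd s t : ln x <= s <= ln x + (ln y - ln x) -> 0 <= t <= 0 + 2 * pi ->
  exists w, forall e, 0 < e -> exists2 del, 0 < del & forall s' t',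
    `|s' - s| < del -> `|t' - t| < del ->
    nm (h s' t' - h s t - w * ((s' - s) +i* (t' - t))) <=
      e * (`|s' - s| + `|t' - t|).
  rewrite xA => /andP[s1 s2] _.
  have [|w Hw] := @cdiff_exp G s t.
    apply: dG; rewrite normc_circle ?expR_ge0 //.
      by rewrite -[x]lnK ?posrE // ler_expR.
    by rewrite -[y]lnK ?posrE // ler_expR.
  exists w => e /Hw[del d0 Hd].
  exists (Num.min del (Num.min (ln x - ln x') (ln y' - ln y))).
    by rewrite !lt_min d0 !subr_gt0 lnx.
  move=> s' t'; rewrite !lt_min => /andP[sd /andP[sx sy]] /andP[td _].
  have E0 : cl s = s.
    by apply: cl_id; rewrite (le_trans (ltW lnx) s1) (le_trans s2 (ltW lny)).
  have E1 : cl s' = s'.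
    by apply: cl_id; move: sx sy; rewrite !ltr_distlC => /andP[? ?] /andP[? ?]; lra.
  by rewrite /h E0 E1; exact: Hd.
have := goursat hs ht A0 B0 hd; rewrite /rect_integral xA add0r.
rewrite (@eq_Cint _ (ln x) (ln y) _ (fun=> 0)); last first.
  move=> s _; rewrite /h.
  have -> : expi (2 * pi) = expi 0 :> R[i].
    by rewrite -[2 * pi]mul1r (expi_2pi 1) expi0.
  by rewrite subrr.
rewrite Cint_cst // mulr0 add0r => /eqP; rewrite mulf_eq0 => /orP[/eqP[] /eqP|].
  by rewrite oner_eq0.
rewrite CintB // subr_eq0 => /eqP; rewrite /cmean /h.
rewrite !cl_id ?lnK ?posrE //.
- by rewrite (ltW lnx) /= ltW // (le_lt_trans lnxy).
- by rewrite (ltW lny) andbT ltW // (lt_le_trans lnx).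
Qed.

Lemma cvg_Rintegral_bounded a b (u : nat -> R -> R) (f : R -> R) B :
  (forall n, continuous (u n)) -> continuous f ->
  (forall t, u n t @[n --> \oo] --> f t) -> (forall n t, `|u n t| <= B) ->
  \int[lebesgue_measure]_(t in `[a, b]) u n t @[n --> \oo] -->
  \int[lebesgue_measure]_(t in `[a, b]) f t.
Proof.
move=> cu cf uf uB.
have mi : measurable (`[a, b]%classic : set R) by exact: measurable_itv.
have [] := @dominated_convergence _ _ _ (@lebesgue_measure R) `[a, b] mi
  (fun n x => (u n x)%:E) (fun x => (f x)%:E) (fun=> B%:E).
- move=> n; apply/measurable_EFinP/measurable_funTS.
  exact: continuous_measurable_fun.
- apply/measurable_EFinP/measurable_funTS.
  exact: continuous_measurable_fun.
- by apply: aeW => x _; apply: cvg_EFin; [exact: nearW|exact: uf].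
- by apply: (continuous_integrable_on a b (u := fun=> B)) => t; exact: cvg_cst.
- by apply: aeW => x n _ /=; rewrite lee_fin.
move=> fi _ H; apply: fine_cvg.
by rewrite /Rintegral fineK //; exact: integrable_fin_num.
Qed.

(** Dominated convergence: G is bounded on the disc by compactness. *)
Lemma cmean_cvg G r1 (r : nat -> R) r0 :
  (forall z, nm z <= r1 -> ccont G z) ->
  (forall k, 0 <= r k <= r1) -> 0 <= r0 <= r1 ->
  r k @[k --> \oo] --> r0 -> cvgC (fun k => cmean G (r k)) (cmean G r0).
Proof.
move=> cG rk /andP[r00 r01] rr.
have [B [B0 HB]] := ccont_bounded (le_trans r00 r01) cG.
have cc x : 0 <= x <= r1 -> Ccontinuous (fun t => G (x%:C * expi t)).
  move=> /andP[x0 x1].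
  apply: (ccont_curve (F := G) (Ccontinuous_circle x)) => t.
  by apply: cG; rewrite normc_circle.
have pt t e : 0 < e -> \forall k \near \oo,
    nm (G ((r k)%:C * expi t) - G (r0%:C * expi t)) < e.
  move=> e0; have [|del d0 Hd] := cG (r0%:C * expi t) _ e e0.
    by rewrite normc_circle.
  move/cvgrPdist_lt : rr => /(_ _ d0); apply: filterS => k kd; apply: Hd.
  by rewrite -mulrBl -rmorphB Normc.normcM normcC normc_expi mulr1 distrC.
have Rc : \int[lebesgue_measure]_(t in `[0, 2 * pi])
    complex.Re (G ((r k)%:C * expi t)) @[k --> \oo] --> complex.Re (cmean G r0).
  apply: (@cvg_Rintegral_bounded _ _ _ _ B).
  - by move=> k; case: (cc (r k) (rk k)).
  - by have [] : Ccontinuous (fun t => G (r0%:C * expi t)) by apply: cc; rewrite r00.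
  - move=> t; apply/cvgrPdist_lt => e /(pt t); apply: filterS => k.
    by apply: le_lt_trans; rewrite distrC -ReN -ReD; exact: le_Re_normc.
  - move=> k t; apply: le_trans (le_Re_normc _) _; have /andP[k0 k1] := rk k.
    by apply: HB; rewrite normc_circle.
have Ic : \int[lebesgue_measure]_(t in `[0, 2 * pi])
    complex.Im (G ((r k)%:C * expi t)) @[k --> \oo] --> complex.Im (cmean G r0).
  apply: (@cvg_Rintegral_bounded _ _ _ _ B).
  - by move=> k; case: (cc (r k) (rk k)).
  - by have [] : Ccontinuous (fun t => G (r0%:C * expi t)) by apply: cc; rewrite r00.
  - move=> t; apply/cvgrPdist_lt => e /(pt t); apply: filterS => k.
    by apply: le_lt_trans; rewrite distrC -ImN -ImD; exact: le_Im_normc.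
  - move=> k t; apply: le_trans (le_Im_normc _) _; have /andP[k0 k1] := rk k.
    by apply: HB; rewrite normc_circle.
apply/cvgCP/cvgrPdist_lt => e e0; have e20 : 0 < e / 2 by rewrite divr_gt0.
move/cvgrPdist_lt : Rc => /(_ _ e20) n1; move/cvgrPdist_lt : Ic => /(_ _ e20) n2.
near=> k; rewrite sub0r normrN ger0_norm ?normc_ge0 //.
apply: le_lt_trans (normc_le _) _; rewrite !ReImE [ltRHS](splitr e).
rewrite distrC (distrC (complex.Im _)); apply: ltrD.
  by near: k.
by near: k.
Unshelve. all: by end_near. Qed.

Lemma cmean_cst_lim G r1 c0 (r : nat -> R) r0 :
  (forall z, nm z <= r1 -> ccont G z) ->
  (forall k, 0 <= r k <= r1) -> 0 <= r0 <= r1 -> r k @[k --> \oo] --> r0 ->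
  (forall k, cmean G (r k) = c0) -> cmean G r0 = c0.
Proof.
move=> cG rk r01 rr rc; have H := cmean_cvg cG rk r01 rr.
apply: (cvgC_unique H).
by under eq_fun do rewrite rc; exact: cvgC_cst.
Qed.

(** The singularity at a is removable: the means are constant on either side
    of the circle through a, and continuous across it. *)
Lemma cmean_zero G rho a r : G 0 = 0 -> nm a < r -> r < rho ->
  (forall z, nm z < rho -> ccont G z) ->
  (forall z, nm z < rho -> z != a -> cdiff G z) ->
  cmean G r = 0.
Proof.
move=> G0 ar rrho cG dG; have a0 := normc_ge0 a.
pose r1 := (r + rho) / 2.
have rr1 : r < r1 by rewrite /r1; lra.
have r1rho : r1 < rho by rewrite /r1; lra.
have r0 : 0 < r by exact: le_lt_trans ar.
have cG1 z : nm z <= r1 -> ccont G z by move=> zr; apply: cG; exact: le_lt_trans r1rho.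
have inv0 : (k.+1%:R)^-1 @[k --> \oo] --> (0 : R).
  by have := @cvg_harmonic R.
have frac_le (x : R) k : 0 < x -> 0 < x * (k.+1%:R)^-1 <= x.
  by move=> x0; rewrite divr_gt0 //= ler_piMr ?(ltW x0) // invf_le1 ?ler1n.
have const x y : 0 < x -> x <= y -> y < r1 -> (y < nm a \/ nm a < x) ->
    cmean G x = cmean G y.
  move=> x0 xy yr1 side.
  apply: (@cmean_const G (x / 2) x y r1); rewrite ?divr_gt0 //; first by lra.
    by move=> z _; exact: cG1.
  move=> z xz zy; apply: dG; first by apply: le_lt_trans zy _; exact: lt_trans r1rho.
  by apply/eqP => za; move: xz zy; rewrite za; case: side; lra.
have E0 : cmean G 0 = 0.
  rewrite /cmean (@eq_Cint _ _ _ _ (fun=> 0)); last by move=> t _; rewrite mul0r G0.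
  by rewrite Cint_cst ?mulr0 // ltW // twopi_gt0.
have Ea : cmean G (nm a) = cmean G r.
  apply: (@cmean_cst_lim G r1 _ (fun k => nm a + (r - nm a) * (k.+1%:R)^-1)) => //.
  - move=> k; have := frac_le (r - nm a) k; rewrite subr_gt0 => /(_ ar) /=.
    by move: (_ * _) => X /andP[X0 X1]; apply/andP; split; lra.
  - by rewrite a0 ltW // (lt_trans ar).
  - rewrite -[X in _ --> X]addr0; apply: cvgD; first exact: cvg_cst.
    by rewrite -(mulr0 (r - nm a)); apply: cvgMr.
  - move=> k; have := frac_le (r - nm a) k; rewrite subr_gt0 => /(_ ar) /=.
    move: (_ * _) => X /andP[X0 X1]; apply: const => //; [lra|lra|right; lra].
rewrite -Ea; have [->//|na0] := eqVneq (nm a) 0.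
have ap : 0 < nm a by rewrite lt_def na0.
have -> : cmean G (nm a) = cmean G (nm a / 2).
  apply: (@cmean_cst_lim G r1 _ (fun k => nm a - (nm a / 2) * (k.+1%:R)^-1)) => //.
  - move=> k; have := frac_le (nm a / 2) k; rewrite divr_gt0 // => /(_ isT) /=.
    by move: (_ * _^-1) => X /andP[X0 X1]; apply/andP; split; lra.
  - by rewrite a0 ltW // (lt_trans ar).
  - rewrite -[X in _ --> X]subr0; apply: cvgB; first exact: cvg_cst.
    by rewrite -(mulr0 (nm a / 2)); apply: cvgMr.
  - move=> k; have := frac_le (nm a / 2) k; rewrite divr_gt0 // => /(_ isT) /=.
    move: (_ * _^-1) => X /andP[X0 X1]; apply/esym/const; [lra|lra|lra|left; lra].
rewrite -E0; apply/esym.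
apply: (@cmean_cst_lim G r1 _ (fun k => (nm a / 2) * (k.+1%:R)^-1)) => //.
- move=> k; have := frac_le (nm a / 2) k; rewrite divr_gt0 // => /(_ isT) /=.
    by move: (_ * _^-1) => X /andP[X0 X1]; apply/andP; split; lra.
- by rewrite lexx ltW // (lt_trans r0).
- by rewrite -(mulr0 (nm a / 2)); apply: cvgMr.
- move=> k; have := frac_le (nm a / 2) k; rewrite divr_gt0 // => /(_ isT) /=.
    move: (_ * _^-1) => X /andP[X0 X1]; apply: const => //; [lra|left; lra].
Qed.

End circle_means.

(** * Cauchy's formula and Taylor's theorem *)

Section cauchy_taylor.
Context {R : realType}.
Implicit Types (F G : R[i] -> R[i]) (z a : R[i]) (r rho : R).
Local Notation nm := (@Normc.normc R).

Lemma cdiffM F G z : cdiff F z -> cdiff G z -> cdiff (fun z => F z * G z) z.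
Proof.
move=> /cdiff_derivable dF /cdiff_derivable dG; apply: derivable_cdiff.
exact: (derivableM dF dG).
Qed.

Lemma cdiffB_cst F z w : cdiff F z -> cdiff (fun z => F z - w) z.
Proof.
move=> [l H]; exists l => e /H[del d0 Hd]; exists del => // z' /Hd.
by rewrite opprB addrA subrK.
Qed.

Lemma cdiff_id z : cdiff id z.
Proof.
exists 1 => e e0; exists 1 => // z' _.
by rewrite mul1r subrr Normc.normc0 mulr_ge0 ?normc_ge0 // ltW.
Qed.

Lemma cdiff_inv_sub a z : z != a -> cdiff (fun z => (z - a)^-1) z.
Proof.
move=> za; apply: derivable_cdiff.
apply: (@derivableV _ _ (fun w : (R[i])^o => w - a)).
  by rewrite subr_eq0.
by apply: derivableB; [exact: derivable_id|exact: derivable_cst].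
Qed.

(** The value w at a is meant to be the derivative of F there. *)
Definition dquot F a (w : R[i]) z : R[i] :=
  if z == a then w else (F z - F a) / (z - a).

Lemma cdiff_dquot F a w z : cdiff F z -> z != a ->
  cdiff (fun z => z * dquot F a w z) z.
Proof.
move=> dF za; have r0 : 0 < nm (z - a) by rewrite normc_gt0 subr_eq0.
apply: (@cdiff_near _ _ (fun z => z * ((F z - F a) / (z - a))) _ _ r0).
  move=> z' z'z; rewrite /dquot; case: eqP => // z'a.
  by move: z'z; rewrite z'a normc_distC ltxx.
apply: cdiffM; first exact: cdiff_id.
by apply: cdiffM; [exact: cdiffB_cst|exact: cdiff_inv_sub].
Qed.

Lemma dquot_exists F a : cdiff F a ->
  exists w, ccont (fun z => z * dquot F a w z) a.
Proof.
move=> [w H]; exists w; apply: ccontM; first exact: ccont_id.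
move=> e e0; have e20 : 0 < e / 2 by rewrite divr_gt0.
have [del d0 Hd] := H _ e20; exists del => // z zd.
rewrite /dquot eqxx; case: eqP => [_|/eqP za]; first by rewrite subrr Normc.normc0.
have n0 : 0 < nm (z - a) by rewrite normc_gt0 subr_eq0.
have -> : (F z - F a) / (z - a) - w = (F z - F a - w * (z - a)) / (z - a).
  by rewrite [RHS]mulrBl mulfK // subr_eq0.
rewrite Normc.normcM Normc.normcV ltr_pdivrMr //.
by apply: le_lt_trans (Hd _ zd) _; rewrite ltr_pM2r //; lra.
Qed.

Variables (rho r : R).
Hypotheses (r0 : 0 < r) (rrho : r < rho).

Local Notation zeta t := (r%:C * expi t).

Lemma circle_neq a t : nm a < r -> zeta t != a.
Proof.
by move=> ar; apply/eqP => E; move: ar; rewrite -E normc_circle ?ltxx // ltW.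
Qed.

Lemma circle_neq0 t : zeta t != 0.
Proof. by rewrite circle_neq // Normc.normc0. Qed.

Lemma Ccontinuous_on_circle F : (forall z, nm z < rho -> ccont F z) ->
  Ccontinuous (fun t => F (zeta t)).
Proof.
move=> cF; apply: (ccont_curve (F := F) (Ccontinuous_circle r)) => t.
by apply: cF; rewrite normc_circle // ltW.
Qed.

Lemma Ccontinuous_kernel a : nm a < r ->
  Ccontinuous (fun t => zeta t / (zeta t - a)).
Proof.
move=> ar; apply: CcontinuousM; first exact: Ccontinuous_circle.
apply: (ccont_curve (F := fun z => (z - a)^-1) (Ccontinuous_circle r)) => t.
by apply/cdiff_ccont/cdiff_inv_sub; exact: circle_neq.
Qed.

(** The function z (F z - F a) / (z - a) satisfies cmean_zero. *)
Lemma cauchy_formula F a : nm a < r -> (forall z, nm z < rho -> cdiff F z) ->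
  Cint 0 (2 * pi) (fun t => F (zeta t) * (zeta t / (zeta t - a))) =
  F a * Cint 0 (2 * pi) (fun t => zeta t / (zeta t - a)).
Proof.
move=> ar dF; have arho := lt_trans ar rrho.
have cF z : nm z < rho -> ccont F z by move=> zr; apply/cdiff_ccont/dF.
have [w cw] := dquot_exists (dF a arho).
have ck := Ccontinuous_kernel ar.
have dg z : nm z < rho -> z != a -> cdiff (fun z => z * dquot F a w z) z.
  by move=> zr za; apply: cdiff_dquot => //; exact: dF.
have cg z : nm z < rho -> ccont (fun z => z * dquot F a w z) z.
  move=> zr; have [->//|za] := eqVneq z a.
  by apply: cdiff_ccont; exact: dg.
have := @cmean_zero _ (fun z => z * dquot F a w z) _ _ _ (mul0r _) ar rrho cg dg.
rewrite /cmean (@eq_Cint _ _ _ _ (fun t => F (zeta t) * (zeta t / (zeta t - a)) -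
   F a * (zeta t / (zeta t - a)))); last first.
  by move=> t _; rewrite /dquot (negbTE (circle_neq t ar)); ring.
rewrite CintB; last 2 first.
- by apply: CcontinuousM => //; exact: Ccontinuous_on_circle.
- by apply: CcontinuousM => //; exact: Ccontinuous_cst.
by rewrite CintZ // => /eqP; rewrite subr_eq0 => /eqP.
Qed.

Definition circle_coef F n : R[i] :=
  Cint 0 (2 * pi) (fun t => (zeta t ^+ n)^-1 * F (zeta t)).

Lemma geometric_kernel a z N : z != 0 -> z != a ->
  z / (z - a) = \sum_(n < N) (a / z) ^+ n + (a / z) ^+ N * (z / (z - a)).
Proof.
move=> z0 za; have za0 : z - a != 0 by rewrite subr_eq0.
elim: N => [|N IH]; first by rewrite big_ord0 add0r expr0 mul1r.
rewrite big_ord_recr /= {1}IH -addrA; congr (_ + _).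
rewrite exprSr -mulrA -[X in _ = X + _]mulr1 -mulrDr; congr (_ * _).
by field; rewrite z0 za0.
Qed.

Lemma Ccontinuous_zetaVn n : Ccontinuous (fun t => (zeta t ^+ n)^-1).
Proof.
have -> : (fun t => (zeta t ^+ n)^-1) = (fun t => ((r ^+ n)^-1)%:C * expi (- n%:R * t)).
  apply/funext => t; rewrite exprMn expiX invfM -rmorphXn -fmorphV expiV mulNr //.
apply: CcontinuousM; first exact: Ccontinuous_cst.
exact: (Ccontinuous_comp Ccontinuous_expi (@continuous_scale _ (- n%:R))).
Qed.

(** Expanding the Cauchy kernel as a finite geometric sum with remainder. *)
Lemma cauchy_expansion F a B N : nm a < r -> (forall z, nm z < rho -> ccont F z) ->
  0 <= B -> (forall t, nm (F (zeta t)) <= B) ->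
  nm (Cint 0 (2 * pi) (fun t => F (zeta t) * (zeta t / (zeta t - a))) -
      \sum_(n < N) circle_coef F n * a ^+ n) <=
  2 * (2 * pi * (B * ((nm a / r) ^+ N * (r / (r - nm a))))).
Proof.
move=> ar cF B0 FB; have cf := Ccontinuous_on_circle cF.
have ck := Ccontinuous_kernel ar.
have sumC : forall N', Ccontinuous
      (fun t => \sum_(n < N') (a ^+ n * ((zeta t ^+ n)^-1 * F (zeta t)))) /\
    Cint 0 (2 * pi) (fun t => \sum_(n < N') (a ^+ n * ((zeta t ^+ n)^-1 * F (zeta t)))) =
      \sum_(n < N') circle_coef F n * a ^+ n.
  have cterm n : Ccontinuous (fun t => (zeta t ^+ n)^-1 * F (zeta t)).
    by apply: CcontinuousM => //; exact: Ccontinuous_zetaVn.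
  have cterm2 n : Ccontinuous (fun t => a ^+ n * ((zeta t ^+ n)^-1 * F (zeta t))).
    by apply: CcontinuousM => //; exact: Ccontinuous_cst.
  elim=> [|M [IH1 IH2]].
    under eq_fun do rewrite big_ord0; rewrite big_ord0.
    split; first exact: Ccontinuous_cst.
    by rewrite Cint_cst ?mulr0 // ltW // twopi_gt0.
  under eq_fun do rewrite big_ord_recr /=; rewrite big_ord_recr /=.
  split; first exact: CcontinuousD.
  by rewrite CintD // IH2 CintZ // /circle_coef [X in _ + X]mulrC.
have [s1 s2] := sumC N.
rewrite -s2 -CintB //; last exact: CcontinuousM.
have := @normc_Cint_le _ 0 (2 * pi) (fun t => F (zeta t) * (zeta t / (zeta t - a)) -
  \sum_(n < N) a ^+ n * ((zeta t ^+ n)^-1 * F (zeta t)))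
  (B * ((nm a / r) ^+ N * (r / (r - nm a)))).
rewrite subr0; apply.
- by apply: CcontinuousB => //; exact: CcontinuousM.
- by rewrite ltW // twopi_gt0.
move=> t _; have z0 := circle_neq0 t; have za := circle_neq t ar.
have -> : F (zeta t) * (zeta t / (zeta t - a)) -
    \sum_(n < N) a ^+ n * ((zeta t ^+ n)^-1 * F (zeta t)) =
    F (zeta t) * ((a / zeta t) ^+ N * (zeta t / (zeta t - a))).
  have E : F (zeta t) * \sum_(n < N) (a / zeta t) ^+ n =
      \sum_(n < N) a ^+ n * ((zeta t ^+ n)^-1 * F (zeta t)).
    by rewrite mulr_sumr; apply: eq_bigr => n _; rewrite expr_div_n mulrC mulrA.
  by rewrite {1}(geometric_kernel N z0 za) mulrDr E addrC addKr.
rewrite Normc.normcM; apply: ler_pM; rewrite ?normc_ge0 //.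
rewrite Normc.normcM normcX (Normc.normcM a) (Normc.normcM (zeta t)) !Normc.normcV.
rewrite normc_circle ?(ltW r0) // ler_wpM2l ?exprn_ge0 ?divr_ge0 ?normc_ge0 ?(ltW r0) //.
rewrite ler_wpM2l ?(ltW r0) // lef_pV2 ?posrE ?subr_gt0 //.
  have := ler_normcD (zeta t - a) a; rewrite subrK normc_circle ?(ltW r0) //.
  by rewrite -lerBlDr.
by rewrite normc_gt0 subr_eq0.
Qed.

(** For the constant function 1, only the first term of the expansion of the
    kernel contributes, and the remainder tends to 0. *)
Lemma cauchy_kernel_integral a : nm a < r ->
  Cint 0 (2 * pi) (fun t => zeta t / (zeta t - a)) = (2 * pi)%:C.
Proof.
move=> ar; have p0 := @twopi_gt0 R.
have c1 z : nm z < rho -> ccont (fun=> 1 : R[i]) z.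
  by move=> _ e e0; exists 1 => // z' _; rewrite subrr Normc.normc0.
have nB t : nm ((fun=> 1) (zeta t)) <= 1 by rewrite Normc.normc1.
have coefE n : circle_coef (fun=> 1) n = if n == 0%N then (2 * pi)%:C else 0.
  rewrite /circle_coef; case: eqP => [->|/eqP n0].
    under eq_fun do rewrite expr0 invr1 mulr1.
    by rewrite Cint_cst ?(ltW p0) // subr0 mulr1.
  have -> : (fun t => (zeta t ^+ n)^-1 * 1) =
      (fun t => ((r ^+ n)^-1)%:C * expi (- n%:R * t)).
    apply/funext => t; rewrite mulr1 exprMn expiX invfM -rmorphXn -fmorphV expiV mulNr //.
  rewrite CintZ; last first.
    exact: (Ccontinuous_comp Ccontinuous_expi (@continuous_scale _ (- n%:R))).
  rewrite Cint_expi ?mulr0 // ?oppr_eq0 ?pnatr_eq0 //.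
  by rewrite mulNr -expiJ expi_2pi conjc1.
have E N : \sum_(n < N.+1) circle_coef (fun=> 1) n * a ^+ n = (2 * pi)%:C.
  rewrite big_ord_recl /= coefE eqxx expr0 mulr1 big1 ?addr0 // => i _.
  by rewrite coefE mul0r.
have H N := cauchy_expansion N.+1 ar c1 ler01 nB.
pose I := Cint 0 (2 * pi) (fun t => zeta t / (zeta t - a)).
have HI N : nm (I - (2 * pi)%:C) <=
    2 * (2 * pi * (1 * ((nm a / r) ^+ N.+1 * (r / (r - nm a))))).
  by have := H N; rewrite E; under eq_fun do rewrite mul1r.
have lim : 2 * (2 * pi * (1 * ((nm a / r) ^+ N.+1 * (r / (r - nm a))))) @[N --> \oo]
    --> (0 : R).
  have q1 : `|nm a / r| < 1.
    by rewrite ger0_norm ?divr_ge0 ?normc_ge0 ?(ltW r0) // ltr_pdivrMr // mul1r.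
  have := cvg_comp _ _ (cvg_addnl 1) (cvg_expr q1) => /= H0.
  have -> : (0 : R) = 2 * (2 * pi * (1 * (0 * (r / (r - nm a))))).
    by rewrite mul0r !mulr0.
  by do 3! apply: cvgMr; apply: cvgMl; exact: H0.
have I0 : nm (I - (2 * pi)%:C) <= 0.
  rewrite -[leRHS](cvg_lim (@Rhausdorff R) lim).
  apply: limr_ge; first by apply/cvg_ex; eexists; exact: lim.
  by apply: nearW => N; exact: HI.
apply/eqP; rewrite -subr_eq0; apply/eqP/Normc.eq0_normc/eqP.
by rewrite eq_le normc_ge0 andbT.
Qed.

(** Taylor's theorem with a remainder that is geometrically small on smaller
    discs. *)
Lemma taylor F : (forall z, nm z < rho -> cdiff F z) ->
  exists (cf : nat -> R[i]) (C : R), 0 <= C /\ forall N a, nm a < r ->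
    nm (F a - \sum_(n < N) cf n * a ^+ n) <= C * ((nm a / r) ^+ N * (r / (r - nm a))).
Proof.
move=> dF; have p0 := @twopi_gt0 R.
have cF z : nm z < rho -> ccont F z by move=> zr; apply/cdiff_ccont/dF.
have [B [B0 HB]] : exists B, 0 <= B /\ forall z, nm z <= r -> nm (F z) <= B.
  by apply: ccont_bounded; [exact: ltW|move=> z zr; apply: cF; exact: le_lt_trans rrho].
have FB t : nm (F (zeta t)) <= B by apply: HB; rewrite normc_circle // ltW.
exists (fun n => ((2 * pi)^-1)%:C * circle_coef F n), (2 * B).
split; first by rewrite mulr_ge0.
move=> N a ar; have := cauchy_expansion N ar cF B0 FB.
rewrite cauchy_formula // cauchy_kernel_integral //.
have -> : F a * (2 * pi)%:C - \sum_(n < N) circle_coef F n * a ^+ n =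
   (2 * pi)%:C * (F a - \sum_(n < N) ((2 * pi)^-1)%:C * circle_coef F n * a ^+ n).
  rewrite mulrBr mulr_sumr mulrC; congr (_ - _); apply: eq_bigr => n _.
  by rewrite !mulrA -rmorphM divff ?mul1r // gt_eqF.
rewrite Normc.normcM normcC gtr0_norm // [X in _ <= X]mulrCA ler_pM2l //.
by rewrite !mulrA.
Qed.

End cauchy_taylor.

(** * Uniqueness of power series *)

Section power_series.
Context {R : realType}.
Implicit Types (a : nat -> R[i]).
Local Notation nm := (@Normc.normc R).

Lemma cdiffD (F G : R[i] -> R[i]) z : cdiff F z -> cdiff G z ->
  cdiff (fun z => F z + G z) z.
Proof.
move=> [l1 H1] [l2 H2]; exists (l1 + l2) => e e0.
have e20 : 0 < e / 2 by rewrite divr_gt0.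
have [d1 d10 K1] := H1 _ e20; have [d2 d20 K2] := H2 _ e20.
exists (Num.min d1 d2) => [|z']; first by rewrite lt_min d10.
rewrite lt_min => /andP[/K1 h1 /K2 h2].
have -> : F z' + G z' - (F z + G z) - (l1 + l2) * (z' - z) =
  (F z' - F z - l1 * (z' - z)) + (G z' - G z - l2 * (z' - z)) by ring.
apply: le_trans (ler_normcD _ _) _; lra.
Qed.

Lemma cdiff_cst (w z : R[i]) : cdiff (fun=> w) z.
Proof.
exists 0 => e e0; exists 1 => // z' _.
by rewrite subrr mul0r subrr Normc.normc0 mulr_ge0 ?normc_ge0 // ltW.
Qed.

Lemma cdiff_psum a n z : cdiff (fun z => \sum_(k < n) a k * z ^+ k) z.
Proof.
have pw k : cdiff (fun z => z ^+ k) z.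
  elim: k => [|k IH]; first exact: cdiff_cst.
  by under eq_fun do rewrite exprS; apply: cdiffM => //; exact: cdiff_id.
elim: n => [|n IH]; first by under eq_fun do rewrite big_ord0; exact: cdiff_cst.
under eq_fun do rewrite big_ord_recr /=.
by apply: cdiffD => //; apply: cdiffM => //; exact: cdiff_cst.
Qed.

Lemma half_geometric_sum N : \sum_(k < N) (2^-1 : R) ^+ k <= 2.
Proof.
suff -> : \sum_(k < N) (2^-1 : R) ^+ k = 2 - 2 * 2^-1 ^+ N.
  by rewrite lerBlDr lerDl mulr_ge0 // exprn_ge0 // invr_ge0.
elim: N => [|N IH]; first by rewrite big_ord0 expr0 mulr1 subrr.
by rewrite big_ord_recr /= IH exprS; field.
Qed.

(** At a point of convergence s > 0 the terms a_k s^k are bounded, so that the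
    first nonzero coefficient would dominate the rest of the series near 0. *)
Lemma power_series_unique a (s : R) : 0 < s ->
  (forall t : R, 0 < t <= s -> cvgC (fun N => \sum_(k < N) a k * t%:C ^+ k) 0) ->
  forall n, a n = 0.
Proof.
move=> s0 H.
have [B B0 HB] : exists2 B, 0 <= B & forall k, nm (a k) * s ^+ k <= B.
  have ss : 0 < s <= s by rewrite s0 lexx.
  have /cvgCP/cvgrPdist_lt/(_ 2^-1) := H s ss.
  rewrite invr_gt0 ltr0n => /(_ isT)[M _ HM].
  have HM2 N : (M <= N)%N -> nm (\sum_(k < N) a k * s%:C ^+ k) <= 2^-1.
    move=> /HM /=; rewrite subr0 sub0r normrN ger0_norm ?normc_ge0 //.
    exact: ltW.
  exists (1 + \sum_(k < M) nm (a k) * s ^+ k).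
    by rewrite addr_ge0 // sumr_ge0 // => k _; rewrite mulr_ge0 ?normc_ge0 ?exprn_ge0 // ltW.
  have p k : 0 <= nm (a k) * s ^+ k by rewrite mulr_ge0 ?normc_ge0 ?exprn_ge0 // ltW.
  move=> k; have [Mk|kM] := leqP M k; last first.
    rewrite (bigD1 (Ordinal kM)) //= addrA (addrC 1) -addrA lerDl addr_ge0 //.
    by rewrite sumr_ge0.
  apply: (@le_trans _ _ 1); last by rewrite lerDl sumr_ge0.
  have -> : nm (a k) * s ^+ k = nm (a k * s%:C ^+ k).
    by rewrite Normc.normcM normcX normcC ger0_norm // ltW.
  have -> : a k * s%:C ^+ k = \sum_(j < k.+1) a j * s%:C ^+ j - \sum_(j < k) a j * s%:C ^+ j.
    by rewrite big_ord_recr /= addrAC subrr add0r.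
  apply: le_trans (ler_normcB _ _) _; rewrite [leRHS](splitr 1) mul1r.
  by rewrite lerD // HM2 // ltnW.
elim/ltn_ind => n IH; apply: Normc.eq0_normc; apply/eqP; rewrite eq_le normc_ge0 andbT.
have key (t : R) : 0 < t -> t <= s / 2 -> nm (a n) <= 2 * B / s ^+ n.+1 * t.
  move=> t0 ts; have tS : 0 < t <= s by rewrite t0 (le_trans ts) // ler_pdivrMr // ler_peMr ?ler1n // ltW.
  have x0 : 0 <= t / s by rewrite divr_ge0 // ltW.
  have x1 : t / s <= 2^-1 by rewrite ler_pdivrMr // mulrC.
  have bound N : nm (a n) * t ^+ n <= 2 * B * (t / s) ^+ n.+1 +
      nm (\sum_(k < n.+1 + N) a k * t%:C ^+ k).
    have E : \sum_(k < n.+1 + N) a k * t%:C ^+ k = a n * t%:C ^+ n +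
        \sum_(k < N) a (n.+1 + k)%N * t%:C ^+ (n.+1 + k).
      rewrite big_split_ord /= big_ord_recr /= big1 ?add0r // => k _.
      by rewrite IH ?mul0r.
    have tail : nm (\sum_(k < N) a (n.+1 + k)%N * t%:C ^+ (n.+1 + k)) <=
        2 * B * (t / s) ^+ n.+1.
      apply: le_trans (ler_normc_sum _ (fun k => a (n.+1 + k)%N * t%:C ^+ (n.+1 + k))) _.
      apply: (@le_trans _ _ (\sum_(k < N) B * (t / s) ^+ n.+1 * 2^-1 ^+ k)).
        apply: ler_sum => k _; rewrite Normc.normcM normcX normcC ger0_norm ?(ltW t0) //.
        have -> : nm (a (n.+1 + k)%N) * t ^+ (n.+1 + k) =
            (nm (a (n.+1 + k)%N) * s ^+ (n.+1 + k)) * ((t / s) ^+ n.+1 * (t / s) ^+ k).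
          by rewrite -exprD -mulrA -exprMn [s * _]mulrC divfK // gt_eqF.
        rewrite -[leRHS]mulrA; apply: ler_pM => //.
        - by rewrite mulr_ge0 ?normc_ge0 ?exprn_ge0 // ltW.
        - by rewrite mulr_ge0 ?exprn_ge0.
        - by rewrite ler_wpM2l ?exprn_ge0 // lerXn2r ?nnegrE // invr_ge0.
      rewrite -mulr_sumr mulrAC [2 * B]mulrC ler_wpM2r ?exprn_ge0 //.
      by rewrite ler_wpM2l // half_geometric_sum.
    have -> : nm (a n) * t ^+ n = nm (a n * t%:C ^+ n).
      by rewrite Normc.normcM normcX normcC ger0_norm // ltW.
    have -> : a n * t%:C ^+ n = (a n * t%:C ^+ n +
        \sum_(k < N) a (n.+1 + k)%N * t%:C ^+ (n.+1 + k)) -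
        \sum_(k < N) a (n.+1 + k)%N * t%:C ^+ (n.+1 + k) by rewrite addrK.
    by rewrite -E; apply: le_trans (ler_normcB _ _) _; rewrite addrC lerD2r.
  have lim0 : 2 * B * (t / s) ^+ n.+1 + nm (\sum_(k < n.+1 + N) a k * t%:C ^+ k)
      @[N --> \oo] --> 2 * B * (t / s) ^+ n.+1 + 0.
    apply: cvgD; first exact: cvg_cst.
    have /cvgCP c0 := H t tS.
    have := cvg_comp _ _ (cvg_addnl n.+1) c0.
    by apply: cvg_trans; apply: near_eq_cvg; apply: nearW => N /=; rewrite subr0.
  have : nm (a n) * t ^+ n <= 2 * B * (t / s) ^+ n.+1.
    rewrite -[leRHS]addr0 -(cvg_lim (@Rhausdorff R) lim0).
    by apply: limr_ge; [apply/cvg_ex; eexists; exact: lim0|exact: nearW].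
  rewrite -ler_pdivlMr ?exprn_gt0 //; move=> /le_trans; apply.
  rewrite le_eqVlt; apply/orP; left; apply/eqP.
  rewrite expr_div_n exprS; field.
  by rewrite !gt_eqF // exprn_gt0.
have Q0 : 0 <= 2 * B / s ^+ n.+1 by rewrite divr_ge0 ?mulr_ge0 ?exprn_ge0 // ltW.
apply/ler_addgt0Pl => e e0; rewrite addr0.
pose t := Num.min (s / 2) (e / (2 * B / s ^+ n.+1 + 1)).
have Q1 : 0 < 2 * B / s ^+ n.+1 + 1 by rewrite ltr_wpDl.
have t0 : 0 < t by rewrite lt_min !divr_gt0.
apply: le_trans (key t t0 _) _; first by rewrite ge_min lexx.
have : t <= e / (2 * B / s ^+ n.+1 + 1) by rewrite ge_min lexx orbT.
rewrite ler_pdivlMr //.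
move: (2 * B / s ^+ n.+1) Q0 => Q Q0; nra.
Qed.

End power_series.

(** * The Segal-Bargmann transform *)

Section segal_bargmann_theory.
Context {R : realType}.
Variables q beta : R.
Hypotheses (hq0 : 0 <= q) (hq1 : q < 1) (hbeta : 0 < beta).
Variable mu : probability R R.
Hypothesis hmu : is_qpoisson q beta mu.

Local Notation nm := (@Normc.normc R).
Local Notation c := (cnorm q beta).
Local Notation e := (charlier_fun q beta).
Local Notation m := (mono q beta).
Local Notation nu := (nu_q q beta).
Local Notation cutD := (cut q beta).
Local Notation S := (segal_bargmann q beta mu).
Local Notation coef f := (orth_coef mu e c f).

Let q1 : 0 < 1 - q. Proof. by rewrite subr_gt0. Qed.
Let K0 : 0 < beta / (1 - q). Proof. by rewrite divr_gt0. Qed.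
Let eL := L2_charlier hmu.
Let eo := l2dot_charlier hq0 hq1 hbeta hmu.
Let mL := L2_mono hq0 hq1 hbeta.
Let mo := l2dot_mono hq0 hq1 hbeta.
Let cp := cnorm_gt0 hq0 hq1 hbeta.

Lemma mu_fin : (mu setT < +oo)%E.
Proof. by rewrite [X in (X < _)%E](_ : _ = 1%E) ?ltry //; exact: probability_setT. Qed.

Lemma cut_psum (a : nat -> R[i]) N :
  cutD (fun z => \sum_(k < N) a k * z ^+ k) = orth_psum m a N.
Proof.
apply/funext => p; rewrite /cut mulr_sumr /orth_psum.
by apply: eq_bigr => k _; rewrite mulrCA.
Qed.

Lemma nu_sqnormE F : nu_sqnorm q beta F = l2sqnorm nu (cutD F).
Proof. by rewrite /nu_sqnorm nu_dotE l2dotff. Qed.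

Lemma l2sqnorm_bounded d (T : measurableType d) (P : {measure set T -> \bar R})
    (f : T -> R[i]) M : P setT = 1%E -> L2 P f -> (forall x, sqmod (f x) <= M) ->
  l2sqnorm P f <= M.
Proof.
move=> P1 fi fM.
have -> : M = \int[P]_x M by rewrite Rintegral_cst // P1 mulr1.
apply: le_Rintegral => //; first exact: L2_sqmod.
by apply: (@bounded_Rintegrable _ _ _ _ _ `|M|) => //; rewrite P1 ltry.
Qed.

(** u and f are the sums of series with the same coefficients, over the powers
    of z and over the q-Charlier polynomials. Two such sums correspond under the
    Segal-Bargmann transform. *)
Definition represents (u : R[i] -> R[i]) (f : R -> R[i]) := exists a : nat -> R[i],
  [/\ L2 mu f, cvgL2 mu (orth_psum e a) f
    & exists2 b : nat -> R, b N @[N --> \oo] --> (0 : R) &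
      forall N z, cOmega q beta z -> nm (u z - \sum_(k < N) a k * z ^+ k) <= b N].

(** Since u is holomorphic on a larger disc, its Taylor series converges
    uniformly on the closed disc. So its partial sums are bounded in L^2(nu),
    where the monomials have the norms of the q-Charlier polynomials: this makes
    the orthogonal series converge in L^2(mu). *)
Lemma represents_exists u : holomorphic_near (cOmega q beta) u ->
  exists f, represents u f.
Proof.
move=> [U [oU KU dU]]; pose rho := Num.sqrt (beta / (1 - q)).
have rho0 : 0 < rho by rewrite sqrtr_gt0.
have rhoE : rho ^+ 2 = beta / (1 - q) by rewrite sqr_sqrtr // ltW.
have inK z : nm z <= rho -> cOmega q beta z.
  by rewrite /cOmega /= -rhoE normc_le_sqmod // ltW.
have Kin z : cOmega q beta z -> nm z <= rho.
  by rewrite /cOmega /= -rhoE normc_le_sqmod // ltW.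
have [rho' rr' HU] := open_disc_enlarge rho0 oU (fun z zr => KU z (inK z zr)).
have [r rhor rrho'] : exists2 r, rho < r & r < rho'.
  by exists ((rho + rho') / 2); lra.
have r0 : 0 < r by exact: lt_trans rhor.
have [a [C [C0 HC]]] := taylor r0 rrho' (fun z zr => derivable_cdiff (dU z (HU z zr))).
pose b N := C * ((rho / r) ^+ N * (r / (r - rho))).
have t0 : 0 <= rho / r by rewrite divr_ge0 // ltW.
have t1 : rho / r < 1 by rewrite ltr_pdivrMr // mul1r.
have rr0 : 0 < r - rho by rewrite subr_gt0.
have b0 : b N @[N --> \oo] --> (0 : R).
  have -> : (0 : R) = C * (0 * (r / (r - rho))) by rewrite mul0r mulr0.
  by apply: cvgMr; apply: cvgMl; apply: cvg_expr; rewrite ger0_norm.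
have bd N z : cOmega q beta z -> nm (u z - \sum_(k < N) a k * z ^+ k) <= b N.
  move=> /Kin zr; apply: le_trans (HC N z (le_lt_trans zr rhor)) _.
  have zr0 : 0 <= nm z / r by rewrite divr_ge0 ?normc_ge0 // ltW.
  have rz0 : 0 < r - nm z by rewrite subr_gt0; exact: le_lt_trans rhor.
  have i1 : (nm z / r) ^+ N <= (rho / r) ^+ N.
    by apply: lerXn2r; rewrite ?nnegrE // ler_wpM2r // invr_ge0 ltW.
  have i2 : r / (r - nm z) <= r / (r - rho).
    by rewrite ler_wpM2l ?(ltW r0) // lef_pV2 ?posrE // lerD2l lerN2.
  apply: ler_wpM2l => //; apply: ler_pM => //; first exact: exprn_ge0.
  by rewrite divr_ge0 // ltW.
have b_ge0 N : 0 <= b N.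
  by rewrite mulr_ge0 // mulr_ge0 ?exprn_ge0 // divr_ge0 // ltW.
have b_dec N : b N <= b 0%N.
  rewrite ler_wpM2l // ler_wpM2r ?divr_ge0 ?(ltW r0) ?(ltW rr0) //.
  by rewrite expr0 exprn_ile1 // ltW.
have wb N : weighted_psum c a N <= (b 0%N + b 0%N) ^+ 2.
  rewrite -(l2sqnorm_orth_psum mL mo); apply: l2sqnorm_bounded.
  - exact: nu_setT.
  - exact: L2_orth_psum.
  move=> p; rewrite -cut_psum sqmodE lerXn2r ?nnegrE ?normc_ge0 ?addr_ge0 //.
  have [Dp|nDp] := pselect ((toC @^-1` cOmega q beta) p); last first.
    by rewrite cut_out // Normc.normc0 addr_ge0.
  rewrite cut_in //; have h1 := bd N _ Dp; have h2 := bd 0%N _ Dp.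
  rewrite big_ord0 subr0 in h2.
  have -> : \sum_(k < N) a k * toC p ^+ k = u (toC p) -
     (u (toC p) - \sum_(k < N) a k * toC p ^+ k) by rewrite opprB addrCA subrr addr0.
  apply: le_trans (ler_normcB _ _) _; apply: lerD => //.
  exact: le_trans h1 (b_dec N).
have [f fi af] := riesz_fischer mu_fin (L2_orth_psum eL a)
  (orth_psum_cauchy eL eo wb).
by exists f, a; split => //; exists b.
Qed.

Lemma represents_L2 u f : represents u f -> L2 mu f.
Proof. by move=> [a []]. Qed.

Lemma representsB u v f g : represents u f -> represents v g ->
  represents (fun z => u z - v z) (fun x => f x - g x).
Proof.
move=> [a [fi af [b b0 bd]]] [a' [gi ag [b' b'0 bd']]].
exists (fun k => a k - a' k); split; first exact: L2B.
- have -> : orth_psum e (fun k => a k - a' k) =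
      fun N x => orth_psum e a N x - orth_psum e a' N x.
    apply/funext => N; apply/funext => x; rewrite /orth_psum -sumrB.
    by apply: eq_bigr => k _; rewrite mulrBl.
  by apply: cvgL2_dist => // N; exact: L2_orth_psum.
- exists (fun N => b N + b' N); first by rewrite -[X in _ --> X]addr0; exact: cvgD.
  move=> N z zK; rewrite (eq_bigr (fun k : 'I_N => a k * z ^+ k - a' k * z ^+ k)).
    rewrite sumrB.
    have -> : u z - v z - (\sum_(i < N) a i * z ^+ i - \sum_(i < N) a' i * z ^+ i) =
      (u z - \sum_(i < N) a i * z ^+ i) - (v z - \sum_(i < N) a' i * z ^+ i) by ring.
    by apply: le_trans (ler_normcB _ _) _; apply: lerD; [exact: bd|exact: bd'].
  by move=> k _; rewrite mulrBl.
Qed.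

Lemma cut_cvg u (a : nat -> R[i]) (b : nat -> R) :
  b N @[N --> \oo] --> (0 : R) ->
  (forall N z, cOmega q beta z -> nm (u z - \sum_(k < N) a k * z ^+ k) <= b N) ->
  L2 nu (cutD u) /\ cvgL2 nu (orth_psum m a) (cutD u).
Proof.
move=> b0 bd.
have b_ge0 N : 0 <= b N.
  apply: le_trans (normc_ge0 _) (bd N 0 _).
  by rewrite /cOmega /= sqmod0 ltW.
have close N p : nm (orth_psum m a N p - cutD u p) <= b N.
  rewrite -cut_psum normc_distC.
  have [Dp|nDp] := pselect ((toC @^-1` cOmega q beta) p).
    by rewrite !cut_in //; exact: bd.
  by rewrite !cut_out // subrr Normc.normc0.
have pt p : cvgC (fun N => orth_psum m a N p) (cutD u p).
  by apply: cvgC_le b0.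
have bsq : b N ^+ 2 @[N --> \oo] --> (0 : R).
  by rewrite -(mulr0 (0 : R)); apply: cvgM.
have mc : Cmeasurable (cutD u).
  have mm N := L2_Cmeasurable (L2_orth_psum mL a N).
  split.
  - apply: (@measurable_fun_cvg _ _ _ _ (fun N p => complex.Re (orth_psum m a N p))).
      by move=> N; case: (mm N).
    move=> p _; apply/cvgrPdist_le => eps eps0.
    have /cvgCP/cvgrPdist_le/(_ _ eps0) := pt p; apply: filterS => N.
    rewrite sub0r normrN ger0_norm ?normc_ge0 //; apply: le_trans.
    by rewrite distrC -ReN -ReD; exact: le_Re_normc.
  - apply: (@measurable_fun_cvg _ _ _ _ (fun N p => complex.Im (orth_psum m a N p))).
      by move=> N; case: (mm N).
    move=> p _; apply/cvgrPdist_le => eps eps0.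
    have /cvgCP/cvgrPdist_le/(_ _ eps0) := pt p; apply: filterS => N.
    rewrite sub0r normrN ger0_norm ?normc_ge0 //; apply: le_trans.
    by rewrite distrC -ImN -ImD; exact: le_Im_normc.
have cL : L2 nu (cutD u).
  apply: (@L2_le _ _ _ _ _ (fun=> b 0%N ^+ 2)) => //.
    by apply: (@bounded_Rintegrable _ _ _ _ _ `|b 0%N ^+ 2|) => //; exact: nu_fin.
  move=> p; rewrite sqmodE lerXn2r ?nnegrE ?normc_ge0 //.
  by have := close 0%N p; rewrite /orth_psum big_ord0 sub0r normc_opp.
split => //.
apply: (@squeeze_cvgr _ _ _ _ (fun=> 0) (fun N => b N ^+ 2)) => //; last exact: cvg_cst.
apply: nearW => N; rewrite l2sqnorm_ge0 /=; apply: l2sqnorm_bounded.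
- exact: nu_setT.
- by apply: L2B => //; exact: L2_orth_psum.
- by move=> p; rewrite sqmodE lerXn2r ?nnegrE ?normc_ge0 ?b_ge0 ?close.
Qed.

(** Both sides are limits of the same finite sums. *)
Lemma represents_dot u v f g : represents u f -> represents v g ->
  nu_dot q beta u v = l2dot mu f g.
Proof.
move=> [a [fi af [b b0 bd]]] [a' [gi ag [b' b'0 bd']]].
have [uL uc] := cut_cvg b0 bd; have [vL vc] := cut_cvg b'0 bd'.
rewrite nu_dotE.
have H1 := l2dot_cvg (L2_orth_psum mL a) uL (L2_orth_psum mL a') vL uc vc.
have H2 := l2dot_cvg (L2_orth_psum eL a) fi (L2_orth_psum eL a') gi af ag.
apply: (cvgC_unique H1); rewrite (_ : (fun N => _) =
  fun N => l2dot mu (orth_psum e a N) (orth_psum e a' N)) //.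
by apply/funext => N; rewrite (l2dot_orth_psum mL mo) (l2dot_orth_psum eL eo).
Qed.

Lemma represents_sqnorm u f : represents u f -> nu_sqnorm q beta u = l2sqnorm mu f.
Proof. by move=> uf; rewrite /nu_sqnorm (represents_dot uf uf) l2dotff. Qed.

Definition coherent_coef (z : R[i]) n := (c n)^-1%:C * z ^+ n.

(** The defining series converges by cvg_inv_cnorm, so the choice made in
    coherent falls on its sum. *)
Lemma coherentP z : Omega q beta z ->
  L2 mu (coherent q beta mu z) /\
  cvgL2 mu (orth_psum e (coherent_coef z)) (coherent q beta mu z).
Proof.
move=> zO; have psE N : orth_psum e (coherent_coef z) N = coherent_psum q beta z N.
  apply/funext => x; apply: eq_bigr => k _.
  by rewrite /coherent_coef rmorphM -/(cnorm q beta k); ring.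
have cvs : cvgn (weighted_psum c (coherent_coef z)).
  have -> : weighted_psum c (coherent_coef z) =
      series (fun n => sqmod z ^+ n / c n).
    apply/funext => N; rewrite /series /= big_mkord; apply: eq_bigr => k _.
    rewrite /coherent_coef sqmodM sqmodC.
    have -> : sqmod (z ^+ k) = sqmod z ^+ k.
      by rewrite !sqmodE normcX -!exprM mulnC.
    by field; rewrite gt_eqF.
  by apply: cvg_inv_cnorm => //; exact: sqmod_ge0.
have wb N : weighted_psum c (coherent_coef z) N <= limn (weighted_psum c (coherent_coef z)).
  apply: nondecreasing_cvgn_le => // i j; exact: weighted_psum_nd eL eo _ _ _.
have [E Ei Ec] := riesz_fischer mu_fin (L2_orth_psum eL (coherent_coef z))
  (orth_psum_cauchy eL eo wb).
have ex : exists E, [set E | L2 mu E /\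
    (fun N => l2sqnorm mu (fun x => coherent_psum q beta z N x - E x)) @ \oo
      --> (0 : R)] E.
  exists E; split => //; move: Ec; rewrite /cvgL2.
  by under eq_fun do rewrite psE.
have [L C] := xgetPex (fun=> 0) ex; split; first exact: L.
by rewrite /cvgL2; under eq_fun do rewrite psE; exact: C.
Qed.

Lemma Omega_conj z : Omega q beta z -> Omega q beta (conjc z).
Proof. by rewrite /Omega /= sqmodJ. Qed.

Lemma coherent_L2 z : Omega q beta z -> L2 mu (coherent q beta mu (conjc z)).
Proof. by move=> /Omega_conj/coherentP[]. Qed.

(** The inner product is continuous, so the transform acts term by term. *)
Lemma segal_bargmann_series f z : L2 mu f -> Omega q beta z ->
  cvgC (fun N => \sum_(n < N) coef f n * z ^+ n) (S f z).
Proof.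
move=> fi zO; have [Ei Ec] := coherentP (Omega_conj zO).
have cst : cvgL2 mu (fun=> f) f.
  rewrite /cvgL2; under eq_fun do under eq_fun do rewrite subrr.
  rewrite (_ : l2sqnorm _ _ = 0); first exact: cvg_cst.
  rewrite /l2sqnorm; under eq_Rintegral do rewrite sqmod0.
  by rewrite Rintegral_cst // mul0r.
have H := l2dot_cvg (L2_orth_psum eL (coherent_coef (conjc z))) Ei (fun=> fi) fi Ec cst.
rewrite (_ : (fun N => _) =
  fun N => l2dot mu (orth_psum e (coherent_coef (conjc z)) N) f) //.
apply/funext => N; rewrite /orth_psum.
rewrite (@l2dot_suml _ _ _ _ _ _ (fun k x => coherent_coef (conjc z) k * e k x)) //.
  apply: eq_bigr => k _; rewrite l2dotZl // /coherent_coef conjcM conjcX conjcK conjc_real.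
  by rewrite /orth_coef; ring.
by move=> k; exact: L2Z.
Qed.

Lemma Omega_cOmega z : Omega q beta z -> cOmega q beta z.
Proof. by move=> /ltW. Qed.

Lemma represents_segal_bargmann u f z : represents u f -> Omega q beta z ->
  S f z = u z.
Proof.
move=> [a [fi af [b b0 bd]]] zO.
apply: (cvgC_unique (segal_bargmann_series fi zO)).
apply: (cvgC_le _ b0) => N.
rewrite (eq_bigr (fun n : 'I_N => a n * z ^+ n)).
  by rewrite normc_distC; apply: bd; exact: Omega_cOmega.
by move=> n _; rewrite (orth_psum_cvg eL eo cp fi af).
Qed.

Lemma segal_bargmann_cvg (fk : nat -> R -> R[i]) f z : (forall k, L2 mu (fk k)) ->
  L2 mu f -> cvgL2 mu fk f -> Omega q beta z -> cvgC (fun k => S (fk k) z) (S f z).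
Proof. by move=> fki fi fc zO; apply: l2dot_cvgr => //; exact: coherent_L2. Qed.

Lemma segal_bargmannB f g z : L2 mu f -> L2 mu g -> Omega q beta z ->
  S (fun x => f x - g x) z = S f z - S g z.
Proof. by move=> fi gi zO; apply: l2dotBr => //; exact: coherent_L2. Qed.

(** A vanishing power series has vanishing coefficients, so f is orthogonal to
    all the q-Charlier polynomials. *)
Lemma segal_bargmann_inj f : L2 mu f -> (forall z, Omega q beta z -> S f z = 0) ->
  l2sqnorm mu f = 0.
Proof.
move=> fi Sf0; apply: l2sqnorm_ae0 => //; apply: (charlier_complete hmu) => // n.
pose s := Num.sqrt (beta / (1 - q)) / 2.
have s0 : 0 < s by rewrite divr_gt0 // sqrtr_gt0.
have a0 : coef f n = 0.
  apply: (power_series_unique s0) => t /andP[t0 ts].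
  have tO : Omega q beta t%:C.
    rewrite /Omega /= sqmodC -[ltRHS]sqr_sqrtr ?(ltW K0) //.
    rewrite ltrXn2r ?nnegrE ?sqrtr_ge0 ?(ltW t0) //; apply: le_lt_trans ts _.
    by rewrite /s ltr_pdivrMr // ltr_pMr ?ltr1n // sqrtr_gt0.
  by have := segal_bargmann_series fi tO; rewrite (Sf0 _ tO).
by move: a0; rewrite /orth_coef => /eqP; rewrite mulf_eq0 => /orP[|/eqP //];
  rewrite fmorph_eq0 invr_eq0 gt_eqF.
Qed.

(** The partial sums of the power series approximate, by Bessel's inequality. *)
Lemma hardy_segal_bargmann f : L2 mu f -> hardy q beta (S f).
Proof.
move=> fi; exists (fun k z => \sum_(n < k) coef f n * z ^+ n); split.
- move=> k; exists setT; split => //; first exact: openT.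
  by move=> z _; apply: cdiff_derivable; exact: cdiff_psum.
- move=> eps eps0.
  have [N HN] := orth_psum_cauchy mL mo (fun n => bessel eL eo cp n fi) eps0.
  exists N => k l Nk Nl; rewrite nu_sqnormE.
  have -> : cutD (fun z => \sum_(n < k) coef f n * z ^+ n -
      \sum_(n < l) coef f n * z ^+ n) =
      fun p => orth_psum m (coef f) k p - orth_psum m (coef f) l p.
    by apply/funext => p; rewrite cutB !cut_psum.
  exact: HN.
- by move=> z zO; exact: segal_bargmann_series.
Qed.

(** An approximating sequence in the Hardy space is the image of a Cauchy
    sequence of L^2(mu). *)
Lemma hardy_approx_preimage F u : hardy_approx q beta F u ->
  exists fk f, [/\ forall k, represents (u k) (fk k), L2 mu f, cvgL2 mu fk f
    & forall z, Omega q beta z -> S f z = F z].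
Proof.
move=> [hu cu pu].
have [fk fkP] := choice (fun k => represents_exists (hu k)).
have fki k := represents_L2 (fkP k).
have [|f fi fc] := @riesz_fischer _ _ _ mu mu_fin fk fki.
  move=> eps /cu[N HN]; exists N => k l Nk Nl.
  by rewrite -(represents_sqnorm (representsB (fkP k) (fkP l))); exact: HN.
exists fk, f; split => // z zO.
apply: (cvgC_unique (segal_bargmann_cvg fki fi fc zO)).
under eq_fun do rewrite (represents_segal_bargmann (fkP _) zO).
exact: pu.
Qed.

(** The preimages of the approximating functions converge to f itself, because
    the transform is injective. *)
Lemma hardy_approx_segal_bargmann f u : L2 mu f -> hardy_approx q beta (S f) u ->
  exists fk, (forall k, represents (u k) (fk k)) /\ cvgL2 mu fk f.
Proof.
move=> fi /hardy_approx_preimage[fk [g [fkP gi gc Sg]]]; exists fk; split => //.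
have gf : l2sqnorm mu (fun x => g x - f x) = 0.
  apply: segal_bargmann_inj; first exact: L2B.
  by move=> z zO; rewrite segal_bargmannB // Sg // subrr.
have fki k := represents_L2 (fkP k).
apply: (@squeeze_cvgr _ _ _ _ (fun=> 0)
  (fun k => 2 * l2sqnorm mu (fun x => fk k x - g x))).
- apply: nearW => k; rewrite l2sqnorm_ge0 /=.
  have := l2sqnormD_le (L2B (fki k) gi) (L2B gi fi); rewrite gf mulr0 addr0.
  congr (_ <= _); apply: eq_Rintegral => x _; congr sqmod.
  by rewrite addrA subrK.
- exact: cvg_cst.
- by rewrite -(mulr0 2); apply: cvgMr.
Qed.

Lemma hardy_dot_segal_bargmann f g : L2 mu f -> L2 mu g ->
  hardy_dot q beta (S f) (S g) = l2dot mu f g.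
Proof.
move=> fi gi; rewrite /hardy_dot /=.
move: (xgetPex (fun _ _ => 0) (hardy_segal_bargmann fi)).
move: (xget _ (hardy_approx q beta (S f))) => u uP.
move: (xgetPex (fun _ _ => 0) (hardy_segal_bargmann gi)).
move: (xget _ (hardy_approx q beta (S g))) => v vP.
have [fk [fkP fc]] := hardy_approx_segal_bargmann fi uP.
have [gk [gkP gc]] := hardy_approx_segal_bargmann gi vP.
have fki k := represents_L2 (fkP k); have gki k := represents_L2 (gkP k).
have E : (fun k => nu_dot q beta (u k) (v k)) = fun k => l2dot mu (fk k) (gk k).
  by apply/funext => k; rewrite (represents_dot (fkP k) (gkP k)).
by apply: limC_eq; rewrite E; exact: l2dot_cvg.
Qed.

Lemma segal_bargmann_ae f g z : L2 mu f -> L2 mu g ->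
  (\forall x \ae mu, f x = g x) -> Omega q beta z -> S f z = S g z.
Proof.
move=> fi gi fg zO; apply/eqP; rewrite -subr_eq0 -segal_bargmannB //.
have Ei := coherent_L2 zO; have di := L2B fi gi.
have n0 : l2sqnorm mu (fun x => f x - g x) = 0.
  by apply: l2sqnorm_ae0 => //; apply: filterS fg => x ->; rewrite subrr.
have := l2dot_CauchySchwarz Ei di; rewrite n0 mulr0 => H.
have : sqmod (S (fun x => f x - g x) z) == 0 by rewrite eq_le H sqmod_ge0.
by rewrite sqmodE expf_eq0 => /andP[_ /eqP /Normc.eq0_normc ->].
Qed.

End segal_bargmann_theory.

Theorem proposition4p1 (R : realType) (q beta : R) (hq0 : 0 <= q) (hq1 : q < 1)
    (hbeta : 0 < beta) (mu : probability R R) (hmu : is_qpoisson q beta mu) :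
  let S := segal_bargmann q beta mu in
  [/\ (* S is well defined on classes modulo almost everywhere equality *)
      forall f g : R -> R[i], L2 mu f -> L2 mu g ->
        (\forall x \ae mu, f x = g x) ->
        forall z, Omega q beta z -> S f z = S g z,
      forall (a : R[i]) (f g : R -> R[i]), L2 mu f -> L2 mu g ->
        forall z, Omega q beta z ->
          S (fun x => a * f x + g x) z = a * S f z + S g z,
      forall f : R -> R[i], L2 mu f -> hardy q beta (S f),
      forall f g : R -> R[i], L2 mu f -> L2 mu g ->
        hardy_dot q beta (S f) (S g) = l2dot mu f g
    & forall F : R[i] -> R[i], hardy q beta F ->
        exists2 f : R -> R[i], L2 mu f &
          forall z, Omega q beta z -> S f z = F z].
Proof.
move=> S; split.
- by move=> f g fi gi fg z zO; exact: segal_bargmann_ae.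
- move=> a f g fi gi z zO; have Ei := coherent_L2 hq0 hq1 hbeta hmu zO.
  by rewrite /S /segal_bargmann l2dotDr ?l2dotZr //; exact: L2Z.
- by move=> f; exact: hardy_segal_bargmann.
- by move=> f g; exact: hardy_dot_segal_bargmann.
- move=> F [u /(hardy_approx_preimage hq0 hq1 hbeta hmu)[fk [f [_ fi _ Sf]]]].
  by exists f.
Qed.
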